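(* Let $X$ and $Y$ be simply connected topological spaces of finite type over $\mathbb{Q}$, and let $f:X\to Y$ be a continuous map that is rationally elliptic with respect to kernel. Assume that the homology rank of the source $X$ is finite, i.e. $\dim H_*(X;\mathbb{Q})=\sum_{i\geq 0}\dim H_i(X;\mathbb{Q})<\infty$. If $P_f(1)>1$, i.e. there exists some integer $i$ such that $H_i(f;\mathbb{Q}):H_i(X;\mathbb{Q})\to H_i(Y;\mathbb{Q})$ is not injective, then there exists a positive integer $n_0$ such that for all integers $n\geq n_0$ the strict inequality $P^{\pi}_{f^n}(1)<P_{f^n}(1)$ holds, i.e. $$\sum_{i\geq 2}\dim\left(\operatorname{Ker}(\pi_i(f^n)\otimes\mathbb{Q})\right)<1+\sum_{i\geq 2}\dim\left(\operatorname{Ker}H_i(f^n;\mathbb{Q})\right).$$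
   Context: A simply connected space is in particular path-connected. A space $X$ is of finite type over $\mathbb{Q}$ if $\dim H_i(X;\mathbb{Q})<\infty$ for every $i$; for simply connected $X$ this implies $\dim(\pi_i(X)\otimes\mathbb{Q})<\infty$ for every $i$. For a continuous map $f:X\to Y$ of simply connected spaces, $H_i(f;\mathbb{Q}):H_i(X;\mathbb{Q})\to H_i(Y;\mathbb{Q})$ and $\pi_i(f)\otimes\mathbb{Q}:\pi_i(X)\otimes\mathbb{Q}\to\pi_i(Y)\otimes\mathbb{Q}$ are the induced homomorphisms, and all dimensions are over $\mathbb{Q}$. The map $f$ is called rationally elliptic with respect to kernel if $\sum_i\dim(\operatorname{Ker}H_i(f;\mathbb{Q}))<\infty$ and $\sum_i\dim(\operatorname{Ker}(\pi_i(f)\otimes\mathbb{Q}))<\infty$. For such $f$ the homological and homotopical Poincaré polynomials of $f$ are $$P_f(t):=1+\sum_{i\geq 2}t^i\dim\left(\operatorname{Ker}H_i(f;\mathbb{Q})\right),\qquad P^{\pi}_f(t):=\sum_{i\geq 2}t^i\dim\left(\operatorname{Ker}(\pi_i(f)\otimes\mathbb{Q})\right).$$ For $n\geq 1$, $X^n$ is the $n$-fold product of $X$ with itself, and $f^n:X^n\to Y^n$ is the map $f^n(x_1,\dots,x_n)=(f(x_1),\dots,f(x_n))$. *)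

(* Defs.v *)
From HB Require Import structures.
From mathcomp Require Import all_boot all_order all_algebra.
From mathcomp Require Import generic_quotient ring_quotient freeg.
From mathcomp Require Import all_classical all_reals all_analysis.

Set Implicit Arguments.
Unset Strict Implicit.
Unset Printing Implicit Defensive.

Import Order.TTheory GRing.Theory Num.Theory.
Import numFieldNormedType.Exports.

Local Open Scope classical_set_scope.
Local Open Scope ring_scope.
Local Open Scope quotient_scope.

Section Dimension.
Variable V : lmodType rat.

Definition lin_indep n (b : 'I_n -> V) : Prop :=
  forall c : 'I_n -> rat, \sum_i c i *: b i = 0 -> forall i, c i = 0.

Definition is_basis (S : set V) n (b : 'I_n -> V) : Prop :=
  lin_indep b /\ S = [set \sum_i c i *: b i | c in [set: 'I_n -> rat]].

Definition has_dim (S : set V) (n : nat) : Prop :=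
  exists b : 'I_n -> V, is_basis S b.

Definition fin_dim (S : set V) : Prop := exists n, has_dim S n.

(* Equal to 0 when S is not finite dimensional. *)
Definition dim (S : set V) : nat := xget 0%N [set n | has_dim S n].

End Dimension.

Definition ker (V W : lmodType rat) (g : V -> W) : set V := [set v | g v = 0].

(* sum_i dim (S i) < oo *)
Definition fin_total_dim (V : nat -> lmodType rat) (S : forall i, set (V i)) :
  Prop :=
  (forall i, fin_dim (S i)) /\ finite_set [set i | dim (S i) != 0%N].

Section LmodQuotient.
Variables (K : nzRingType) (V : lmodType K) (B : submodClosed V).

Definition submod_pred : {pred V} := [pred v in B].

Lemma submod_pred_zmod : GRing.zmod_closed submod_pred.
Proof.
split=> [|v w Bv Bw]; first exact: (rpred0 B).
rewrite -scaleN1r; apply: (rpredD (S := B)) => //.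
exact: (rpredZ (s := B)).
Qed.

HB.instance Definition _ :=
  GRing.isZmodClosed.Build V submod_pred submod_pred_zmod.

Definition lquot : Type := Quotient.quot submod_pred.
HB.instance Definition _ := GRing.Zmodule.on lquot.
HB.instance Definition _ :=
  EqQuotient.copy lquot (Quotient.quot submod_pred).

Lemma eq_lquot (v w : V) : (\pi_lquot v == \pi_lquot w) = (v - w \in B).
Proof. by rewrite -Quotient.idealrBE. Qed.

Definition lquot_scale (a : K) (x : lquot) : lquot := \pi_lquot (a *: repr x).

Lemma pi_lquotZ a v : \pi_lquot (a *: v) = lquot_scale a (\pi_lquot v).
Proof.
apply/eqP; rewrite eq_lquot -scalerBr rpredZ// -eq_lquot; apply/eqP.
by rewrite reprK.
Qed.

Lemma lquot_scaleA a b x :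
  lquot_scale a (lquot_scale b x) = lquot_scale (a * b) x.
Proof. by elim/(@quotW _ lquot): x => x; rewrite -!pi_lquotZ scalerA. Qed.

Lemma lquot_scale1 : left_id 1 lquot_scale.
Proof. by elim/(@quotW _ lquot) => x; rewrite -pi_lquotZ scale1r. Qed.

Lemma pi_lquotD (v w : V) :
  \pi_lquot (v + w) = (\pi_lquot v : lquot) + \pi_lquot w.
Proof. exact: (raddfD (\pi_(Quotient.quot submod_pred))). Qed.

Lemma lquot_scaleDr : right_distributive lquot_scale +%R.
Proof.
move=> a; elim/(@quotW _ lquot) => x; elim/(@quotW _ lquot) => y.
by rewrite -pi_lquotD -!pi_lquotZ -pi_lquotD scalerDr.
Qed.

Lemma lquot_scaleDl x : {morph lquot_scale^~ x : a b / a + b}.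
Proof.
move=> a b; elim/(@quotW _ lquot): x => x.
by rewrite -!pi_lquotZ -pi_lquotD scalerDl.
Qed.

HB.instance Definition _ := GRing.Zmodule_isLmodule.Build K lquot
  lquot_scaleA lquot_scale1 lquot_scaleDr lquot_scaleDl.

End LmodQuotient.

Section LquotMap.
Variables (K : nzRingType) (V W : lmodType K).
Variables (B : submodClosed V) (C : submodClosed W) (g : {linear V -> W}).

Definition lquot_map (gBC : forall v, v \in B -> g v \in C) :
    lquot B -> lquot C :=
  fun x => \pi_(lquot C) (g (repr x)).

Hypothesis gBC : forall v, v \in B -> g v \in C.

Lemma lquot_mapE v : lquot_map gBC (\pi_(lquot B) v) = \pi_(lquot C) (g v).
Proof.
apply/eqP; rewrite eq_lquot -linearB gBC// -eq_lquot; apply/eqP.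
by rewrite reprK.
Qed.

Lemma lquot_map_linear : linear (lquot_map gBC).
Proof.
move=> a; elim/(@quotW _ (lquot B)) => x; elim/(@quotW _ (lquot B)) => y.
rewrite -[a *: _]pi_lquotZ -pi_lquotD !lquot_mapE linearP.
by rewrite pi_lquotD pi_lquotZ.
Qed.

HB.instance Definition _ :=
  GRing.isLinear.Build K (lquot B) (lquot C) _ (lquot_map gBC)
    lquot_map_linear.

End LquotMap.

Section Span.
Variables (K : nzRingType) (V : lmodType K).

Definition span (A : set V) : set V :=
  [set v | exists n (c : 'I_n -> K) (a : 'I_n -> V),
     (forall i, A (a i)) /\ v = \sum_i c i *: a i].

Definition in_span (A : set V) : {pred V} := [pred v | `[< span A v >]].

Lemma span_submod (A : set V) : GRing.submod_closed (in_span A).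
Proof.
split.
  apply/asboolP; exists 0%N, (fun=> 0), (fun=> 0); split; first by case.
  by rewrite big_ord0.
move=> k u v /asboolP[n [c [a [Aa ->]]]] /asboolP[m [d [b [Ab ->]]]].
apply/asboolP; exists (n + m)%N.
exists (fun i : 'I_(n + m) =>
  match fintype.split i with inl j => k * c j | inr j => d j end).
exists (fun i : 'I_(n + m) =>
  match fintype.split i with inl j => a j | inr j => b j end).
split; first by move=> i; case: (fintype.split i).
rewrite big_split_ord scaler_sumr; congr (_ + _); apply: eq_bigr => i _.
  by rewrite -[lshift _ _]/(unsplit (inl i)) unsplitK scalerA.
by rewrite -[rshift _ _]/(unsplit (inr i)) unsplitK.
Qed.

HB.instance Definition _ (A : set V) :=
  GRing.isSubmodClosed.Build K V (in_span A) (span_submod A).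

End Span.

Section LinearExtension.
Variables (K : choiceType) (V : lmodType rat) (f : K -> V).

Lemma fglift_scalable : scalable (fglift f).
Proof.
pose h := GRing.isZmodMorphism.Build _ _ (fglift f) (lift_is_additive f).
pose F : {additive {freeg K / rat} -> V} := HB.pack (fglift f) h.
have FE u : F u = \sum_(x <- dom u) coeff x u *: f x.
  rewrite -[in LHS](freeg_sumE u) raddf_sum.
  by apply: eq_bigr => x _; exact: liftU.
move=> a u; rewrite -[fglift f]/(F : _ -> _) (FE u) scaler_sumr.
rewrite -[in LHS](freeg_sumE u) scaler_sumr raddf_sum; apply: eq_bigr => x _.
have -> : a *: << coeff x u *g x >> = << a * coeff x u *g x >>.
  by apply/eqP/freeg_eqP => y; rewrite coeffZ !coeffU mulrA.
by rewrite scalerA; exact: liftU.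
Qed.

HB.instance Definition _ := GRing.isZmodMorphism.Build
  {freeg K / rat} V (fglift f) (lift_is_additive f).
HB.instance Definition _ := GRing.isScalable.Build
  rat {freeg K / rat} V _ (fglift f) fglift_scalable.

End LinearExtension.

Section LinearExtensionTheory.
Variables (K : choiceType) (V : lmodType rat).

Lemma fglift1 (f : K -> V) x : fglift f << x >> = f x.
Proof. by rewrite liftU scale1r. Qed.

Lemma eq_freeg_linear (F G : {linear {freeg K / rat} -> V}) :
  (forall x, F << x >> = G << x >>) -> F =1 G.
Proof.
move=> FG c; rewrite -(freeg_sumE c) !linear_sum; apply: eq_bigr => x _.
have -> : << coeff x c *g x >> = coeff x c *: << x >> :> {freeg K / rat}.
  by apply/eqP/freeg_eqP => y; rewrite coeffZ !coeffU mul1r.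
by rewrite !linearZ/= FG.
Qed.

End LinearExtensionTheory.

Lemma continuous_compT (S T U : topologicalType) (f : S -> T) (g : T -> U) :
  continuous f -> continuous g -> continuous (fun s => g (f s)).
Proof. by move=> fc gc s; apply: continuous_comp; [exact: fc|exact: gc]. Qed.

Lemma continuous_pair (S T U : topologicalType) (f : S -> T) (g : S -> U) :
  continuous f -> continuous g -> continuous (fun s => (f s, g s)).
Proof. by move=> fc gc s; apply: cvg_pair; [exact: fc|exact: gc]. Qed.

Lemma continuous_fst (T U : topologicalType) : continuous (@fst T U).
Proof. by move=> ?; exact: cvg_fst. Qed.

Lemma continuous_snd (T U : topologicalType) : continuous (@snd T U).
Proof. by move=> ?; exact: cvg_snd. Qed.

Lemma continuous_set_type (T U : topologicalType) (A : set U)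
  (g : T -> set_type A) : continuous (set_val \o g) -> continuous g.
Proof. exact: continuous_comp_initial. Qed.

Lemma continuous_set_val (U : topologicalType) (A : set U) :
  continuous (set_val : set_type A -> U).
Proof. exact: initial_continuous. Qed.

Lemma continuous_ptws (I : Type) (T U : topologicalType)
  (g : T -> {ptws I -> U}) :
  (forall i, continuous (fun t => g t i)) -> continuous g.
Proof.
move=> gc t; apply/cvg_sup => i; move: t.
exact: (@continuous_comp_initial _ _ _ (fun h : I -> U => h i) g (gc i)).
Qed.

Lemma continuous_coord (I : eqType) (U : topologicalType) (i : I) :
  continuous (fun g : {ptws I -> U} => g i).
Proof. exact: (@proj_continuous I (fun=> U) i). Qed.

Lemma continuous_if (R : realType) (T U : topologicalType) (c : T -> R)
    (a : R) (g h : T -> U) :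
  continuous c -> continuous g -> continuous h ->
  (forall t, c t = a -> g t = h t) ->
  continuous (fun t => if c t <= a then g t else h t).
Proof.
move=> cc gc hc gh; apply/continuous_closedP => W cW.
have -> : (fun t => if c t <= a then g t else h t) @^-1` W =
    (c @^-1` [set x | x <= a] `&` g @^-1` W) `|`
    (c @^-1` [set x | x >= a] `&` h @^-1` W).
  apply/seteqP; split => t /=.
    case: ifPn => [ca Wg|]; first by left.
    by rewrite -ltNge => /ltW ac Wh; right.
  case: ifPn => [ca [[]//|[ac Wh]]|]; last by move=> nca [[]|[]].
  by rewrite gh//; apply/eqP; rewrite eq_le ca.
by apply: closedU; apply: closedI; apply: preimage_closed.
Qed.

Section SingularHomology.
Variable R : realType.

Definition std_simplex n : set {ptws 'I_n.+1 -> R} :=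
  [set t | (forall i, 0 <= t i) /\ \sum_i t i = 1].

Definition face_fun n (i : 'I_n.+2) (t : set_type (@std_simplex n)) :
  {ptws 'I_n.+2 -> R} :=
  fun j => if unlift i j is Some k then set_val t k else 0.

Lemma face_fun_simplex n (i : 'I_n.+2) t :
  face_fun i t \in (@std_simplex n.+1 : set _).
Proof.
have [t0 t1] := set_valP t; apply/mem_set; split=> [j|].
  by rewrite /face_fun; case: unliftP => [k _|//]; exact: t0.
rewrite (bigD1_ord i)//= /face_fun unlift_none add0r -[RHS]t1.
by apply: eq_bigr => k _; rewrite liftK.
Qed.

Definition face n (i : 'I_n.+2) (t : set_type (@std_simplex n)) :
  set_type (@std_simplex n.+1) := exist _ (face_fun i t) (face_fun_simplex i t).

Lemma face_continuous n (i : 'I_n.+2) : continuous (@face n i).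
Proof.
apply: continuous_set_type; apply: continuous_ptws => j.
rewrite (_ : (fun t => _) = fun t => face_fun i t j); last first.
  by apply/funext => t; rewrite /= set_valE.
rewrite /face_fun; case: (unlift i j) => [k|]; last exact: cst_continuous.
exact: (continuous_compT (@continuous_set_val _ _)
  (@continuous_coord _ R (k : 'I_n.+1))).
Qed.

HB.instance Definition _ n (i : 'I_n.+2) :=
  isContinuous.Build _ _ (@face n i) (@face_continuous n i).

Definition sing (X : topologicalType) n :=
  continuousType (set_type (@std_simplex n)) X.

Definition chain (X : topologicalType) n := {freeg (sing X n) / rat}.

Definition sing_face X n (s : sing X n.+1) (i : 'I_n.+2) : sing X n :=
  s \o face i.

Definition boundary X n : chain X n -> chain X n.-1 :=
  match n with
  | 0 => fun=> 0
  | m.+1 => fglift (fun s : sing X m.+1 =>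
      \sum_(i < m.+2) (-1) ^+ i *: << sing_face s i >> : chain X m)
  end.

Lemma boundary_linear X n : linear (@boundary X n).
Proof.
case: n => [|n] a u v /=; last exact: linearP.
by rewrite scaler0 addr0.
Qed.

HB.instance Definition _ X n :=
  GRing.isLinear.Build rat (chain X n) (chain X n.-1) _ (@boundary X n)
    (@boundary_linear X n).

Definition is_cycle X n : {pred chain X n} := [pred c | boundary c == 0].

Lemma is_cycle_submod X n : GRing.submod_closed (@is_cycle X n).
Proof.
split=> [|a u v]; rewrite !inE ?linear0// => /eqP du /eqP dv.
by rewrite linearP/= du dv scaler0 addr0.
Qed.

HB.instance Definition _ X n :=
  GRing.isSubmodClosed.Build rat (chain X n) (@is_cycle X n)
    (@is_cycle_submod X n).

Definition cycle X n := {c : chain X n | c \in @is_cycle X n}.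

HB.instance Definition _ X n := SubChoice.on (cycle X n).
HB.instance Definition _ X n :=
  [SubChoice_isSubLmodule of cycle X n by <:].

Definition is_boundary X n : {pred cycle X n} :=
  [pred z | `[< exists c : chain X n.+1, boundary c = val z >]].

Lemma is_boundary_submod X n : GRing.submod_closed (@is_boundary X n).
Proof.
split=> [|a u v]; rewrite !inE.
  by exists 0; exact: linear0.
move=> [c cu] [d dv]; exists (a *: c + d).
transitivity (a *: boundary c + boundary d); first exact: linearP.
by rewrite cu dv.
Qed.

HB.instance Definition _ X n :=
  GRing.isSubmodClosed.Build rat (cycle X n) (@is_boundary X n)
    (@is_boundary_submod X n).

Definition homology X n : lmodType rat := lquot (@is_boundary X n).

Section HomologyMap.
Variables (X Y : topologicalType) (f : continuousType X Y).

Definition chain_map n : chain X n -> chain Y n :=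
  fglift (fun s : sing X n => << (f \o s : sing Y n) >>).
HB.instance Definition _ n := GRing.Linear.on (@chain_map n).

Lemma boundary_chain_map n (c : chain X n) :
  boundary (chain_map c) = chain_map (boundary c).
Proof.
case: n c => [|n] c; first by rewrite /= linear0.
pose F : {linear chain X n.+1 -> chain Y n} :=
  @boundary Y n.+1 \o @chain_map n.+1.
pose G : {linear chain X n.+1 -> chain Y n} :=
  @chain_map n \o @boundary X n.+1.
rewrite -[LHS]/(F c) -[RHS]/(G c); apply: eq_freeg_linear => s /=.
rewrite /chain_map !fglift1 linear_sum; apply: eq_bigr => i _.
rewrite linearZ/= fglift1; congr (_ *: << _ >>).
exact/continuousEP.
Qed.

Lemma chain_map_cycle n (z : cycle X n) :
  chain_map (val z) \in @is_cycle Y n.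
Proof.
have := valP z; rewrite !inE => /eqP dz.
by rewrite boundary_chain_map dz linear0.
Qed.

Definition cycle_map n (z : cycle X n) : cycle Y n :=
  exist _ (chain_map (val z)) (chain_map_cycle z).

Lemma cycle_map_linear n : linear (@cycle_map n).
Proof. by move=> a u v; apply: val_inj; rewrite /= linearP. Qed.

HB.instance Definition _ n :=
  GRing.isLinear.Build rat (cycle X n) (cycle Y n) _ (@cycle_map n)
    (@cycle_map_linear n).

Lemma cycle_map_boundary n (z : cycle X n) :
  z \in @is_boundary X n -> cycle_map z \in @is_boundary Y n.
Proof.
rewrite !inE => -[c cz]; exists (chain_map c).
by rewrite boundary_chain_map cz.
Qed.

Definition homology_map n : {linear homology X n -> homology Y n} :=
  lquot_map (@cycle_map_boundary n).

End HomologyMap.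
End SingularHomology.

Section HomotopyGroups.
Variable R : realType.

Definition unit_itv : Type := set_type (`[0, 1]%classic : set R).
HB.instance Definition _ := Topological.on unit_itv.

Lemma unit_itv_ge0 (t : unit_itv) : 0 <= set_val t.
Proof. by have := set_valP t; rewrite /= in_itv/= => /andP[]. Qed.

Lemma unit_itv_le1 (t : unit_itv) : set_val t <= 1.
Proof. by have := set_valP t; rewrite /= in_itv/= => /andP[]. Qed.

Lemma mem_unit_itv (t : R) :
  0 <= t -> t <= 1 -> t \in (`[0, 1]%classic : set R).
Proof. by move=> t0 t1; apply/mem_set; rewrite /= in_itv/= t0. Qed.

Definition mk_itv t (t0 : 0 <= t) (t1 : t <= 1) : unit_itv :=
  exist _ t (mem_unit_itv t0 t1).

Definition itv0 : unit_itv := mk_itv (lexx 0) ler01.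
Definition itv1 : unit_itv := mk_itv ler01 (lexx 1).

Fact lo_ge0 (t : unit_itv) : 0 <= Num.min 1 (2 * set_val t).
Proof. by rewrite le_min ler01 mulr_ge0// unit_itv_ge0. Qed.
Fact lo_le1 (t : unit_itv) : Num.min 1 (2 * set_val t) <= 1.
Proof. by rewrite ge_min lexx. Qed.
Fact hi_ge0 (t : unit_itv) : 0 <= Num.max 0 (2 * set_val t - 1).
Proof. by rewrite le_max lexx. Qed.
Fact hi_le1 (t : unit_itv) : Num.max 0 (2 * set_val t - 1) <= 1.
Proof.
by rewrite ge_max ler01 lerBlDr -[1 + 1]mulr1 ler_wpM2l// unit_itv_le1.
Qed.
Fact rev_ge0 (t : unit_itv) : 0 <= 1 - set_val t.
Proof. by rewrite subr_ge0 unit_itv_le1. Qed.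
Fact rev_le1 (t : unit_itv) : 1 - set_val t <= 1.
Proof. by rewrite gerBl unit_itv_ge0. Qed.

(* itv_lo t is 2 t on [0, 1/2] and itv_hi t is 2 t - 1 on [1/2, 1]; they are
   only used there. *)
Definition itv_lo (t : unit_itv) : unit_itv := mk_itv (lo_ge0 t) (lo_le1 t).
Definition itv_hi (t : unit_itv) : unit_itv := mk_itv (hi_ge0 t) (hi_le1 t).
Definition itv_rev (t : unit_itv) : unit_itv := mk_itv (rev_ge0 t) (rev_le1 t).

Lemma itv_val_continuous : continuous (set_val : unit_itv -> R).
Proof. exact: continuous_set_val. Qed.

Lemma itv_dbl_continuous : continuous (fun t : unit_itv => 2 * set_val t : R).
Proof.
exact: (continuous_compT itv_val_continuous (@mulrl_continuous R 2)).
Qed.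

Lemma itv_lo_continuous : continuous itv_lo.
Proof.
apply: continuous_set_type.
rewrite (_ : _ \o _ = cst 1 \min (fun t : unit_itv => 2 * set_val t)).
  move=> t; apply: continuous_min; first exact: cst_continuous.
  exact: itv_dbl_continuous.
by apply/funext => t; rewrite /= set_valE.
Qed.

Lemma itv_hi_continuous : continuous itv_hi.
Proof.
apply: continuous_set_type.
rewrite (_ : _ \o _ = cst 0 \max (fun t : unit_itv => 2 * set_val t - 1)).
  move=> t; apply: continuous_max; first exact: cst_continuous.
  apply: (@cvgB _ R^o _ (nbhs t) _ (fun t => 2 * set_val t) (cst 1)).
    exact: itv_dbl_continuous.
  exact: cst_continuous.
by apply/funext => t; rewrite /= set_valE.
Qed.

Lemma itv_rev_continuous : continuous itv_rev.
Proof.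
apply: continuous_set_type.
rewrite (_ : _ \o _ = fun t : unit_itv => 1 - set_val t).
  move=> t; apply: (@cvgB _ R^o _ (nbhs t) _ (cst 1) set_val).
    exact: cst_continuous.
  exact: itv_val_continuous.
by apply/funext => t; rewrite /= set_valE.
Qed.

Lemma itv_eq (s t : unit_itv) : set_val s = set_val t -> s = t.
Proof. by rewrite set_valE => st; exact: val_inj. Qed.

Lemma itv_lo0 t : set_val t = 0 :> R -> itv_lo t = itv0.
Proof.
move=> t0; apply: itv_eq; rewrite set_valE/= t0 mulr0.
by rewrite min_r.
Qed.

Lemma itv_lo_half t : set_val t = 2^-1 :> R -> itv_lo t = itv1.
Proof.
by move=> th; apply: itv_eq; rewrite set_valE/= th divff// minxx.
Qed.

Lemma itv_hi_half t : set_val t = 2^-1 :> R -> itv_hi t = itv0.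
Proof.
by move=> th; apply: itv_eq; rewrite set_valE/= th divff// subrr maxxx.
Qed.

Lemma itv_hi1 t : set_val t = 1 :> R -> itv_hi t = itv1.
Proof.
move=> t1; apply: itv_eq; rewrite set_valE/= t1 mulr1 [2]/(1 + 1) addrK.
by rewrite max_r.
Qed.

Lemma half_itv : (2^-1 < 1 :> R).
Proof. by rewrite invf_lt1// ltr1n. Qed.

Definition cube n := {ptws 'I_n -> unit_itv}.
HB.instance Definition _ n := Topological.on (cube n).

Definition cube_boundary n : set (cube n) :=
  [set s | exists j, set_val (s j) = 0 :> R \/ set_val (s j) = 1 :> R].

Definition cube_lo n (s : cube n.+1) : cube n.+1 :=
  fun j => if j == ord0 then itv_lo (s j) else s j.
Definition cube_hi n (s : cube n.+1) : cube n.+1 :=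
  fun j => if j == ord0 then itv_hi (s j) else s j.

Lemma cube_coord_continuous n (j : 'I_n) :
  continuous (fun s : cube n => s j).
Proof. exact: continuous_coord. Qed.

Lemma cube_coord_val_continuous n (j : 'I_n) :
  continuous (fun s : cube n => set_val (s j) : R).
Proof.
exact: (continuous_compT (@cube_coord_continuous n j) itv_val_continuous).
Qed.

Lemma cube_map_continuous n (g : unit_itv -> unit_itv) (i : 'I_n) :
  continuous g ->
  continuous ((fun s j => if j == i then g (s j) else s j) : cube n -> cube n).
Proof.
move=> gc; apply: continuous_ptws => j; case: eqP => _; last first.
  exact: cube_coord_continuous.
exact: (continuous_compT (@cube_coord_continuous n j) gc).
Qed.

Lemma cube_lo_continuous n : continuous (@cube_lo n).
Proof. exact: (cube_map_continuous itv_lo_continuous). Qed.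

Lemma cube_hi_continuous n : continuous (@cube_hi n).
Proof. exact: (cube_map_continuous itv_hi_continuous). Qed.

Lemma cube_lo_half n (s : cube n.+1) :
  set_val (s ord0) = 2^-1 :> R -> cube_boundary (cube_lo s).
Proof.
by move=> sh; exists ord0; right; rewrite /cube_lo eqxx itv_lo_half// set_valE.
Qed.

Lemma cube_hi_half n (s : cube n.+1) :
  set_val (s ord0) = 2^-1 :> R -> cube_boundary (cube_hi s).
Proof.
by move=> sh; exists ord0; left; rewrite /cube_hi eqxx itv_hi_half// set_valE.
Qed.

Lemma cube_lo_boundary n (s : cube n.+1) :
  cube_boundary s -> set_val (s ord0) <= 2^-1 :> R ->
  cube_boundary (cube_lo s).
Proof.
move=> [j sj] s0; exists j; rewrite /cube_lo.
have [j0|//] := eqVneq j ord0; rewrite {j}j0 in sj *.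
case: sj => sj; first by left; rewrite itv_lo0// set_valE.
by move: s0; rewrite sj leNgt half_itv.
Qed.

Lemma cube_hi_boundary n (s : cube n.+1) :
  cube_boundary s -> ~~ (set_val (s ord0) <= 2^-1 :> R) ->
  cube_boundary (cube_hi s).
Proof.
move=> [j sj] s0; exists j; rewrite /cube_hi.
have [j0|//] := eqVneq j ord0; rewrite {j}j0 in sj *.
case: sj => sj; last by right; rewrite itv_hi1// set_valE.
by move: s0; rewrite sj invr_ge0 ler0n.
Qed.

Section Pointed.
Variables (X : topologicalType) (x : X) (n : nat).

Definition is_spheroid (a : continuousType (cube n) X) : bool :=
  `[< forall s, cube_boundary s -> a s = x >].

Definition spheroid := {a : continuousType (cube n) X | is_spheroid a}.
HB.instance Definition _ := Choice.on spheroid.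

Lemma spheroidP (a : spheroid) s : cube_boundary s -> val a s = x.
Proof. by move: s; apply/asboolP; exact: (valP a). Qed.

Definition homotopic (a b : spheroid) : bool :=
  `[< exists H : continuousType (cube n * unit_itv)%type X,
      [/\ forall s, H (s, itv0) = val a s,
          forall s, H (s, itv1) = val b s &
          forall s t, cube_boundary s -> H (s, t) = x] >].

Lemma homotopic_refl : reflexive homotopic.
Proof.
move=> a; apply/asboolP.
have ac := continuous_compT (@continuous_fst (cube n) unit_itv)
  (@cts_fun _ _ (val a)).
exists (mkcts ac); split => //= s t bs; exact: spheroidP.
Qed.

Lemma homotopic_sym : symmetric homotopic.
Proof.
suff h a b : homotopic a b -> homotopic b a.
  by move=> a b; apply/idP/idP; exact: h.
move=> /asboolP[H [H0 H1 Hb]]; apply/asboolP.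
have Hc := continuous_compT
  (continuous_pair (@continuous_fst (cube n) unit_itv)
    (continuous_compT (@continuous_snd (cube n) unit_itv) itv_rev_continuous))
  (@cts_fun _ _ H).
exists (mkcts Hc); split => /= [s|s|s t bs]; last exact: Hb.
- rewrite -H1; congr (H (_, _)); apply: itv_eq.
  by rewrite !set_valE/= set_valE/= subr0.
- rewrite -H0; congr (H (_, _)); apply: itv_eq.
  by rewrite !set_valE/= set_valE/= subrr.
Qed.

Lemma homotopic_trans : transitive homotopic.
Proof.
move=> b a c /asboolP[H [H0 H1 Hb]] /asboolP[G [G0 G1 Gb]]; apply/asboolP.
pose F (st : cube n * unit_itv) :=
  if set_val st.2 <= 2^-1 :> R then H (st.1, itv_lo st.2)
  else G (st.1, itv_hi st.2).
have Fc : continuous F.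
  apply: continuous_if.
  - exact: (continuous_compT (@continuous_snd _ _) itv_val_continuous).
  - apply: (continuous_compT _ (@cts_fun _ _ H)).
    apply: (continuous_pair (@continuous_fst _ _)).
    exact: (continuous_compT (@continuous_snd _ _) itv_lo_continuous).
  - apply: (continuous_compT _ (@cts_fun _ _ G)).
    apply: (continuous_pair (@continuous_fst _ _)).
    exact: (continuous_compT (@continuous_snd _ _) itv_hi_continuous).
  - by move=> [s t]/= th; rewrite itv_lo_half// itv_hi_half// H1 G0.
exists (mkcts Fc); split => [s|s|s t bs].
- have t0 : set_val itv0 = 0 :> R by rewrite set_valE.
  by rewrite -[LHS]/(F (s, itv0)) /F/= t0 invr_ge0 ler0n itv_lo0.
- have t1 : set_val itv1 = 1 :> R by rewrite set_valE.
  by rewrite -[LHS]/(F (s, itv1)) /F/= t1 leNgt half_itv/= itv_hi1.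
- rewrite -[LHS]/(F (s, t)) /F/=.
  by case: ifP => _; [exact: Hb|exact: Gb].
Qed.

Canonical homotopic_equiv :=
  EquivRel homotopic homotopic_refl homotopic_sym homotopic_trans.

(* The underlying set of pi_n(X, x); for n > 0 the group law is pi_mul. *)
Definition homotopy_group := {eq_quot homotopic}.
HB.instance Definition _ := Choice.on homotopy_group.
HB.instance Definition _ := EqQuotient.on homotopy_group.

End Pointed.

Section Multiplication.
Variables (X : topologicalType) (x : X) (n : nat).

Definition concat_fun (a b : spheroid x n.+1) (s : cube n.+1) : X :=
  if set_val (s ord0) <= 2^-1 :> R then val a (cube_lo s)
  else val b (cube_hi s).

Lemma concat_continuous a b : continuous (concat_fun a b).
Proof.
apply: continuous_if.
- exact: cube_coord_val_continuous.
- exact: (continuous_compT (@cube_lo_continuous n) (@cts_fun _ _ (val a))).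
- exact: (continuous_compT (@cube_hi_continuous n) (@cts_fun _ _ (val b))).
- move=> s sh; rewrite !spheroidP//; first exact: cube_hi_half.
  exact: cube_lo_half.
Qed.

Lemma concat_spheroid a b :
  is_spheroid x (mkcts (@concat_continuous a b)).
Proof.
apply/asboolP => s bs; rewrite -[LHS]/(concat_fun a b s) /concat_fun.
case: ifPn => s0; apply: spheroidP; first exact: cube_lo_boundary.
exact: cube_hi_boundary.
Qed.

Definition concat (a b : spheroid x n.+1) : spheroid x n.+1 :=
  exist _ (mkcts (@concat_continuous a b) : continuousType _ _)
    (concat_spheroid a b).

Lemma homotopic_concat a a' b b' : homotopic a a' -> homotopic b b' ->
  homotopic (concat a b) (concat a' b').
Proof.
move=> /asboolP[H [H0 H1 Hb]] /asboolP[G [G0 G1 Gb]]; apply/asboolP.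
pose F (st : cube n.+1 * unit_itv) :=
  if set_val (st.1 ord0) <= 2^-1 :> R then H (cube_lo st.1, st.2)
  else G (cube_hi st.1, st.2).
have Fc : continuous F.
  apply: continuous_if.
  - exact: (continuous_compT (@continuous_fst _ _)
      (@cube_coord_val_continuous n.+1 ord0)).
  - apply: (continuous_compT _ (@cts_fun _ _ H)).
    apply: continuous_pair; last exact: continuous_snd.
    exact: (continuous_compT (@continuous_fst _ _) (@cube_lo_continuous n)).
  - apply: (continuous_compT _ (@cts_fun _ _ G)).
    apply: continuous_pair; last exact: continuous_snd.
    exact: (continuous_compT (@continuous_fst _ _) (@cube_hi_continuous n)).
  - move=> [s t]/= sh; rewrite Hb ?Gb//; first exact: cube_hi_half.
    exact: cube_lo_half.
exists (mkcts Fc); split => [s|s|s t bs].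
- rewrite -[LHS]/(F (s, itv0)) -[RHS]/(concat_fun a b s) /F /concat_fun/=.
  by rewrite H0 G0.
- rewrite -[LHS]/(F (s, itv1)) -[RHS]/(concat_fun a' b' s) /F /concat_fun/=.
  by rewrite H1 G1.
- rewrite -[LHS]/(F (s, t)) /F/=.
  case: ifPn => s0; [apply: Hb; exact: cube_lo_boundary|].
  by apply: Gb; exact: cube_hi_boundary.
Qed.

Definition pi_mul (u v : homotopy_group x n.+1) : homotopy_group x n.+1 :=
  \pi_(homotopy_group x n.+1) (concat (repr u) (repr v)).

Lemma pi_mulE (a b : spheroid x n.+1) :
  pi_mul (\pi_(homotopy_group x n.+1) a) (\pi_(homotopy_group x n.+1) b) =
  \pi_(homotopy_group x n.+1) (concat a b).
Proof.
by apply/eqmodP; apply: homotopic_concat; apply/eqmodP; rewrite reprK.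
Qed.

End Multiplication.

Section HomotopyGroupMap.
Variables (X Y : topologicalType) (f : continuousType X Y) (x : X).

Lemma spheroid_map_subproof n (a : spheroid x n) :
  is_spheroid (f x) (f \o val a).
Proof. by apply/asboolP => s bs /=; rewrite spheroidP. Qed.

Definition spheroid_map n (a : spheroid x n) : spheroid (f x) n :=
  exist _ (f \o val a : continuousType _ _) (spheroid_map_subproof a).

Lemma homotopic_map n (a b : spheroid x n) :
  homotopic a b -> homotopic (spheroid_map a) (spheroid_map b).
Proof.
move=> /asboolP[H [H0 H1 Hb]]; apply/asboolP.
exists (f \o H : continuousType _ _).
by split=> [s|s|s t bs] /=; rewrite ?H0 ?H1 ?Hb.
Qed.

Definition pi_map n (u : homotopy_group x n) : homotopy_group (f x) n :=
  \pi_(homotopy_group (f x) n) (spheroid_map (repr u)).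

Lemma pi_mapE n (a : spheroid x n) :
  pi_map (\pi_(homotopy_group x n) a) =
  \pi_(homotopy_group (f x) n) (spheroid_map a).
Proof. by apply/eqmodP; apply: homotopic_map; apply/eqmodP; rewrite reprK. Qed.

Lemma pi_mapM n (u v : homotopy_group x n.+1) :
  pi_map (pi_mul u v) = pi_mul (pi_map u) (pi_map v).
Proof.
elim/(@quotW _ (homotopy_group x n.+1)): u => a.
elim/(@quotW _ (homotopy_group x n.+1)): v => b.
rewrite pi_mulE !pi_mapE pi_mulE; congr (\pi_(homotopy_group (f x) n.+1) _).
apply: val_inj; apply/continuousEP => s /=.
rewrite -[RHS]/(concat_fun (spheroid_map a) (spheroid_map b) s).
rewrite -[LHS]/(f (concat_fun a b s)) /concat_fun.
by case: ifP.
Qed.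

End HomotopyGroupMap.
End HomotopyGroups.

(* For an abelian group (G, mul), rat_tensor mul is G (x) Q. The element g (x) q
   is the class of << q *g g >>: additivity of (x) in q already holds in the
   free Q-vector space over G, and the quotient imposes additivity in g. *)
Section RatTensor.
Variables (G : choiceType) (mul : G -> G -> G).

Definition tensor_relators : set {freeg G / rat} :=
  [set << mul p.1 p.2 >> - << p.1 >> - << p.2 >> | p in [set: G * G]].

Definition rat_tensor : lmodType rat := lquot (in_span tensor_relators).

End RatTensor.

Section RatTensorMap.
Variables (G G' : choiceType) (mul : G -> G -> G) (mul' : G' -> G' -> G').
Variable phi : G -> G'.

Definition freeg_map : {freeg G / rat} -> {freeg G' / rat} :=
  fglift (fun g => << phi g >>).
HB.instance Definition _ := GRing.Linear.on freeg_map.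

Hypothesis phiM : forall g h, phi (mul g h) = mul' (phi g) (phi h).

Lemma freeg_map_relators v :
  v \in in_span (tensor_relators mul) ->
  freeg_map v \in in_span (tensor_relators mul').
Proof.
rewrite !inE => -[n [c [a [aA ->]]]]; exists n, c, (freeg_map \o a); split.
  move=> i /=; have [[g h] _ <-] := aA i; exists (phi g, phi h) => //=.
  by rewrite !linearB/= /freeg_map !fglift1 phiM.
by rewrite linear_sum; apply: eq_bigr => i _; rewrite linearZ.
Qed.

Definition rat_tensor_map : {linear rat_tensor mul -> rat_tensor mul'} :=
  lquot_map freeg_map_relators.

End RatTensorMap.

Section RationalEllipticity.
Variable R : realType.

Definition path_connected (X : topologicalType) : Prop :=
  inhabited X /\
  forall x y : X, exists g : continuousType (unit_itv R) X,
    g (itv0 R) = x /\ g (itv1 R) = y.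

Definition simply_connected (X : topologicalType) : Prop :=
  path_connected X /\ forall (x : X) (u v : homotopy_group R x 1), u = v.

Definition rational_finite_type (X : topologicalType) : Prop :=
  forall i, fin_dim [set: homology R X i].

Definition finite_homology_rank (X : topologicalType) : Prop :=
  fin_total_dim (fun i => [set: homology R X i]).

(* The index is shifted: this is pi_{n+1}(X, x) (x) Q, as pi_0(X, x) has no
   group structure. *)
Definition pi_rat (X : topologicalType) (x : X) n : lmodType rat :=
  rat_tensor (@pi_mul R X x n).

Definition pi_rat_map (X Y : topologicalType) (f : continuousType X Y) (x : X)
    n : {linear pi_rat x n -> pi_rat (f x) n} :=
  rat_tensor_map (@pi_mapM R X Y f x n).

Section Map.
Variables (X Y : topologicalType) (f : continuousType X Y) (x : X).

Definition rationally_elliptic_ker : Prop :=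
  fin_total_dim (fun i => ker (homology_map R f i)) /\
  fin_total_dim (fun n => ker (pi_rat_map f x n)).

(* The sums over an infinite set are the sums of the nonzero terms, provided
   that these are finitely many, which rationally_elliptic_ker ensures. *)
Definition homological_poly : {poly int} :=
  1 + \sum_(i \in [set i | (2 <= i)%N])
        ('X^i : {poly int}) *+ dim (ker (homology_map R f i)).

Definition homotopical_poly : {poly int} :=
  \sum_(i \in [set i | (2 <= i)%N])
    ('X^i : {poly int}) *+ dim (ker (pi_rat_map f x i.-1)).

End Map.
End RationalEllipticity.

Section PowerMap.
Variables (X Y : topologicalType) (f : continuousType X Y) (n : nat).

Definition power_map (x : {ptws 'I_n -> X}) : {ptws 'I_n -> Y} :=
  fun i => f (x i).

Lemma power_map_continuous : continuous power_map.
Proof.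
apply: continuous_ptws => i.
exact: (continuous_compT (@continuous_coord _ X i) (@cts_fun _ _ f)).
Qed.

HB.instance Definition _ :=
  isContinuous.Build _ _ power_map power_map_continuous.

End PowerMap.

(* Main.v *)
Require Import Defs.
From HB Require Import structures.
From mathcomp Require Import all_boot all_order all_algebra.
From mathcomp Require Import generic_quotient ring_quotient freeg.
From mathcomp Require Import all_classical all_reals all_analysis.
From mathcomp Require Import zify ring lra.

Set Implicit Arguments.
Unset Strict Implicit.
Unset Printing Implicit Defensive.

Import Order.TTheory GRing.Theory Num.Theory.
Import numFieldNormedType.Exports.

Local Open Scope ring_scope.

(** The two sides grow at different speeds with n. Write H for total rational
homology, d for the dimension of H(X), and f^n for the n-th power of f.

Homotopy is additive under products: pi_i(X^n) tensored with Q is the direct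
sum of n copies of pi_i(X) tensored with Q, naturally in f, so the homotopy
side is at most n times a constant. What is needed is only that a class of
pi_i(X^n) is determined by its n coordinates ([pi_rat_decomp]), and this holds
because concatenating a spheroid with a constant one does not change its class;
hence the rational class of a spheroid of X^n is the sum of the classes of its
projections to the axes ([sphere_class_tuple]).

Homology is multiplicative: by the Kunneth formula H(X^(n+1)) has a basis of
d^(n+1) cross products ([kunneth], [pow_basis]). Choose a nonzero class alpha
of degree at least 2 in the kernel of H(f). The cross products of a basis of
H(X^(n+1)) with alpha are independent ([cross_indep]), have degree at least 2,
and die in H(Y^(n+2)) because the image of alpha is a boundary. So the homology
side of f^(n+2) exceeds d^(n+1), and d >= 2 since H_0(X) and the degree of alpha
both contribute ([power_growth]). An exponential beats a linear function.

The Kunneth formula for singular homology has two halves. The algebraic half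
([kunneth_lift]) peels off a chain of the tensor complex by the degree of its
first factor; finiteness of the dimension of H(X) takes the place of a splitting
of the singular chains. The topological half compares chains of a
product with the tensor product of chains by acyclic models, in a purely
combinatorial form. A singular simplex can be pulled back along any map of
vertices, so natural operations are determined by what they do to words in the
vertices. Chains of words, in a product or in a tensor product, have explicit
cone contractions, and [solve] turns a contraction into chain maps and chain
homotopies by recursion on the size of words. [realize] then transports these
operations and all identities between them to singular chains. All complexes
are total ones: a single vector space with a differential, graded only through
the support of chains. *)

(** * Free vector spaces *)
Section FreeModule.
Variables (K : choiceType).
Implicit Types (c : {freeg K / rat}) (P : pred K).

Definition supported P c := forall x, coeff x c != 0 -> P x.

(** Linear identities and stability of supports are all proved by this
induction, which reduces them to basis elements. *)
Lemma freeg_supported_ind P (Q : {freeg K / rat} -> Prop) :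
  Q 0 -> (forall x, P x -> Q << x >>) ->
  (forall a u v, Q u -> Q v -> Q (a *: u + v)) -> forall c, supported P c -> Q c.
Proof.
move=> Q0 Q1 QD c Pc; rewrite -(freeg_sumE c).
have : {in dom c, forall x, P x} by move=> x; rewrite mem_dom => /Pc.
elim: (dom c) => [|x s IH] h; first by rewrite big_nil.
rewrite big_cons; have -> : << coeff x c *g x >> = coeff x c *: << x >> :> {freeg K /
  rat}.
  by apply/eqP/freeg_eqP => y; rewrite coeffZ !coeffU mul1r.
apply: QD; first by apply: Q1; apply: h; rewrite mem_head.
by apply: IH => y ys; apply: h; rewrite inE ys orbT.
Qed.

Lemma freeg_ind (Q : {freeg K / rat} -> Prop) :
  Q 0 -> (forall x, Q << x >>) ->
  (forall a u v, Q u -> Q v -> Q (a *: u + v)) -> forall c, Q c.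
Proof. by move=> Q0 Q1 QD c; apply: (@freeg_supported_ind predT). Qed.

Lemma fgliftD (V : lmodType rat) (f : K -> V) a u v :
  fglift f (a *: u + v) = a *: fglift f u + fglift f v.
Proof. exact: linearP. Qed.

Lemma fgliftZ (V : lmodType rat) (f : K -> V) a u :
  fglift f (a *: u) = a *: fglift f u.
Proof. exact: linearZ. Qed.

Lemma fglift_add (V : lmodType rat) (f : K -> V) u v :
  fglift f (u + v) = fglift f u + fglift f v.
Proof. exact: linearD. Qed.

Lemma fgliftN (V : lmodType rat) (f : K -> V) u : fglift f (- u) = - fglift f u.
Proof. exact: linearN. Qed.

Lemma fgliftB (V : lmodType rat) (f : K -> V) u v :
  fglift f (u - v) = fglift f u - fglift f v.
Proof. exact: linearB. Qed.

Lemma fglift_sum (V : lmodType rat) (f : K -> V) (I : Type) (r : seq I)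
    (P : pred I) (g : I -> {freeg K / rat}) :
  fglift f (\sum_(i <- r | P i) g i) = \sum_(i <- r | P i) fglift f (g i).
Proof. exact: linear_sum. Qed.

Lemma fglift0 (V : lmodType rat) (f : K -> V) : fglift f 0 = 0.
Proof. exact: linear0. Qed.

Lemma fglift_id c : fglift (fun x => << x >>) c = c.
Proof.
elim/freeg_ind: c => [|x|a u v Fu Fv]; rewrite ?linear0 ?fglift1 //.
by rewrite fgliftD Fu Fv.
Qed.

Lemma supported0 P : supported P 0.
Proof. by move=> x; rewrite coeff0 eqxx. Qed.

Lemma supported1 P x : P x -> supported P << x >>.
Proof. by move=> Px y; rewrite coeffU mul1r; case: (eqVneq x y) => [<-|]//;
  rewrite eqxx. Qed.

Lemma supported_lin P a u v : supported P u -> supported P v -> supported P (a *: u +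
  v).
Proof.
move=> Pu Pv x; rewrite coeffD coeffZ; have [->|/Pu//] := eqVneq (coeff x u) 0.
by rewrite mulr0 add0r; exact: Pv.
Qed.

Lemma supportedD P u v : supported P u -> supported P v -> supported P (u + v).
Proof. by move=> Pu Pv; rewrite -[u]scale1r; exact: supported_lin. Qed.

Lemma supportedZ P a u : supported P u -> supported P (a *: u).
Proof. by move=> Pu; rewrite -[_ *: _]addr0; apply: supported_lin => //;
  exact: supported0. Qed.

Lemma supportedN P u : supported P u -> supported P (- u).
Proof. by rewrite -scaleN1r; exact: supportedZ. Qed.

Lemma supportedB P u v : supported P u -> supported P v -> supported P (u - v).
Proof. by move=> Pu /supportedN; exact: supportedD. Qed.

Lemma supported_sum P (I : Type) (r : seq I) (Q : pred I) (F : I -> {freeg K / rat}) :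
  (forall i, Q i -> supported P (F i)) -> supported P (\sum_(i <- r | Q i) F i).
Proof. by move=> h; elim/big_ind : _ => //; [exact: supported0|exact: supportedD]. Qed.

Lemma sub_supported P P' c : (forall x, P x -> P' x) -> supported P c -> supported P' c.
Proof. by move=> PP' Pc x /Pc/PP'. Qed.

Lemma eq_fglift_supported (V : lmodType rat) (f g : K -> V) P c :
  supported P c -> (forall x, P x -> f x = g x) -> fglift f c = fglift g c.
Proof.
move=> Pc fg; elim/freeg_supported_ind: Pc => [|x Px|a u v Fu Fv];
  rewrite ?linear0 ?fglift1 //.
  exact: fg.
by rewrite !fgliftD Fu Fv.
Qed.

Lemma eq_fglift (V : lmodType rat) (f g : K -> V) c :
  f =1 g -> fglift f c = fglift g c.
Proof. by move=> fg; apply: (@eq_fglift_supported _ _ _ predT). Qed.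

End FreeModule.

Lemma supported_fglift (K L : choiceType) (P : pred K) (Q : pred L) (f : K -> {freeg
  L / rat}) c :
  supported P c -> (forall x, P x -> supported Q (f x)) -> supported Q (fglift f c).
Proof.
move=> Pc fQ; elim/freeg_supported_ind: Pc => [|x Px|a u v Fu Fv].
- by rewrite linear0; exact: supported0.
- by rewrite fglift1; exact: fQ.
- by rewrite fgliftD; exact: supported_lin.
Qed.

Lemma fglift_comp (K L : choiceType) (V : lmodType rat) (f : K -> {freeg L / rat})
  (g : L -> V) c : fglift g (fglift f c) = fglift (fun x => fglift g (f x)) c.
Proof.
elim/freeg_ind: c => [|x|a u v Fu Fv]; rewrite ?linear0 ?fglift1 //.
by rewrite !fgliftD Fu Fv.
Qed.

Section MoreFree.
Variables (K : choiceType) (V : lmodType rat).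
Implicit Types (f g : K -> V) (c : {freeg K / rat}).

Lemma fglift_addf f g c :
  fglift (fun x => f x + g x) c = fglift f c + fglift g c.
Proof.
elim/freeg_ind: c => [|x|a u v Fu Fv]; rewrite ?linear0 ?fglift1 ?addr0 //.
by rewrite !fgliftD Fu Fv scalerDr addrACA.
Qed.

Lemma fglift_scalef k f c : fglift (fun x => k *: f x) c = k *: fglift f c.
Proof.
elim/freeg_ind: c => [|x|a u v Fu Fv]; rewrite ?linear0 ?fglift1 ?scaler0 //.
by rewrite !fgliftD Fu Fv scalerDr !scalerA mulrC.
Qed.

Lemma fglift_oppf f c : fglift (fun x => - f x) c = - fglift f c.
Proof.
by rewrite -scaleN1r -fglift_scalef; apply: eq_fglift => x; rewrite scaleN1r.
Qed.

Lemma fglift_subf f g c :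
  fglift (fun x => f x - g x) c = fglift f c - fglift g c.
Proof. by rewrite fglift_addf fglift_oppf. Qed.

Lemma fglift_0f c : fglift (fun=> 0 : V) c = 0.
Proof.
elim/freeg_ind: c => [|x|a u v Fu Fv]; rewrite ?linear0 ?fglift1 //.
by rewrite !fgliftD Fu Fv scaler0 addr0.
Qed.

Lemma fglift_linf (W : lmodType rat) (F : {linear V -> W}) f c :
  F (fglift f c) = fglift (fun x => F (f x)) c.
Proof.
elim/freeg_ind: c => [|x|a u v Fu Fv]; rewrite ?linear0 ?fglift1 //.
by rewrite !fgliftD linearP Fu Fv.
Qed.

End MoreFree.

Lemma fglift_exchange (K L : choiceType) (V : lmodType rat) (F : K -> L -> V)
  (c : {freeg K / rat}) (e : {freeg L / rat}) :
  fglift (fun x => fglift (F x) e) c = fglift (fun y => fglift (F^~ y) c) e.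
Proof.
elim/freeg_ind: c => [|x|a u v Fu Fv].
- by rewrite linear0 -[LHS](fglift_0f V e); apply: eq_fglift => y; rewrite linear0.
- by rewrite fglift1; apply: eq_fglift => y; rewrite fglift1.
- rewrite fgliftD Fu Fv -fglift_scalef -fglift_addf.
  by apply: eq_fglift => y; rewrite fgliftD.
Qed.

Notation freemap f := (fglift (fun x => << f x >>)).

Definition freeg_linE := (fglift_add, fgliftN, fgliftZ, fglift1).

(** * Solving for operators with values in a contractible complex *)
Section Solve.
Variables (B : choiceType) (size : B -> nat) (d : B -> {freeg B / rat}).
Variables (D : lmodType rat) (dD : {linear D -> D}).
Variables (h : B -> {linear D -> D}) (Q : B -> D) (eps : rat) (s0 : D).

(** The operator S sought satisfies dD (S b) = Q b - eps *: S (d b). With eps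
equal to -1 and Q equal to 0 this says that S is a chain map; with eps equal
to 1 and Q the difference of two chain maps, that S is a homotopy between them.
As h b contracts D, applying it to the right hand side gives a solution. The
first argument is fuel, needed because d b is a sum and not a subterm of b. *)
Fixpoint solve_rec n b : D :=
  if n is m.+1 then
    if size b is 0 then s0 else h b (Q b - eps *: fglift (solve_rec m) (d b))
  else s0.

Definition solve b := solve_rec (size b) b.

Hypothesis size_d : forall b, supported (fun b' => size b == (size b').+1) (d b).

Lemma solve_recE n b : (size b <= n)%N -> solve_rec n b = solve b.
Proof.
rewrite /solve; elim: n {-2}n (leqnn n) b => [|N IH] n.
  by rewrite leqn0 => /eqP -> b; rewrite leqn0 => /eqP ->.
move=> nN b; case: n nN => [|n] nN.
  by rewrite leqn0 => /eqP ->.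
move=> bn /=; case E : (size b) => [|m] //=.
rewrite E; congr (h b (_ - eps *: _)).
apply: eq_fglift_supported (size_d (b:=b)) _ => b'; rewrite E eqSS => /eqP b'm.
by rewrite IH ?IH ?b'm //; lia.
Qed.

Lemma solveE b : size b != 0%N ->
  solve b = h b (Q b - eps *: fglift solve (d b)).
Proof.
rewrite {1}/solve; case E : (size b) => [|m] //= _; rewrite E.
congr (h b (_ - eps *: _)); apply: eq_fglift_supported (size_d (b:=b)) _ => b'.
by rewrite E eqSS => /eqP b'm; rewrite solve_recE // b'm.
Qed.

Lemma solve0 b : size b = 0%N -> solve b = s0.
Proof. by rewrite /solve => ->. Qed.

Hypothesis dd : forall b, fglift d (d b) = 0.
Hypothesis contr : forall b c, size b != 0%N -> dD (h b c) = c - h b (dD c).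
Hypothesis Qd : forall b, dD (Q b) = eps *: fglift Q (d b).
Hypothesis Q0 : forall b, size b = 0%N -> dD s0 = Q b.

(** Acyclic models in one step: the right hand side is a cycle, by induction on
the size of b, so the contraction is a primitive of it. *)
Lemma solveP b : dD (solve b) = Q b - eps *: fglift solve (d b).
Proof.
elim: {b}(size b) {-2}b (erefl (size b)) => [|n IH] b sb.
  rewrite solve0 // (Q0 sb) (_ : fglift solve (d b) = 0) ?scaler0 ?subr0//.
  rewrite -(linear0 (fglift solve)).
  congr fglift; apply/eqP/freeg_eqP => x; rewrite coeff0; apply/eqP/negPn/negP.
  by move=> /size_d; rewrite sb.
rewrite solveE ?sb // contr ?sb //.
suff -> : dD (Q b - eps *: fglift solve (d b)) = 0 by rewrite linear0 subr0.
have E : dD (fglift solve (d b)) = fglift (fun b' => Q b' - eps *: fglift solve (d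
  b')) (d b).
  rewrite (fglift_linf dD); apply: eq_fglift_supported (size_d (b:=b)) _ => b'.
  by rewrite sb eqSS => /eqP b'n; rewrite IH.
rewrite linearB linearZ /= Qd E.
by rewrite fglift_subf fglift_scalef -fglift_comp dd linear0 scaler0 subr0 subrr.
Qed.

End Solve.

(** * Chains of words *)
Section OrderedChains.
Variable V : choiceType.

(** A nonempty list of vertices, in which repetitions are allowed: an ordered
simplex of the full simplex on V. *)
Definition word := (V * seq V)%type.

Definition word_cons a (w : word) : word := (a, w.1 :: w.2).

(** The alternating sum of faces. Deleting the head gives the first term, and
the other faces keep the head. The last term corrects the case of an edge
(x, y), whose second face is the vertex x: the recursive call on the single
vertex y returns 0, and not the empty word. *)
Fixpoint face_sum x s : {freeg word / rat} :=
  if s is y :: t then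
    << (y, t) >> - freemap (word_cons x) (face_sum y t) - (t == [::])%:R *: << (x,
      [::]) >>
  else 0.

Definition word_bd (w : word) := face_sum w.1 w.2.

Definition word_aug (w : word) : rat := (w.2 == [::])%:R.

Arguments word_bd : simpl never.
Arguments word_aug : simpl never.

Lemma word_bd_cons a w :
  word_bd (word_cons a w) = << w >> - freemap (word_cons a) (word_bd w) - word_aug w
    *: << (a, [::]) >>.
Proof. by case: w. Qed.

Lemma word_bd_nil a : word_bd (a, [::]) = 0.
Proof. by []. Qed.

(** The augmentation vanishes on boundaries. The vector v lets the identity be
used inside combinations that take values in any space. *)
Lemma word_aug_bd (W : lmodType rat) (v : W) w :
  fglift (fun w' => word_aug w' *: v) (word_bd w) = 0.
Proof.
case: w => x [|y t]; first by rewrite word_bd_nil fglift0.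
rewrite -[(x, _)]/(word_cons x (y, t)) word_bd_cons !fgliftB fgliftZ !fglift1
  fglift_comp.
rewrite (eq_fglift (g := fun=> 0)) ?fglift_0f; last first.
  by move=> w; rewrite fglift1 /word_aug scale0r.
by rewrite subr0 /word_aug scale1r subrr.
Qed.

Lemma word_bd_bd w : fglift word_bd (word_bd w) = 0.
Proof.
case: w => x s; elim: s x => [|y t IH] x; first by rewrite word_bd_nil fglift0.
rewrite -[(x, _)]/(word_cons x (y, t)) word_bd_cons !fgliftB fgliftZ !fglift1.
rewrite word_bd_nil scaler0 subr0 fglift_comp.
under eq_fglift => w do rewrite fglift1 word_bd_cons.
rewrite !fglift_subf word_aug_bd fglift_id subr0 -fglift_comp IH fglift0 subr0.
by rewrite subrr.
Qed.

Lemma size_word_bd w : supported (fun w' => size w.2 == (size w'.2).+1) (word_bd w).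
Proof.
case: w => x s; elim: s x => [|y t IH] x; first exact: supported0.
rewrite -[(x, _)]/(word_cons x (y, t)) word_bd_cons; apply: supportedB;
  first apply: supportedB.
- exact: supported1.
- by apply: supported_fglift (IH y) _ => w' /= /eqP tw; apply: supported1 => /=;
  rewrite tw.
- rewrite /word_aug /=; case: eqP => [->|_]; last by rewrite scale0r; exact: supported0.
  exact/supportedZ/supported1.
Qed.

End OrderedChains.

Section WordMap.
Variables (V W : choiceType) (g : V -> W).

Definition word_map (w : word V) : word W := (g w.1, map g w.2).

Lemma word_aug_map w : word_aug (word_map w) = word_aug w.
Proof. by case: w => x []. Qed.

Lemma word_bd_map w : word_bd (word_map w) = freemap word_map (word_bd w).
Proof.
case: w => x s; elim: s x => [|y t IH] x;
  first by rewrite /word_map/= !word_bd_nil fglift0.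
rewrite -[(x, y :: t)]/(word_cons x (y, t)).
have -> : word_map (word_cons x (y, t)) = word_cons (g x) (word_map (y, t)) by [].
rewrite !word_bd_cons IH word_aug_map !fgliftB fgliftZ !fglift1 !fglift_comp.
congr (_ - _ - _); apply: eq_fglift => w; rewrite !fglift1 //.
Qed.

End WordMap.

Section Simplicial.
Variable V : choiceType.

(** [None] is the generator of degree -1 of the augmented complex. Augmentation
makes the cone a contraction in every degree, with no exception in degree 0. *)
Definition simp_word : choiceType := option (word V).

Definition simp_size (b : simp_word) := if b is Some w then (size w.2).+1 else 0%N.

Definition simp_bd (b : simp_word) : {freeg simp_word / rat} :=
  if b is Some w then freemap Some (word_bd w) + word_aug w *: << None >> else 0.

Definition simp_cone_word (b c : simp_word) : {freeg simp_word / rat} :=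
  if b is Some v then
    << Some (if c is Some w then word_cons v.1 w else (v.1, [::])) >>
  else 0.

Definition simp_cone b := fglift (simp_cone_word b).

Lemma size_simp_bd b : supported (fun b' => simp_size b == (simp_size b').+1)
  (simp_bd b).
Proof.
case: b => [w|] /=; last exact: supported0.
apply: supportedD.
    by apply: supported_fglift (@size_word_bd _ w) _ => w' /eqP ww;
      apply: supported1 => /=; rewrite ww.
rewrite /word_aug /=; case: eqP => [->|_]; last by rewrite scale0r; exact: supported0.
exact/supportedZ/supported1.
Qed.

Lemma simp_bd_bd b : fglift simp_bd (simp_bd b) = 0.
Proof.
case: b => [w|] /=; last by rewrite fglift0.
rewrite fglift_add fgliftZ fglift1 scaler0 addr0 fglift_comp.
under eq_fglift => w' do rewrite fglift1 /=.
by rewrite fglift_addf word_aug_bd addr0 -fglift_comp word_bd_bd fglift0.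
Qed.

Lemma simp_cone_contr b c : simp_size b != 0%N ->
  fglift simp_bd (simp_cone b c) = c - simp_cone b (fglift simp_bd c).
Proof.
case: b => [v|//] _; elim/freeg_ind: c => [|x|a u w Fu Fv].
- by rewrite /simp_cone !fglift0 subr0.
- rewrite /simp_cone !fglift1 /=; case: x => [w|] /=; last first.
    by rewrite fglift0 subr0 word_bd_nil fglift0 add0r /word_aug scale1r.
  rewrite word_bd_cons !freeg_linE !fglift_comp /= scale0r addr0 opprD addrA.
  by congr (_ - _ - _); apply: eq_fglift => w'; rewrite !fglift1.
- by rewrite /simp_cone !fgliftD Fu Fv scalerBr addrACA -opprD.
Qed.

End Simplicial.

Section SimplicialMap.
Variables (V W : choiceType) (g : V -> W).

Definition simp_push : simp_word V -> simp_word W := omap (word_map g).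

Lemma simp_size_push b : simp_size (simp_push b) = simp_size b.
Proof. by case: b => //= w; rewrite size_map. Qed.

Lemma simp_bd_push b : simp_bd (simp_push b) = freemap simp_push (simp_bd b).
Proof.
case: b => [w|]; rewrite /= ?fglift0 //.
rewrite fglift_add fgliftZ fglift1 word_aug_map word_bd_map !fglift_comp; congr (_ + _).
by apply: eq_fglift => w'; rewrite !fglift1.
Qed.

Lemma simp_cone_push b c : simp_cone (simp_push b) (freemap simp_push c) = freemap
  simp_push (simp_cone b c).
Proof.
rewrite /simp_cone !fglift_comp; apply: eq_fglift => x; rewrite fglift1.
case: b => [v|]; last by rewrite /= fglift0.
by case: x => [w|] /=; rewrite fglift1.
Qed.

End SimplicialMap.

Section Tensor.
Variables V W : choiceType.

(** The tensor product of two complexes of words, augmented as a whole by the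
generator [None] of degree -1. *)
Definition tens_word : choiceType := option (word V * word W).

Definition tens_size (b : tens_word) :=
  if b is Some w then (size w.1.2 + size w.2.2).+1 else 0%N.

Definition tens_gen (u : word V) (v : word W) : tens_word := Some (u, v).

Definition tens_bd (b : tens_word) : {freeg tens_word / rat} :=
  if b is Some (u, v) then
    freemap (tens_gen^~ v) (word_bd u)
    + (-1) ^+ size u.2 *: freemap (tens_gen u) (word_bd v)
    + (word_aug u * word_aug v) *: << None >>
  else 0.

(** The contraction h (x) 1 + e (x) h of a tensor product, where h is the cone
and e sends each vertex to the apex. *)
Definition tens_cone_word (b c : tens_word) : {freeg tens_word / rat} :=
  if b is Some (u, v) then
    if c is Some (u', v') then
      << tens_gen (word_cons u.1 u') v' >>
      + word_aug u' *: << tens_gen (u.1, [::]) (word_cons v.1 v') >>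
    else << tens_gen (u.1, [::]) (v.1, [::]) >>
  else 0.

Definition tens_cone b := fglift (tens_cone_word b).

Lemma size_tens_bd b : supported (fun b' => tens_size b == (tens_size b').+1)
  (tens_bd b).
Proof.
case: b => [[u v]|] /=; last exact: supported0.
apply: supportedD; first apply: supportedD.
- by apply: supported_fglift (@size_word_bd _ u) _ => u' /eqP uu; apply: supported1;
  rewrite /= uu.
- apply: supportedZ.
  by apply: supported_fglift (@size_word_bd _ v) _ => u' /eqP uu; apply: supported1;
    rewrite /= uu addnS.
rewrite /word_aug /=; case: eqP => [->|_]; last by rewrite mul0r scale0r;
  exact: supported0.
case: eqP => [->|_]; last by rewrite mulr0 scale0r; exact: supported0.
exact/supportedZ/supported1.
Qed.

Lemma tens_bd_bd b : fglift tens_bd (tens_bd b) = 0.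
Proof.
case: b => [[u v]|] /=; last by rewrite fglift0.
rewrite !fglift_add !fgliftZ fglift1 scaler0 addr0 !fglift_comp.
have -> : fglift (fun u' => fglift tens_bd << tens_gen u' v >>) (word_bd u) =
   - (-1) ^+ size u.2 *: fglift (fun u' => freemap (tens_gen u') (word_bd v))
     (word_bd u).
  under eq_fglift => u' do rewrite fglift1 /=.
  rewrite !fglift_addf; under [X in _ + X]eq_fglift => u' do rewrite -scalerA.
  rewrite word_aug_bd addr0 -fglift_comp word_bd_bd fglift0 add0r.
  rewrite -fglift_scalef;
    apply: eq_fglift_supported (@size_word_bd _ u) _ => u' /eqP ->.
  by rewrite exprS mulN1r opprK.
have -> : fglift (fun v' => fglift tens_bd << tens_gen u v' >>) (word_bd v) =
   fglift (fun u' => freemap (tens_gen u') (word_bd v)) (word_bd u).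
  under eq_fglift => v' do rewrite fglift1 /=.
  rewrite !fglift_addf; under [X in _ + X]eq_fglift => u' do rewrite mulrC -scalerA.
  rewrite word_aug_bd addr0 fglift_scalef -fglift_comp word_bd_bd.
  by rewrite fglift0 scaler0 addr0 fglift_exchange.
by rewrite scaleNr addNr.
Qed.

Lemma tens_cone_contr b c : tens_size b != 0%N ->
  fglift tens_bd (tens_cone b c) = c - tens_cone b (fglift tens_bd c).
Proof.
case: b => [[[a s] [b t]]|//] _; elim/freeg_ind: c => [|x|k u w Fu Fv].
- by rewrite /tens_cone !fglift0 subr0.
- rewrite /tens_cone !fglift1 /=; case: x => [[u v]|] /=; last first.
    by rewrite fglift1 /= !word_bd_nil !fglift0 scaler0 !add0r subr0 /word_aug mul1r
      scale1r.
  rewrite !freeg_linE /= !word_bd_cons word_bd_nil !freeg_linE !fglift0 add0r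
    !fglift_comp /=.
  rewrite {2}/word_aug /= mul0r scale0r addr0.
  pose A := fglift (fun x => << tens_gen (word_cons a x) v >>) (word_bd u).
  pose C := fglift (fun x => << tens_gen (a, [::]) (word_cons b x) >>) (word_bd v).
  rewrite (eq_fglift (f := fun x => freemap (tens_gen^~ v) << word_cons a x >>) (g :=
    fun x => << tens_gen (word_cons a x) v >>) (word_bd u)); last first.
    by move=> x; rewrite fglift1.
  rewrite (eq_fglift (f := fun x => freemap (tens_gen (a, [::])) << word_cons b x >>)
    (g := fun x => << tens_gen (a, [::]) (word_cons b x) >>) (word_bd v)); last first.
    by move=> x; rewrite fglift1.
  rewrite (eq_fglift (f := fun x => fglift _ << tens_gen x v >>) (g := fun x =>
    << tens_gen (word_cons a x) v >> + word_aug x *: << tens_gen (a, [::]) (word_cons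
      b v) >>) (word_bd u)); last first.
    by move=> x; rewrite fglift1.
  rewrite (eq_fglift (f := fun x => fglift _ << tens_gen u x >>) (g := fun x =>
    << tens_gen (word_cons a u) x >> + word_aug u *: << tens_gen (a, [::]) (word_cons
      b x) >>) (word_bd v)); last first.
    by move=> x; rewrite fglift1.
  rewrite !fglift_addf word_aug_bd fglift_scalef addr0 -/A -/C.
  (* The augmentation is supported in degree 0, where the Koszul sign is 1. *)
  have sgn : (-1) ^+ size u.2 * word_aug u = word_aug u.
    by rewrite /word_aug; case: (u.2) => [|? ?]; rewrite ?mul1r ?mulr0.
  apply/eqP/freeg_eqP => x.
  rewrite !(coeffD, coeffN, coeffZ, coeff0).
  rewrite exprS [_ * (coeff x (freemap _ _) + _)]mulrDr (mulrA _ (word_aug u)) sgn.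
  rewrite /tens_gen; ring.
- by rewrite /tens_cone !fgliftD Fu Fv scalerBr addrACA -opprD.
Qed.

End Tensor.

Section TensorMap.
Variables (V V' W W' : choiceType) (g : V -> V') (k : W -> W').

Definition tens_push : tens_word V W -> tens_word V' W' :=
  omap (fun uv => (word_map g uv.1, word_map k uv.2)).

Lemma tens_size_push b : tens_size (tens_push b) = tens_size b.
Proof. by case: b => [[u v]|] //=; rewrite !size_map. Qed.

Lemma tens_bd_push b : tens_bd (tens_push b) = freemap tens_push (tens_bd b).
Proof.
case: b => [[u v]|]; rewrite /= ?fglift0 //.
rewrite !freeg_linE !word_aug_map !word_bd_map !fglift_comp size_map.
by congr (_ + _ *: _ + _); apply: eq_fglift => w'; rewrite !fglift1.
Qed.

Lemma tens_cone_push b c :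
  tens_cone (tens_push b) (freemap tens_push c) = freemap tens_push (tens_cone b c).
Proof.
rewrite /tens_cone !fglift_comp; apply: eq_fglift => x; rewrite fglift1.
case: b => [[u v]|]; last by rewrite /= fglift0.
by case: x => [[u' v']|] /=; rewrite !freeg_linE ?word_aug_map.
Qed.

End TensorMap.

(** Naturality is inherited from the contraction, whose apex moves along with
the word. *)
Section SolveNatural.
Variables (B : choiceType) (size : B -> nat) (d : B -> {freeg B / rat}).
Variables (D : lmodType rat) (h : B -> {linear D -> D}).
Variables (Q : B -> D) (eps : rat) (s0 : D).
Variables (p : B -> B) (P : {linear D -> D}).
Hypothesis size_d : forall b, supported (fun b' => size b == (size b').+1) (d b).
Hypothesis size_p : forall b, size (p b) = size b.
Hypothesis d_p : forall b, d (p b) = freemap p (d b).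
Hypothesis h_p : forall b c, h (p b) (P c) = P (h b c).
Hypothesis Q_p : forall b, Q (p b) = P (Q b).
Hypothesis P_s0 : P s0 = s0.

Lemma solve_natural b :
  solve size d h Q eps s0 (p b) = P (solve size d h Q eps s0 b).
Proof.
elim: {b}(size b) {-2}b (erefl (size b)) => [|n IH] b sb.
  by rewrite !solve0 ?size_p.
rewrite !solveE ?size_p ?sb //.
have PE u v : P (u - eps *: v) = P u - eps *: P v by rewrite linearB linearZ.
rewrite -h_p PE Q_p d_p fglift_comp (fglift_linf P); congr (h _ (_ - _ *: _)).
by apply: eq_fglift_supported (size_d (b:=b)) _ => b'; rewrite sb eqSS => /eqP b'n;
  rewrite fglift1 IH.
Qed.

End SolveNatural.

(** * Comparison of products and tensor products of words *)
Notation simp_nat := (simp_word (nat * nat)%type).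
Notation tens_nat := (tens_word nat nat).

Definition simp_apex (b : simp_nat) : tens_nat := omap (fun w => ((w.1.1, [::]),
  (w.1.2, [::]))) b.
Definition tens_apex (b : tens_nat) : simp_nat := omap (fun uv => ((uv.1.1, uv.2.1),
  [::])) b.

Definition simp_cone_lin (b : simp_nat) : {linear {freeg simp_nat / rat} -> {freeg
  simp_nat / rat}} :=
  fglift (simp_cone_word b).
Definition tens_cone_lin (b : tens_nat) : {linear {freeg tens_nat / rat} -> {freeg
  tens_nat / rat}} :=
  fglift (tens_cone_word b).

(** The Eilenberg-Zilber map in the direction of the cross product. The
recursion yields a chain map that is not the shuffle map term by term; like
the shuffle map, it is determined up to natural homotopy by its value in
degree 0. *)
Definition cross_word : tens_nat -> {freeg simp_nat / rat} :=
  solve (@tens_size nat nat) (@tens_bd nat nat) (fun b => simp_cone_lin (tens_apex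
    b)) (fun=> 0) (-1) << None >>.

(** The map in the opposite direction, in the role of the Alexander-Whitney
map. *)
Definition split_word : simp_nat -> {freeg tens_nat / rat} :=
  solve (@simp_size _) (@simp_bd _) (fun b => tens_cone_lin (simp_apex b)) (fun=> 0)
    (-1) << None >>.

Definition simp_htpy : simp_nat -> {freeg simp_nat / rat} :=
  solve (@simp_size _) (@simp_bd _) simp_cone_lin (fun b => << b >> - fglift
    cross_word (split_word b)) 1 0.

Definition tens_htpy : tens_nat -> {freeg tens_nat / rat} :=
  solve (@tens_size _ _) (@tens_bd _ _) tens_cone_lin (fun b => << b >> - fglift
    split_word (cross_word b)) 1 0.

Lemma simp_size_eq0 (V : choiceType) (b : simp_word V) : simp_size b = 0%N -> b = None.
Proof. by case: b. Qed.
Lemma tens_size_eq0 (V W : choiceType) (b : tens_word V W) : tens_size b = 0%N -> b =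
  None.
Proof. by case: b. Qed.

Lemma cross_word_bd b : fglift (@simp_bd _) (cross_word b) = fglift cross_word
  (tens_bd b).
Proof.
rewrite /cross_word (solveP (dD := fglift (@simp_bd _))) ?sub0r ?scaleN1r ?opprK //.
- exact: size_tens_bd.
- exact: tens_bd_bd.
- by move=> {}b c b0; apply: simp_cone_contr; case: b b0.
- by move=> {}b; rewrite fglift_0f scaler0 linear0.
- by move=> *; rewrite /= fglift1.
Qed.

Lemma split_word_bd b : fglift (@tens_bd _ _) (split_word b) = fglift split_word
  (simp_bd b).
Proof.
rewrite /split_word (solveP (dD := fglift (@tens_bd _ _))) ?sub0r ?scaleN1r ?opprK //.
- exact: size_simp_bd.
- exact: simp_bd_bd.
- by move=> {}b c b0; apply: tens_cone_contr; case: b b0.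
- by move=> {}b; rewrite fglift_0f scaler0 linear0.
- by move=> *; rewrite /= fglift1.
Qed.

Lemma cross_word0 : cross_word None = << None >>. Proof. exact: solve0. Qed.
Lemma split_word0 : split_word None = << None >>. Proof. exact: solve0. Qed.
Lemma simp_htpy0 : simp_htpy None = 0. Proof. exact: solve0. Qed.
Lemma tens_htpy0 : tens_htpy None = 0. Proof. exact: solve0. Qed.

Lemma fglift_bd_comm (B B' : choiceType) (T : B -> {freeg B' / rat}) d d' c :
  (forall b, fglift d' (T b) = fglift T (d b)) ->
  fglift d' (fglift T c) = fglift T (fglift d c).
Proof. by move=> h; rewrite !fglift_comp; apply: eq_fglift. Qed.

Lemma simp_htpy_bd b : fglift (@simp_bd _) (simp_htpy b) =
  << b >> - fglift cross_word (split_word b) - fglift simp_htpy (simp_bd b).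
Proof.
rewrite /simp_htpy (solveP (dD := fglift (@simp_bd _))) ?scale1r //.
- exact: size_simp_bd.
- exact: simp_bd_bd.
- by move=> {}b c b0; exact: simp_cone_contr.
- move=> {}b; rewrite scale1r /= fgliftB fglift1 fglift_subf fglift_id -fglift_comp.
  by rewrite -split_word_bd; congr (_ - _); apply: fglift_bd_comm; exact: cross_word_bd.
- by move=> {}b /simp_size_eq0 ->;
  rewrite split_word0 fglift1 cross_word0 subrr linear0.
Qed.

Lemma tens_htpy_bd b : fglift (@tens_bd _ _) (tens_htpy b) =
  << b >> - fglift split_word (cross_word b) - fglift tens_htpy (tens_bd b).
Proof.
rewrite /tens_htpy (solveP (dD := fglift (@tens_bd _ _))) ?scale1r //.
- exact: size_tens_bd.
- exact: tens_bd_bd.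
- by move=> {}b c b0; exact: tens_cone_contr.
- move=> {}b; rewrite scale1r /= fgliftB fglift1 fglift_subf fglift_id -fglift_comp.
  by rewrite -cross_word_bd; congr (_ - _); apply: fglift_bd_comm; exact: split_word_bd.
- by move=> {}b /tens_size_eq0 ->;
  rewrite cross_word0 fglift1 split_word0 subrr linear0.
Qed.

Section Natural.
Variables phi psi : nat -> nat.
Definition simp_pair : simp_nat -> simp_nat := simp_push (fun xy => (phi xy.1, psi
  xy.2)).
Definition tens_pair : tens_nat -> tens_nat := tens_push phi psi.

Lemma cross_word_natural b : cross_word (tens_pair b) = freemap simp_pair (cross_word
  b).
Proof.
rewrite /cross_word; apply: (@solve_natural _ _ _ _ _ _ _ _ _ (freemap simp_pair)).
- exact: size_tens_bd.
- exact: tens_size_push.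
- exact: tens_bd_push.
- move=> {}b c; rewrite [RHS]/= -[RHS]simp_cone_push; congr (simp_cone_lin _ _).
  by case: b => [[]|].
- by move=> {}b; rewrite linear0.
- by rewrite /= fglift1.
Qed.

Lemma split_word_natural b : split_word (simp_pair b) = freemap tens_pair (split_word
  b).
Proof.
rewrite /split_word; apply: (@solve_natural _ _ _ _ _ _ _ _ _ (freemap tens_pair)).
- exact: size_simp_bd.
- exact: simp_size_push.
- exact: simp_bd_push.
- move=> {}b c; rewrite [RHS]/= -[RHS]tens_cone_push; congr (tens_cone_lin _ _).
  by case: b => [[]|].
- by move=> {}b; rewrite linear0.
- by rewrite /= fglift1.
Qed.

Lemma simp_htpy_natural b : simp_htpy (simp_pair b) = freemap simp_pair (simp_htpy b).
Proof.
rewrite /simp_htpy; apply: (@solve_natural _ _ _ _ _ _ _ _ _ (freemap simp_pair)).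
- exact: size_simp_bd.
- exact: simp_size_push.
- exact: simp_bd_push.
- by move=> {}b c; exact: simp_cone_push.
- move=> {}b; rewrite /= fgliftB fglift1 split_word_natural !fglift_comp; congr (_ - _).
  by apply: eq_fglift => x; rewrite fglift1 cross_word_natural.
- by rewrite linear0.
Qed.

Lemma tens_htpy_natural b : tens_htpy (tens_pair b) = freemap tens_pair (tens_htpy b).
Proof.
rewrite /tens_htpy; apply: (@solve_natural _ _ _ _ _ _ _ _ _ (freemap tens_pair)).
- exact: size_tens_bd.
- exact: tens_size_push.
- exact: tens_bd_push.
- by move=> {}b c; exact: tens_cone_push.
- move=> {}b; rewrite /= fgliftB fglift1 cross_word_natural !fglift_comp; congr (_ - _).
  by apply: eq_fglift => x; rewrite fglift1 split_word_natural.
- by rewrite linear0.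
Qed.

End Natural.

(** The cross product respects degrees: the recursion lowers the size once and
the cone raises it once. *)
Lemma cross_word_size b : supported (fun c => simp_size c == tens_size b) (cross_word
  b).
Proof.
elim: {b}(tens_size b) {-2}b (erefl (tens_size b)) => [|n IH] b sb.
  by move/tens_size_eq0: sb => ->; rewrite cross_word0; exact: supported1.
rewrite /cross_word solveE ?sb //; last exact: size_tens_bd.
rewrite -/cross_word sub0r scaleN1r opprK.
apply: (supported_fglift (P := fun c => simp_size c == n)).
  apply: supported_fglift (@size_tens_bd _ _ b) _ => b'; rewrite sb eqSS => /eqP b'n.
  by rewrite b'n; apply: IH.
case: b {sb} => [[[a s] [b t]]|] x xn; last exact: supported0.
by apply: supported1; case: x xn => [w|] /= /eqP <-.
Qed.

(** * Symmetric sets and the Eilenberg-Zilber theorem *)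
(** The singular simplices of a space, of all degrees together: [sact s m f] is
the simplex of degree m obtained from s by sending vertex j to vertex f j. A
vertex out of range counts as vertex 0, both for f here and in the composition
law, so that f can be any function and no dependent type is needed. *)
Record symset := SymSet {
  scarrier :> choiceType;
  sdeg : scarrier -> nat;
  sact : scarrier -> nat -> (nat -> nat) -> scarrier;
  sdeg_act : forall s m f, sdeg (sact s m f) = m;
  sact_ext : forall s m f g, (forall j, (j <= m)%N -> f j = g j) ->
    sact s m f = sact s m g;
  sact_act : forall s m f k g, sact (sact s m f) k g =
    sact s k (fun j => f (if (g j <= m)%N then g j else 0%N));
  sact_id : forall s, sact s (sdeg s) id = s
}.

(** The default value is the head of the word, in accordance with the
convention of [symset] on vertices that are out of range. *)
Definition word_vertex (w : word nat) : nat -> nat := nth w.1 (w.1 :: w.2).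

Definition std_word n : word nat := (0%N, iota 1 n).

Lemma word_map_comp (U V W : choiceType) (g : V -> W) (f : U -> V) w :
  word_map g (word_map f w) = word_map (g \o f) w.
Proof. by rewrite /word_map /= map_comp. Qed.

Lemma word_map_id (U : choiceType) (w : word U) : word_map id w = w.
Proof. by case: w => x s; rewrite /word_map map_id. Qed.

Lemma word_vertex_map (f : nat -> nat) w j : (j <= size w.2)%N -> word_vertex
  (word_map f w) j = f (word_vertex w j).
Proof. by move=> jw; rewrite /word_vertex /= -map_cons (nth_map w.1). Qed.

Lemma word_vertex_std n j : (j <= n)%N -> word_vertex (std_word n) j = j.
Proof. by move=> jn; rewrite /word_vertex -[_ :: _]/(iota 0 n.+1) nth_iota. Qed.

Lemma word_map_std (U : choiceType) (f : nat -> U) n :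
  word_map f (std_word n) = (f 0%N, [seq f i | i <- iota 1 n]).
Proof. by []. Qed.

Lemma word_map_nth_std (U : choiceType) (w : word U) :
  word_map (nth w.1 (w.1 :: w.2)) (std_word (size w.2)) = w.
Proof.
case: w => x s; rewrite word_map_std; congr (_, _).
rewrite -[1%N]addn0 iotaDl -map_comp -[RHS](mkseq_nth x).
by apply: eq_map => i.
Qed.

Section SymmetricSet.
Variable K : symset.
Implicit Types (s : K) (w : word nat).

Definition word_act s w : K := sact s (size w.2) (word_vertex w).

Lemma sdeg_word_act s w : sdeg (word_act s w) = size w.2.
Proof. exact: sdeg_act. Qed.

Lemma word_act_act s w v : word_act (word_act s w) v = word_act s (word_map
  (word_vertex w) v).
Proof.
rewrite /word_act sact_act size_map; apply: sact_ext => j jv.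
rewrite word_vertex_map //; case: leqP => // wv.
by rewrite [in RHS]/word_vertex nth_default.
Qed.

Lemma word_act_std s : word_act s (std_word (sdeg s)) = s.
Proof.
rewrite /word_act size_iota -[RHS]sact_id; apply: sact_ext => j; exact: word_vertex_std.
Qed.

(** The differential of the total complex of K, on a basis element. *)
Definition simplex_bd s : {freeg K / rat} := freemap (word_act s) (word_bd (std_word
  (sdeg s))).

Lemma sdeg_simplex_bd s : supported (fun s' => sdeg s == (sdeg s').+1) (simplex_bd s).
Proof.
apply: supported_fglift (@size_word_bd _ (std_word (sdeg s))) _ => w /eqP ws.
by apply: supported1; rewrite sdeg_word_act -ws size_iota.
Qed.

End SymmetricSet.

(** A functor of two symmetric sets that is free on models: [mS] is its basis
at K and L, [mB] the corresponding basis on words of vertices, [mpush] the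
action of maps of vertices, and [mev a b] the evaluation of words at the
simplices a and b. Each basis element is the value of a universal word
[miota s]. *)
Record model (K L : symset) := Model {
  mB : choiceType;
  mS : choiceType;
  mpush : (nat -> nat) -> (nat -> nat) -> mB -> mB;
  mev : K -> L -> mB -> {freeg mS / rat};
  mfst : mS -> K;
  msnd : mS -> L;
  miota : mS -> mB;
  mev_iota : forall s, mev (mfst s) (msnd s) (miota s) = << s >>;
  mev_word_act : forall a b u v w, mev (word_act a u) (word_act b v) w =
    mev a b (mpush (word_vertex u) (word_vertex v) w);
  mevP : forall a b w, mev a b w = 0 \/ exists s u v,
    [/\ mev a b w = << s >>, mpush (word_vertex u) (word_vertex v) (miota s) = w,
        mfst s = word_act a u & msnd s = word_act b v]
}.

Section Realization.
Variables (K L : symset).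

(** The second clause says that an operation respects the augmentation, that
is, the words that evaluate to 0. *)
Definition natural_op (M N : model K L) (T : mB M -> {freeg (mB N) / rat}) :=
  (forall phi psi w, T (mpush phi psi w) = freemap (mpush phi psi) (T w)) /\
  (forall a b w, mev a b w = 0 -> fglift (mev a b) (T w) = 0).

Definition realize (M N : model K L) (T : mB M -> {freeg (mB N) / rat}) (s : mS M) :
  {freeg (mS N) / rat} := fglift (mev (mfst s) (msnd s)) (T (miota s)).

(** The Yoneda lemma for models: a natural operation on words and its
realization correspond under evaluation. Hence realization is compatible with
composition, and identities between operations on words carry over. *)
Lemma realize_ev (M N : model K L) (T : mB M -> {freeg (mB N) / rat}) a b w :
  natural_op T -> fglift (mev a b) (T w) = fglift (realize T) (mev a b w).
Proof.
move=> [Tp T0]; case: (mevP a b w) => [w0|[s [u [v [ws wE su sv]]]]].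
  by rewrite w0 T0 // fglift0.
rewrite ws -wE fglift1 /realize Tp fglift_comp; apply: eq_fglift => x.
by rewrite fglift1 su sv mev_word_act.
Qed.

Lemma realize_comp (M N P : model K L) (T : mB M -> {freeg (mB N) / rat})
    (T' : mB N -> {freeg (mB P) / rat}) s : natural_op T' ->
  realize (fun w => fglift T' (T w)) s = fglift (realize T') (realize T s).
Proof.
move=> T'n; rewrite /realize !fglift_comp; apply: eq_fglift => w.
exact: realize_ev.
Qed.

Lemma realize_id (M : model K L) (s : mS M) : realize (fun w : mB M => << w >>) s =
  << s >>.
Proof. by rewrite /realize fglift1 mev_iota. Qed.

Lemma realize_sub (M N : model K L) (T T' : mB M -> {freeg (mB N) / rat}) s :
  realize (fun w => T w - T' w) s = realize T s - realize T' s.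
Proof. exact: fgliftB. Qed.

End Realization.

(** The product of K and L in the degreewise sense. It is given by its
projections and pairing so that the singular simplices of a product space can
be used directly. The pairing is a total function, constrained on pairs of
simplices of equal degree. *)
Record symprod (K L : symset) := SymProd {
  pset :> symset;
  pfst : pset -> K;
  psnd : pset -> L;
  ppair : K -> L -> pset;
  pfst_deg : forall s, sdeg (pfst s) = sdeg s;
  psnd_deg : forall s, sdeg (psnd s) = sdeg s;
  pfst_act : forall s m f, pfst (sact s m f) = sact (pfst s) m f;
  psnd_act : forall s m f, psnd (sact s m f) = sact (psnd s) m f;
  pfst_pair : forall a b, sdeg a = sdeg b -> pfst (ppair a b) = a;
  psnd_pair : forall a b, sdeg a = sdeg b -> psnd (ppair a b) = b;
  ppair_eta : forall s, ppair (pfst s) (psnd s) = s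
}.

Section Models.
Variables (K L : symset) (M : symprod K L).

Definition simp_ev (a : K) (b : L) (w : simp_nat) : {freeg M / rat} :=
  if w is Some w then << ppair M (word_act a (word_map fst w)) (word_act b (word_map
    snd w)) >>
  else 0.

Definition simp_iota (s : M) : simp_nat := Some (word_map (fun i => (i, i)) (std_word
  (sdeg s))).

Lemma simp_ev_iota s : simp_ev (pfst s) (psnd s) (simp_iota s) = << s >>.
Proof.
rewrite /= !word_map_comp !word_map_id -{1}(pfst_deg s) -(psnd_deg s) !word_act_std.
by rewrite ppair_eta.
Qed.

Lemma simp_ev_word_act a b u v w : simp_ev (word_act a u) (word_act b v) w =
  simp_ev a b (simp_pair (word_vertex u) (word_vertex v) w).
Proof. by case: w => [w|//]; rewrite /= !word_act_act !word_map_comp. Qed.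

Lemma simp_evP a b w : simp_ev a b w = 0 \/ exists s u v,
    [/\ simp_ev a b w = << s >>, simp_pair (word_vertex u) (word_vertex v) (simp_iota
      s) = w,
        pfst s = word_act a u & psnd s = word_act b v].
Proof.
case: w => [w|]; [right|by left].
exists (ppair M (word_act a (word_map fst w)) (word_act b (word_map snd w))).
exists (word_map fst w), (word_map snd w).
have sab : sdeg (word_act a (word_map fst w)) = sdeg (word_act b (word_map snd w)).
  by rewrite !sdeg_word_act !size_map.
split; rewrite ?pfst_pair ?psnd_pair //.
  rewrite /simp_pair /simp_iota -pfst_deg pfst_pair // sdeg_word_act size_map /=;
    congr Some.
  rewrite word_map_comp -[RHS]word_map_nth_std; rewrite /word_map /=; congr (_, _).
    by rewrite /word_vertex; case: (w.1).
  have E i : i \in iota 1 (size w.2) ->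
      (word_vertex (word_map fst w) i, word_vertex (word_map snd w) i) = nth w.1 (w.1
        :: w.2) i.
    rewrite mem_iota add1n => /andP[_ iw].
    rewrite /word_vertex /= -!map_cons !(nth_map w.1) //.
    by case: (nth _ _ _).
  exact/eq_in_map.
Qed.

Definition simp_model : model K L := Model simp_ev_iota simp_ev_word_act simp_evP.

Definition tens_ev (a : K) (b : L) (w : tens_nat) : {freeg (K * L)%type / rat} :=
  if w is Some (u, v) then << (word_act a u, word_act b v) >> else 0.

Definition tens_iota (s : K * L) : tens_nat := Some (std_word (sdeg s.1), std_word
  (sdeg s.2)).

Lemma tens_ev_iota s : tens_ev s.1 s.2 (tens_iota s) = << s >>.
Proof. by case: s => a b; rewrite /= !word_act_std. Qed.

Lemma tens_ev_word_act a b u v w : tens_ev (word_act a u) (word_act b v) w =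
  tens_ev a b (tens_pair (word_vertex u) (word_vertex v) w).
Proof. by case: w => [[u' v']|//]; rewrite /= !word_act_act. Qed.

Lemma tens_evP a b w : tens_ev a b w = 0 \/ exists s u v,
    [/\ tens_ev a b w = << s >>, tens_pair (word_vertex u) (word_vertex v) (tens_iota
      s) = w,
        s.1 = word_act a u & s.2 = word_act b v].
Proof.
case: w => [[u v]|]; [right|by left].
exists (word_act a u, word_act b v), u, v; split => //.
by rewrite /tens_pair /tens_iota /= !sdeg_word_act !word_map_nth_std.
Qed.

Definition tens_model : model K L := Model tens_ev_iota tens_ev_word_act tens_evP.

Lemma cross_word_op : natural_op (M := tens_model) (N := simp_model) cross_word.
Proof.
split=> [phi psi w|a b [[u v]|]]; first exact: cross_word_natural.
  move=> /eqP; rewrite /= freegU_eq0 oner_eq0 //.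
by move=> _; rewrite cross_word0 fglift1.
Qed.

Lemma split_word_op : natural_op (M := simp_model) (N := tens_model) split_word.
Proof.
split=> [phi psi w|a b [u|]]; first exact: split_word_natural.
  move=> /eqP; rewrite /= freegU_eq0 oner_eq0 //.
by move=> _; rewrite split_word0 fglift1.
Qed.

Lemma simp_htpy_op : natural_op (M := simp_model) (N := simp_model) simp_htpy.
Proof.
split=> [phi psi w|a b [u|]]; first exact: simp_htpy_natural.
  move=> /eqP; rewrite /= freegU_eq0 oner_eq0 //.
by move=> _; rewrite simp_htpy0 fglift0.
Qed.

Lemma tens_htpy_op : natural_op (M := tens_model) (N := tens_model) tens_htpy.
Proof.
split=> [phi psi w|a b [[u v]|]]; first exact: tens_htpy_natural.
  move=> /eqP; rewrite /= freegU_eq0 oner_eq0 //.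
by move=> _; rewrite tens_htpy0 fglift0.
Qed.

Lemma simp_bd_op : natural_op (M := simp_model) (N := simp_model) (@simp_bd _).
Proof.
split=> [phi psi w|a b [u|]]; first exact: simp_bd_push.
  move=> /eqP; rewrite /= freegU_eq0 oner_eq0 //.
by move=> _; rewrite fglift0.
Qed.

Lemma tens_bd_op : natural_op (M := tens_model) (N := tens_model) (@tens_bd _ _).
Proof.
split=> [phi psi w|a b [[u v]|]]; first exact: tens_bd_push.
  move=> /eqP; rewrite /= freegU_eq0 oner_eq0 //.
by move=> _; rewrite fglift0.
Qed.

(** The differential of the tensor product of the two total complexes. *)
Definition tensor_bd (s : K * L) : {freeg (K * L)%type / rat} :=
  freemap (fun a => (a, s.2)) (simplex_bd s.1) +
  (-1) ^+ sdeg s.1 *: freemap (fun b => (s.1, b)) (simplex_bd s.2).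

Lemma realize_simp_bd s : realize (M := simp_model) (N := simp_model) (@simp_bd _) s
  = @simplex_bd M s.
Proof.
rewrite /realize /= !freeg_linE scaler0 addr0 word_bd_map !fglift_comp;
  apply: eq_fglift => w.
rewrite !fglift1 /= !word_map_comp !word_map_id -[in RHS](ppair_eta (word_act s w)).
by rewrite /word_act pfst_act psnd_act.
Qed.

Lemma realize_tens_bd s : realize (M := tens_model) (N := tens_model) (@tens_bd _ _)
  s = tensor_bd s.
Proof.
case: s => a b; rewrite /realize /= !freeg_linE scaler0 addr0 !fglift_comp /tensor_bd
  /simplex_bd size_iota /=.
rewrite !fglift_comp; congr (_ + _ *: _); apply: eq_fglift => w.
  by rewrite !fglift1 /= word_act_std.
by rewrite !fglift1 /= word_act_std.
Qed.

Definition eilenberg_zilber := realize (M := tens_model) (N := simp_model) cross_word.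
Definition alexander_whitney := realize (M := simp_model) (N := tens_model) split_word.
Definition realize_simp_htpy := realize (M := simp_model) (N := simp_model) simp_htpy.
Definition realize_tens_htpy := realize (M := tens_model) (N := tens_model) tens_htpy.

Lemma eilenberg_zilber_bd c : fglift (@simplex_bd M) (fglift eilenberg_zilber c) =
  fglift eilenberg_zilber (fglift tensor_bd c).
Proof.
rewrite !fglift_comp; apply: eq_fglift => s.
rewrite -realize_tens_bd -(realize_comp (M := tens_model) (N := tens_model) (P :=
  simp_model)).
  rewrite (eq_fglift (g := realize (M := simp_model) (N := simp_model) (@simp_bd _))).
    rewrite -(realize_comp (M := tens_model) (N := simp_model) (P := simp_model)).
      by rewrite /realize; congr fglift; exact: cross_word_bd.
    exact: simp_bd_op.
  by move=> t; rewrite realize_simp_bd.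
exact: cross_word_op.
Qed.

Lemma alexander_whitney_bd c : fglift tensor_bd (fglift alexander_whitney c) = fglift
  alexander_whitney (fglift (@simplex_bd M) c).
Proof.
rewrite !fglift_comp; apply: eq_fglift => s.
rewrite -realize_simp_bd -(realize_comp (M := simp_model) (N := simp_model) (P :=
  tens_model)).
  rewrite (eq_fglift (g := realize (M := tens_model) (N := tens_model) (@tens_bd _ _))).
    rewrite -(realize_comp (M := simp_model) (N := tens_model) (P := tens_model)).
      by rewrite /realize; congr fglift; exact: split_word_bd.
    exact: tens_bd_op.
  by move=> t; rewrite realize_tens_bd.
exact: split_word_op.
Qed.

Lemma realize_simp_htpy_bd c : fglift (@simplex_bd M) (fglift realize_simp_htpy c) =
  c - fglift eilenberg_zilber (fglift alexander_whitney c) - fglift realize_simp_htpy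
    (fglift (@simplex_bd M) c).
Proof.
rewrite !fglift_comp -[X in _ = X - _ - _]fglift_id -!fglift_subf;
  apply: eq_fglift => s.
rewrite -realize_simp_bd -!(realize_comp (M := simp_model) (P := simp_model)).
- rewrite (eq_fglift (g := realize (M := simp_model) (N := simp_model) (@simp_bd _))).
    rewrite -(realize_comp (M := simp_model) (N := simp_model) (P := simp_model)).
      rewrite -(realize_id (M := simp_model)) -!(realize_sub (M := simp_model) (N :=
        simp_model)) /realize; congr fglift.
      exact: simp_htpy_bd.
    exact: simp_bd_op.
  by move=> t; rewrite realize_simp_bd.
- exact: simp_htpy_op.
- exact: cross_word_op.
Qed.

Lemma realize_tens_htpy_bd c : fglift tensor_bd (fglift realize_tens_htpy c) =
  c - fglift alexander_whitney (fglift eilenberg_zilber c) - fglift realize_tens_htpy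
    (fglift tensor_bd c).
Proof.
rewrite !fglift_comp -[X in _ = X - _ - _]fglift_id -!fglift_subf;
  apply: eq_fglift => s.
rewrite -realize_tens_bd -!(realize_comp (M := tens_model) (P := tens_model)).
- rewrite (eq_fglift (g := realize (M := tens_model) (N := tens_model) (@tens_bd _ _))).
    rewrite -(realize_comp (M := tens_model) (N := tens_model) (P := tens_model)).
      rewrite -(realize_id (M := tens_model)) -!(realize_sub (M := tens_model) (N :=
        tens_model)) /realize; congr fglift.
      exact: tens_htpy_bd.
    exact: tens_bd_op.
  by move=> t; rewrite realize_tens_bd.
- exact: tens_htpy_op.
- exact: split_word_op.
Qed.

Lemma tensor_bd_bd s : fglift tensor_bd (tensor_bd s) = 0.
Proof.
rewrite -realize_tens_bd (eq_fglift (g := realize (M := tens_model) (N := tens_model)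
  (@tens_bd _ _))).
  rewrite -(realize_comp (M := tens_model) (N := tens_model) (P := tens_model)).
    by rewrite /realize tens_bd_bd fglift0.
  exact: tens_bd_op.
by move=> t; rewrite realize_tens_bd.
Qed.

Lemma eilenberg_zilber_deg s : supported (fun t => sdeg t == (sdeg s.1 + sdeg s.2)%N)
  (eilenberg_zilber s).
Proof.
apply: supported_fglift (@cross_word_size (tens_iota s)) _ => -[w|] /=; last first.
  by move=> _; exact: supported0.
rewrite !size_iota => /eqP [ws]; apply: supported1.
by rewrite -pfst_deg pfst_pair !sdeg_word_act !size_map // ws.
Qed.

End Models.

Arguments eilenberg_zilber {K L} M s : rename.
Arguments alexander_whitney {K L} M s : rename.
Arguments realize_simp_htpy {K L} M s : rename.

Definition symmap (K K' : symset) (g : K -> K') :=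
  (forall s, sdeg (g s) = sdeg s) /\
  (forall s m f, g (sact s m f) = sact (g s) m f).

Lemma simplex_bd_map (K K' : symset) (g : K -> K') s : symmap g ->
  simplex_bd (g s) = freemap g (simplex_bd s).
Proof.
move=> [gd ga]; rewrite /simplex_bd gd fglift_comp; apply: eq_fglift => w.
by rewrite fglift1 /word_act ga.
Qed.

Lemma eilenberg_zilber_map (K K' L L' : symset) (M : symprod K L) (M' : symprod K' L')
    (g : K -> K') (k : L -> L') (m : M -> M') s :
  symmap g -> symmap k -> (forall s, pfst (m s) = g (pfst s)) ->
  (forall s, psnd (m s) = k (psnd s)) ->
  eilenberg_zilber M' (g s.1, k s.2) = freemap m (eilenberg_zilber M s).
Proof.
move=> [gd ga] [kd ka] m1 m2; rewrite /eilenberg_zilber /realize [RHS]fglift_comp.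
have -> : @miota _ _ (tens_model K' L') (g s.1, k s.2) = tens_iota s.
  by rewrite /= /tens_iota /= gd kd.
apply: eq_fglift => -[w|]; rewrite /= ?fglift0 // fglift1; congr << _ >>.
by rewrite -[RHS]ppair_eta m1 m2 pfst_pair ?psnd_pair /word_act ?ga ?ka // !sdeg_act
  !size_map.
Qed.

(** * The Kunneth formula *)
Lemma big_pair (V : lmodType rat) (I J : finType) (f : I * J -> V) :
  \sum_p f p = \sum_i \sum_j f (i, j).
Proof. by rewrite pair_bigA; apply: eq_bigr => -[]. Qed.

Section TensorChains.
Variables (K L : choiceType).

Definition tens (u : {freeg K / rat}) (v : {freeg L / rat}) :
  {freeg (K * L)%type / rat} := fglift (fun a => freemap (pair a) v) u.

Lemma tens_linl a u u' v : tens (a *: u + u') v = a *: tens u v + tens u' v.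
Proof. exact: fgliftD. Qed.

Lemma tens_linr a u v v' : tens u (a *: v + v') = a *: tens u v + tens u v'.
Proof.
rewrite /tens -fglift_scalef -fglift_addf; apply: eq_fglift => x.
exact: fgliftD.
Qed.

Lemma tens11 a b : tens << a >> << b >> = << (a, b) >>.
Proof. by rewrite /tens !fglift1. Qed.

HB.instance Definition _ u := GRing.isLinear.Build rat _ _ _ (tens u)
  (fun a v v' => tens_linr a u v v').
Lemma tens0l v : tens 0 v = 0.
Proof. exact: (linear0 (fglift (fun a => freemap (pair a) v))). Qed.
Lemma tensDl u u' v : tens (u + u') v = tens u v + tens u' v.
Proof. exact: (linearD (fglift (fun a => freemap (pair a) v))). Qed.
Lemma tensBl u u' v : tens (u - u') v = tens u v - tens u' v.
Proof. exact: (linearB (fglift (fun a => freemap (pair a) v))). Qed.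
Lemma tensZl a u v : tens (a *: u) v = a *: tens u v.
Proof. exact: (linearZ_LR (fglift (fun a => freemap (pair a) v))). Qed.
Lemma tens_suml (I : Type) (r : seq I) (P : pred I) f v :
  tens (\sum_(i <- r | P i) f i) v = \sum_(i <- r | P i) tens (f i) v.
Proof. exact: (linear_sum (fglift (fun a => freemap (pair a) v))). Qed.
Lemma tens0r u : tens u 0 = 0.
Proof. exact: (linear0 (tens u)). Qed.
Lemma tensDr u v v' : tens u (v + v') = tens u v + tens u v'.
Proof. exact: (linearD (tens u)). Qed.
Lemma tensZr a u v : tens u (a *: v) = a *: tens u v.
Proof. exact: (linearZ_LR (tens u)). Qed.
Lemma tens_sumr (I : Type) (r : seq I) (P : pred I) f u :
  tens u (\sum_(i <- r | P i) f i) = \sum_(i <- r | P i) tens u (f i).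
Proof. exact: (linear_sum (tens u)). Qed.

Lemma coeff_tens a b u v : coeff (a, b) (tens u v) = coeff a u * coeff b v.
Proof.
elim/freeg_ind: u => [|x|k u w Fu Fw]; first by rewrite tens0l !coeff0 mul0r.
- rewrite coeffU mul1r; elim/freeg_ind: v => [|y|k u w Fu Fw].
  + by rewrite tens0r !coeff0 mulr0.
  + by rewrite tens11 !coeffU !mul1r xpair_eqE -mulnb natrM.
  + by rewrite tens_linr !(coeffD, coeffZ) Fu Fw; ring.
- by rewrite tens_linl !(coeffD, coeffZ) Fu Fw; ring.
Qed.

(** The coefficient of the simplex a when a tensor chain is written as a sum of
terms a (x) v. *)
Definition slice a (w : {freeg (K * L)%type / rat}) : {freeg L / rat} :=
  fglift (fun s => (s.1 == a)%:R *: << s.2 >>) w.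

Lemma coeff_slice a b w : coeff b (slice a w) = coeff (a, b) w.
Proof.
rewrite /slice; elim/freeg_ind: w => [|[x y]|k u w Fu Fw].
- by rewrite fglift0 !coeff0.
- by rewrite fglift1 coeffZ !coeffU !mul1r xpair_eqE -mulnb natrM.
- by rewrite fgliftD !(coeffD, coeffZ) Fu Fw.
Qed.

Lemma slice_tens a u v : slice a (tens u v) = coeff a u *: v.
Proof. by apply/eqP/freeg_eqP => b; rewrite coeff_slice coeff_tens coeffZ. Qed.

Lemma slice_sum a (I : Type) (r : seq I) (P : pred I) f :
  slice a (\sum_(i <- r | P i) f i) = \sum_(i <- r | P i) slice a (f i).
Proof. exact: linear_sum. Qed.

End TensorChains.

Lemma supported_bound (K : choiceType) (deg : K -> nat) (c : {freeg K / rat}) :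
  exists p, supported (fun x => (deg x < p)%N) c.
Proof.
elim/freeg_ind: c => [|x|a u v [p pu] [q qv]]; first by exists 0%N; exact: supported0.
  by exists (deg x).+1; exact: supported1.
exists (maxn p q); apply: supported_lin.
  by apply: sub_supported pu => x; rewrite leq_max => ->.
by apply: sub_supported qv => x; rewrite leq_max orbC => ->.
Qed.

Lemma supported_bound_family (I : finType) (K : choiceType) (deg : K -> nat)
    (x : I -> {freeg K / rat}) :
  exists N, forall i, supported (fun s => (deg s < N)%N) (x i).
Proof.
have /choice[p pP] : forall i, exists p, supported (fun s => (deg s < p)%N) (x i).
  by move=> i; exact: supported_bound.
exists (\max_i p i)%N => i; apply: sub_supported (pP i) => s si.
exact: leq_trans si (leq_bigmax i).
Qed.

Section Homology.
Variable K : symset.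

Notation d := (fglift (@simplex_bd K)).

(** Families of chains whose classes span the homology, are independent in it,
or form a basis of it. *)
Definition hspan (J : finType) (y : J -> {freeg K / rat}) :=
  forall z, d z = 0 -> exists c v, z = \sum_j c j *: y j + d v.

Definition hindep (J : finType) (y : J -> {freeg K / rat}) :=
  forall (c : J -> rat) v, \sum_j c j *: y j = d v -> forall j, c j = 0.

Definition hbasis (J : finType) (y : J -> {freeg K / rat}) :=
  [/\ forall j, d (y j) = 0, hindep y & hspan y].

End Homology.

Section Kunneth.
Variables (K L : symset) (M : symprod K L).

Notation dK := (fglift (@simplex_bd K)).
Notation dL := (fglift (@simplex_bd L)).
Notation dM := (fglift (@simplex_bd M)).
Notation dT := (fglift (@tensor_bd K L)).

Lemma tensor_bd_point a v :
  dT (tens << a >> v) = tens (simplex_bd a) v + (-1) ^+ sdeg a *: tens << a >> (dL v).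
Proof.
elim/freeg_ind: (v) => [|y|k u w Fu Fw].
+ by rewrite fglift0 !tens0r fglift0 scaler0 addr0.
+ rewrite tens11 !fglift1 /tensor_bd /= {2}/tens fglift1; congr (_ + _).
  by rewrite /tens; apply: eq_fglift => b; rewrite fglift1.
+ rewrite fgliftD !tens_linr !fgliftD Fu Fw !scalerDr addrACA.
  by rewrite !scalerA mulrC.
Qed.

Lemma tensor_bd_cycler u v : dL v = 0 -> dT (tens u v) = tens (dK u) v.
Proof.
move=> v0; elim/freeg_ind: u => [|x|k u w Fu Fw].
- by rewrite fglift0 !tens0l fglift0.
- by rewrite tensor_bd_point v0 tens0r scaler0 addr0 fglift1.
- by rewrite tens_linl !fgliftD Fu Fw -tens_linl.
Qed.

(** In the top degree of the first factor, the boundary acts on the second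
factor alone. *)
Lemma slice_tensor_bd p a w : supported (fun s => sdeg s.1 < p.+1)%N w -> sdeg a = p ->
  slice a (dT w) = (-1) ^+ p *: dL (slice a w).
Proof.
move=> wp ap; elim/freeg_supported_ind: wp => [|[x y] xp|k u v Fu Fv].
- by rewrite /slice !fglift0 scaler0.
- rewrite fglift1 -tens11 slice_tens -[tensor_bd _]fglift1 -tens11 tensor_bd_point
  fglift1.
  rewrite [slice _ _]fglift_add -/(slice _ _) fgliftZ -/(slice _ _) !slice_tens.
  have [->|xa] := eqVneq x a.
    rewrite coeffU eqxx mulr1 scale1r ap -[RHS]add0r; congr (_ + _); last first.
      by rewrite scale1r fglift1.
    have [->|/sdeg_simplex_bd] := eqVneq (coeff a (simplex_bd a)) 0;
      first by rewrite scale0r.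
    by rewrite ap; lia.
  rewrite coeffU (negbTE xa) mulr0 !scale0r fglift0 !scaler0 addr0.
  have [->|/sdeg_simplex_bd] := eqVneq (coeff a (simplex_bd x)) 0;
    first by rewrite scale0r.
  by move: xp; rewrite /= ap; lia.
- rewrite fgliftD [slice _ _]fgliftD -!/(slice _ _) Fu Fv.
  by rewrite [slice a (_ *: _ + _)]fgliftD fgliftD scalerDr !scalerA mulrC.
Qed.

Lemma supported_tens (P : pred K) u (v : {freeg L / rat}) : supported P u ->
  supported (fun s : K * L => P s.1) (tens u v).
Proof.
move=> Pu; apply: supported_fglift Pu _ => x Px.
by apply: (supported_fglift (P := predT)) => // z _; exact: supported1.
Qed.

Variables (J : finType) (y : J -> {freeg L / rat}).
Hypothesis y_basis : hbasis y.

Lemma tensor_bd_lift0 w : dT (dT w) = 0.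
Proof. by rewrite fglift_comp -[RHS](fglift_0f _ w); apply: eq_fglift => s;
  exact: tensor_bd_bd. Qed.

(** Subtracting the slices at the finitely many simplices of degree p lowers
the degree in the first factor. *)
Lemma top_part p (w : {freeg (K * L)%type / rat}) : supported (fun s => sdeg s.1 <
  p.+1)%N w ->
  exists2 A : seq K, (forall a, a \in A -> sdeg a = p) &
  supported (fun s => sdeg s.1 < p)%N (w - \sum_(a <- A) tens << a >> (slice a w)).
Proof.
move=> wp; exists [seq a <- undup [seq s.1 | s <- dom w] | sdeg a == p].
  by move=> a; rewrite mem_filter => /andP[/eqP].
set A := [seq _ <- _ | _] => -[a b] /=; rewrite coeffB raddf_sum /=.
have E c : coeff (a, b) (tens << c >> (slice c w)) = (c == a)%:R * coeff (a, b) w.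
  by rewrite coeff_tens coeffU mul1r coeff_slice; case: eqVneq => [->//|_];
    rewrite !mul0r.
under eq_bigr => c _ do rewrite E.
have [aA|aA] := boolP (a \in A).
  rewrite (bigD1_seq a) //=; last exact/filter_uniq/undup_uniq.
  rewrite eqxx mul1r big1 ?addr0 ?subrr ?eqxx //.
  by move=> c /negbTE ->; rewrite mul0r.
rewrite big_seq big1 ?subr0 => [wab|c cA]; last first.
  by case: eqVneq cA aA => [-> -> //|_]; rewrite mul0r.
have /= := wp _ wab; rewrite ltnS leq_eqVlt => /orP[ap|//].
case/negP: aA; rewrite mem_filter ap mem_undup; apply/mapP; exists (a, b) => //.
by rewrite mem_dom.
Qed.

(** The sums of terms c_j (x) y_j form a subcomplex with the same homology as
the tensor product, because y is a basis of the homology of L. The case x = 0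
says that every cycle is homologous to one in the subcomplex; the general case
says that a boundary in the subcomplex bounds inside it. The induction is on
the degree of w in the first factor. The slices of w in top degree p have
boundary in the span of y; by independence of y they are cycles, hence
combinations of y up to boundaries, and these top terms can be removed. *)
Lemma kunneth_lift w (x : J -> {freeg K / rat}) :
  dT w = \sum_j tens (x j) (y j) ->
  exists (c : J -> {freeg K / rat}) v,
    w = \sum_j tens (c j) (y j) + dT v /\ forall j, dK (c j) = x j.
Proof.
have [yc yi ys] := y_basis.
have [p wp] := supported_bound (fun s : K * L => sdeg s.1) w.
elim: p w x wp => [|p IH] w x wp wx.
  have w0 : w = 0.
    by apply/eqP/freeg_eqP => s; rewrite coeff0; apply/eqP/negPn/negP => /wp.
  exists (fun=> 0), 0; rewrite w0 !fglift0 big1 ?addr0; last by move=> j _;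
    exact: tens0l.
  split=> // j; apply/esym/eqP/freeg_eqP => a; rewrite coeff0.
  apply: (yi (fun j => coeff a (x j)) 0); rewrite fglift0.
  rewrite -[RHS](fglift0 (fun s : K * L => (s.1 == a)%:R *: << s.2 >>)) -/(slice a _).
  rewrite -[0 in RHS](fglift0 (@tensor_bd K L)) -[X in dT X]w0 wx slice_sum.
  by apply: eq_bigr => i _; rewrite slice_tens.
have [A Ap wA] := top_part wp.
have sl a : sdeg a = p ->
    exists cv : (J -> rat) * {freeg L / rat},
    slice a w = \sum_j cv.1 j *: y j + dL cv.2.
  move=> ap; suff /ys[c [v E]] : dL (slice a w) = 0 by exists (c, v).
  have E : \sum_j ((-1) ^+ p * coeff a (x j)) *: y j = dL (slice a w).
    rewrite -[RHS](signrZK p) -(slice_tensor_bd wp ap) wx slice_sum scaler_sumr.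
    by apply: eq_bigr => j _; rewrite slice_tens scalerA.
  by rewrite -E big1 // => j _; rewrite (yi _ _ E) scale0r.
have /choice[cv cvP] : forall a, exists cv : (J -> rat) * {freeg L / rat},
    sdeg a = p -> slice a w = \sum_j cv.1 j *: y j + dL cv.2.
  move=> a; have [/sl[cv cvE]|ap] := pselect (sdeg a = p); first by exists cv.
  by exists (fun=> 0, 0).
(* The top part of w: c1 collects the multiples of y, and v1 has the remaining
   boundaries as the top part of its own boundary. *)
pose c1 j := \sum_(a <- A) (cv a).1 j *: << a >> : {freeg K / rat}.
pose v1 := \sum_(a <- A) (-1) ^+ p *: tens << a >> (cv a).2.
have topE : \sum_(a <- A) tens << a >> (slice a w) =
    \sum_j tens (c1 j) (y j) + dT v1 - \sum_(a <- A) (-1) ^+ p *: tens (simplex_bd a)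
      (cv a).2.
  rewrite linear_sum /= -addrA -sumrB.
  under [in RHS]eq_bigr => j _ do rewrite tens_suml.
  rewrite exchange_big -big_split /=; apply: eq_big_seq => a /Ap ap.
  rewrite fgliftZ tensor_bd_point ap (cvP _ ap) tensDr tens_sumr scalerDr signrZK
    addrAC subrr add0r.
  by congr (_ + _); apply: eq_bigr => j _; rewrite tensZr tensZl.
pose w' := w - (\sum_j tens (c1 j) (y j) + dT v1).
have w'p : supported (fun s => sdeg s.1 < p)%N w'.
  have -> : w' = (w - \sum_(a <- A) tens << a >> (slice a w))
     - \sum_(a <- A) (-1) ^+ p *: tens (simplex_bd a) (cv a).2.
    by rewrite topE /w' opprB addrA addrAC addrK.
  apply: supportedB => //; rewrite big_seq; apply: supported_sum => a /Ap ap;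
    apply: supportedZ.
  apply: (@supported_tens (fun b => (sdeg b < p)%N)).
  by apply: sub_supported (@sdeg_simplex_bd _ a) => b; rewrite ap => /eqP ->.
have dw' : dT w' = \sum_j tens (x j - dK (c1 j)) (y j).
  rewrite /w' fgliftB wx fglift_add tensor_bd_lift0 addr0 linear_sum -sumrB;
    apply: eq_bigr => j _ /=.
  by rewrite tensor_bd_cycler // tensBl.
have [c [v [w'E cE]]] := IH _ _ w'p dw'.
exists (fun j => c j + c1 j), (v + v1); split.
  rewrite -[w](subrK (\sum_j tens (c1 j) (y j) + dT v1)) -/w' w'E.
  rewrite fglift_add addrACA -big_split; congr (_ + _).
  by apply: eq_bigr => j _; rewrite tensDl.
by move=> j; rewrite fglift_add cE subrK.
Qed.

Definition cross (u : {freeg K / rat}) (v : {freeg L / rat}) : {freeg M / rat} :=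
  fglift (eilenberg_zilber M) (tens u v).

Lemma bd_cross u v : dL v = 0 -> dM (cross u v) = cross (dK u) v.
Proof. by move=> v0; rewrite /cross eilenberg_zilber_bd tensor_bd_cycler. Qed.

Lemma cross_suml (I : Type) (r : seq I) (P : pred I) f v :
  cross (\sum_(i <- r | P i) f i) v = \sum_(i <- r | P i) cross (f i) v.
Proof. by rewrite /cross tens_suml linear_sum. Qed.

Lemma cross_sumr (I : Type) (r : seq I) (P : pred I) f u :
  cross u (\sum_(i <- r | P i) f i) = \sum_(i <- r | P i) cross u (f i).
Proof. by rewrite /cross tens_sumr linear_sum. Qed.

Lemma crossZl a u v : cross (a *: u) v = a *: cross u v.
Proof. by rewrite /cross tensZl fgliftZ. Qed.

Lemma crossZr a u v : cross u (a *: v) = a *: cross u v.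
Proof. by rewrite /cross tensZr fgliftZ. Qed.

Lemma crossDr u v v' : cross u (v + v') = cross u v + cross u v'.
Proof. by rewrite /cross tensDr fglift_add. Qed.

(* a cycle times a boundary is a boundary *)
(** Up to the sign given by the degree of the cycle u, the Leibniz rule says that
u x dv is the boundary of u x v. *)
Lemma cross_bdr u v : dK u = 0 -> exists b, cross u (dL v) = dM b.
Proof.
move=> u0; rewrite /cross.
pose sg := fglift (fun a => (-1) ^+ sdeg a *: << a >>) : {freeg K / rat} -> {freeg K
  / rat}.
have E u' : dT (tens (sg u') v) = - tens (sg (dK u')) v + tens u' (dL v).
  have sgd a : sg (simplex_bd a) = - ((-1) ^+ sdeg a *: simplex_bd a).
    rewrite /sg (eq_fglift_supported (g := fun b => - ((-1) ^+ sdeg a *: << b >>))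
      (@sdeg_simplex_bd _ a)).
      by rewrite fglift_oppf fglift_scalef fglift_id.
    by move=> b /eqP ->; rewrite exprS mulN1r scaleNr opprK.
  elim/freeg_ind: u' => [|a|k b c Fb Fc].
  - by rewrite /sg !fglift0 !tens0l fglift0 oppr0 addr0.
  - rewrite [dK _]fglift1 sgd /sg fglift1 tensZl fgliftZ tensor_bd_point scalerDr
    signrZK.
    by congr (_ + _); rewrite -!tensZl -scaleN1r -tensZl scaleN1r opprK.
  - rewrite [dK _]fgliftD /sg !fgliftD -!/(sg _) !tens_linl fgliftD Fb Fc.
    by rewrite scalerDr scalerN addrACA -opprD.
exists (fglift (eilenberg_zilber M) (tens (sg u) v)).
by rewrite eilenberg_zilber_bd E u0 /sg fglift0 tens0l oppr0 add0r.
Qed.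

Variables (I : finType) (x : I -> {freeg K / rat}).
Hypothesis x_basis : hbasis x.

(** Cross products span, since a cycle of M is homologous to the image of its
image in the tensor product, to which [kunneth_lift] applies. They are
independent, since a relation maps to a relation in the tensor product. *)
Lemma kunneth : hbasis (fun ij : I * J => cross (x ij.1) (y ij.2)).
Proof.
have [xc xi xs] := x_basis; have [yc yi ys] := y_basis.
have swap e : \sum_(ij : I * J) e ij *: cross (x ij.1) (y ij.2) =
    fglift (eilenberg_zilber M) (\sum_j tens (\sum_i e (i, j) *: x i) (y j)).
  rewrite linear_sum big_pair exchange_big /=; apply: eq_bigr => j _.
  by rewrite -[RHS]/(cross _ _) cross_suml; apply: eq_bigr => i _; rewrite crossZl.
split=> [[i j]|e v E [i j]|z zc] /=.
- by rewrite bd_cross // xc /cross tens0l fglift0.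
- pose T := \sum_j tens (\sum_i e (i, j) *: x i) (y j).
  have dT0 : dT T = 0.
    rewrite linear_sum big1 // => k _ /=; rewrite tensor_bd_cycler //.
    rewrite linear_sum big1 ?tens0l // => l _ /=.
    by rewrite fgliftZ xc scaler0.
  have TE : dT (fglift (alexander_whitney M) v + fglift (@realize_tens_htpy K L) T) = T.
    rewrite fglift_add alexander_whitney_bd -E swap (@realize_tens_htpy_bd K L M) -/T
      dT0 fglift0 subr0.
    by rewrite addrC subrK.
  have [c [_ [_ cE]]] := kunneth_lift TE.
  exact: (xi (fun i => e (i, j)) (c j) (esym (cE j)) i).
- have : dT (fglift (alexander_whitney M) z) = \sum_j tens 0 (y j).
    by rewrite alexander_whitney_bd zc fglift0 big1 // => j _; rewrite tens0l.
  move=> /kunneth_lift[c [v [azE cE]]].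
  have /choice[eu euE] : forall j, exists eu : (I -> rat) * {freeg K / rat},
      c j = \sum_i eu.1 i *: x i + dK eu.2.
    by move=> j; have [e [u ->]] := xs _ (cE j); exists (e, u).
  exists (fun ij => (eu ij.2).1 ij.1).
  exists (\sum_j cross (eu j).2 (y j) + fglift (eilenberg_zilber M) v + fglift
    (realize_simp_htpy M) z).
  rewrite (swap (fun ij => (eu ij.2).1 ij.1)) /=.
  have zE : z = fglift (eilenberg_zilber M) (fglift (alexander_whitney M) z) + dM
    (fglift (realize_simp_htpy M) z).
    by rewrite realize_simp_htpy_bd zc fglift0 subr0 addrC subrK.
  rewrite {1}zE azE !fglift_add !addrA eilenberg_zilber_bd; congr (_ + _ + _).
  rewrite !linear_sum -big_split; apply: eq_bigr => j _ /=.
  by rewrite euE tensDl fglift_add bd_cross.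
Qed.

(** Expand alpha in the basis y and use that some coefficient is nonzero. *)
Lemma cross_indep (alpha : {freeg L / rat}) : dL alpha = 0 ->
  (forall v, alpha <> dL v) -> hindep (fun i => cross (x i) alpha).
Proof.
have [xc xi xs] := x_basis; have [yc yi ys] := y_basis.
have [_ ki _] := kunneth.
move=> /ys[a [v ->]] alpha_nb b w E.
have [j aj] : exists j, a j != 0.
  apply: contrapT => /forallNP a0; apply: (alpha_nb v).
  rewrite big1 ?add0r // => j _; have /negP/negPn/eqP -> := a0 j.
  by rewrite scale0r.
have /choice[t tE] : forall i, exists t, cross (x i) (dL v) = dM t.
  by move=> i; apply: cross_bdr.
move=> i; have : b i * a j = 0.
  apply: (ki (fun ij => b ij.1 * a ij.2) (w - \sum_i b i *: t i) _ (i, j)).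
  rewrite fgliftB -E linear_sum -sumrB big_pair; apply: eq_bigr => k _ /=.
  rewrite fgliftZ -tE -scalerBr crossDr addrK cross_sumr scaler_sumr.
  by apply: eq_bigr => l _; rewrite crossZr scalerA.
by move/eqP; rewrite mulf_eq0 (negbTE aj) orbF => /eqP.
Qed.

End Kunneth.

Local Open Scope classical_set_scope.

(** * Singular simplices as a symmetric set *)
Lemma inordE m i : @inord m i = (if (i <= m)%N then i else 0%N) :> nat.
Proof.
case: leqP => im; first exact: inordK.
by rewrite /inord /insubd insubN // -ltnNge.
Qed.

Section Affine.
Variable R : realType.

Notation simplex n := (set_type (@std_simplex R n)).

(** The affine map of standard simplices with prescribed values on vertices. *)
Definition vertex_map_fun m n (f : nat -> nat) (t : simplex m) : {ptws 'I_n.+1 -> R} :=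
  fun k => \sum_(j < m.+1 | inord (f j) == k) set_val t j.

Arguments vertex_map_fun {m} n f t : rename.

Lemma vertex_map_simplex m n f (t : simplex m) :
  vertex_map_fun n f t \in (@std_simplex R n : set _).
Proof.
have [t0 t1] := set_valP t; apply/mem_set; split=> [k|].
  by apply: sumr_ge0 => j _; exact: t0.
rewrite -[RHS]t1 /vertex_map_fun (partition_big (fun j : 'I_m.+1 => inord (f j) :
  'I_n.+1) predT) //=.
Qed.

Definition vertex_map m n f (t : simplex m) : simplex n :=
  exist _ (vertex_map_fun n f t) (vertex_map_simplex n f t).

Lemma set_val_vertex_map m n f (t : simplex m) k :
  set_val (vertex_map n f t) k = \sum_(j < m.+1 | inord (f j) == k) set_val t j.
Proof. by rewrite [in LHS]set_valE. Qed.

Lemma vertex_map_continuous m n f : continuous (@vertex_map m n f).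
Proof.
apply: continuous_set_type; apply: continuous_ptws => k.
rewrite (_ : (fun t => _) = fun t => vertex_map_fun n f t k); last first.
  by apply/funext => t; rewrite /= set_valE.
apply: continuous_big => [|j _].
  exact: add_continuous.
exact: (continuous_compT (@continuous_set_val _ _) (@continuous_coord _ R j)).
Qed.

HB.instance Definition _ m n f :=
  isContinuous.Build _ _ (@vertex_map m n f) (@vertex_map_continuous m n f).

Lemma std_simplex_eq n (t u : simplex n) : set_val t =1 set_val u -> t = u.
Proof. by move=> tu; apply: val_inj; rewrite -!set_valE; exact/funext. Qed.

Lemma vertex_map_id n (t : simplex n) : vertex_map n id t = t.
Proof.
apply: std_simplex_eq => k; rewrite set_val_vertex_map.
rewrite (bigD1 k) ?inord_val //= big1 ?addr0 // => j /andP[/eqP].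
by rewrite inord_val => ->; rewrite eqxx.
Qed.

Lemma vertex_map_ext m n f g (t : simplex m) :
  (forall j, (j <= m)%N -> f j = g j) -> vertex_map n f t = vertex_map n g t.
Proof.
move=> fg; apply: std_simplex_eq => k; rewrite !set_val_vertex_map.
by apply: eq_bigl => j; rewrite fg // -ltnS.
Qed.

Lemma vertex_map_comp k m n f g (t : simplex k) :
  vertex_map n f (vertex_map m g t) = vertex_map n (fun j => f (if (g j <= m)%N then
    g j else 0%N)) t.
Proof.
apply: std_simplex_eq => i; rewrite !set_val_vertex_map.
rewrite [RHS](partition_big (fun j : 'I_k.+1 => inord (g j) : 'I_m.+1)
   (fun l => inord (f l) == i :> 'I_n.+1)) /=.
  apply: eq_bigr => l fl; rewrite set_val_vertex_map; apply: eq_bigl => j.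
  have [jl|] := eqVneq (inord (g j)) l; last by rewrite andbF.
  by rewrite andbT -(eqP fl) -jl inordE eqxx.
by move=> j; rewrite inordE.
Qed.

Variable X : topologicalType.

Definition total_sing : choiceType := {n : nat & sing R X n}.

Definition sing_act (s : total_sing) m f : total_sing :=
  Tagged (fun n => sing R X n) (tagged s \o vertex_map (tag s) f : sing R X m).

Lemma sing_act_id s : sing_act s (tag s) id = s.
Proof.
case: s => n s; rewrite /sing_act /=; congr Tagged; apply/continuousEP => t /=.
by rewrite vertex_map_id.
Qed.

Lemma sing_act_ext s m f g : (forall j, (j <= m)%N -> f j = g j) -> sing_act s m f =
  sing_act s m g.
Proof.
move=> fg; case: s => n s; congr Tagged; apply/continuousEP => t /=.
by congr (s _); exact: vertex_map_ext.
Qed.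

Lemma sing_act_act s m f k g : sing_act (sing_act s m f) k g =
    sing_act s k (fun j => f (if (g j <= m)%N then g j else 0%N)).
Proof.
case: s => n s; congr Tagged; apply/continuousEP => t /=.
by rewrite vertex_map_comp.
Qed.

Definition singset : symset := @SymSet total_sing (fun s => tag s) sing_act
  (fun _ _ _ => erefl) sing_act_ext sing_act_act sing_act_id.

End Affine.

(** * Dimension *)
Lemma linear_relation (I J : finType) (a : I -> J -> rat) : (#|J| < #|I|)%N ->
  exists c : I -> rat, (exists i, c i != 0) /\ forall j, \sum_i c i * a i j = 0.
Proof.
move=> JI; pose A := \matrix_(i < #|I|, j < #|J|) a (enum_val i) (enum_val j).
have : kermx A != 0.
  rewrite -mxrank_eq0 mxrank_ker subn_eq0 -ltnNge.
  exact: leq_ltn_trans (rank_leq_col A) JI.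
case/rowV0Pn => u /sub_kermxP uA u0.
exists (fun i => u 0 (enum_rank i)); split.
  have /rV0Pn[k uk] := u0; exists (enum_val k); by rewrite enum_valK.
move=> j; have /matrixP/(_ 0 (enum_rank j)) := uA; rewrite !mxE => uAj.
rewrite -[RHS]uAj (reindex (@enum_val I predT)) /=; last exact/onW_bij/enum_val_bij.
by apply: eq_bigr => i _; rewrite mxE enum_rankK enum_valK.
Qed.

Section DimensionTheory.
Variable V : lmodType rat.

Lemma fin_dimP (S : set V) : fin_dim S -> has_dim S (Defs.dim S).
Proof. by move=> /(xgetPex 0%N). Qed.

Lemma is_basis_mem (S : set V) n (b : 'I_n -> V) : is_basis S b -> forall i, S (b i).
Proof.
move=> [_ ->] i; exists (fun j => (j == i)%:R) => //.
rewrite (bigD1 i) //= eqxx scale1r big1 ?addr0 // => j /negbTE ->.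
exact: scale0r.
Qed.

Lemma is_basis_span (S : set V) n (b : 'I_n -> V) v : is_basis S b -> S v ->
  exists c : 'I_n -> rat, v = \sum_i c i *: b i.
Proof. by move=> [_ ->] [c _ <-]; exists c. Qed.

(** A maximal independent family is a basis, and a bound on the length of
independent families provides a maximal one. *)
Lemma fin_dim_bound (S : set V) N : S 0 ->
  (forall a u v, S u -> S v -> S (a *: u + v)) ->
  (forall k (b : 'I_k -> V), lin_indep b -> (forall i, S (b i)) -> (k <= N)%N) ->
  fin_dim S /\ (Defs.dim S <= N)%N.
Proof.
move=> S0 SD bound.
suff fS : fin_dim S.
  split => //; have [b bb] := fin_dimP fS.
  by apply: bound (is_basis_mem bb); case: bb.
pose P k := `[< exists b : 'I_k -> V, lin_indep b /\ forall i, S (b i) >].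
have P0 : exists k, P k.
  by exists 0%N; apply/asboolP; exists (fun=> 0); split => [c _ []|[]].
have PN k : P k -> (k <= N)%N by move=> /asboolP[b [bi /bound]]; exact.
have [k /asboolP[b [bi bS]] kmax] := ex_maxnP P0 PN.
exists k, b; split => //; apply/seteqP; split => [v Sv|_ [c _ <-]]; last first.
  elim/big_ind : _ => //= [u v Su Sv|i _]; last by rewrite -[_ *: _]addr0; exact: SD.
  by rewrite -[u]scale1r; exact: SD.
apply: contrapT => nv.
suff /asboolP/kmax : exists b' : 'I_k.+1 -> V, lin_indep b' /\ forall i, S (b' i).
  by rewrite ltnn.
exists (fun i => if unlift ord0 i is Some j then b j else v); split; last first.
  by move=> i; case: unlift.
move=> c; rewrite big_ord_recl unlift_none; under eq_bigr => i _ do rewrite liftK.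
move=> E; have c0 : c ord0 = 0.
  apply/eqP/negPn/negP => c0; apply: nv.
  exists (fun i => - (c ord0)^-1 * c (fintype.lift ord0 i)) => //.
  under eq_bigr => i _ do rewrite -scalerA.
  rewrite -scaler_sumr; move/eqP: E; rewrite addr_eq0 => /eqP E.
  by rewrite scaleNr -scalerN -E scalerA mulVf // scale1r.
move: E; rewrite c0 scale0r add0r => /bi ci i.
by case: (unliftP ord0 i) => [j ->|->].
Qed.

End DimensionTheory.

(** * The total singular complex *)
Section ExplicitFaces.
Variable V : choiceType.

Definition word_face i (w : word V) : word V :=
  if i is j.+1 then (w.1, take j w.2 ++ drop j.+1 w.2)
  else if w.2 is y :: t then (y, t) else w.

Lemma word_bd_faces (w : word V) : (0 < size w.2)%N ->
  word_bd w = \sum_(i < (size w.2).+1) (-1) ^+ i *: << word_face i w >>.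
Proof.
case: w => x s; elim: s x => [//|y t IH] x _.
rewrite -[(x, _)]/(word_cons x (y, t)) word_bd_cons big_ord_recl expr0 scale1r -addrA.
congr (_ + _); have [->|t0] := eqVneq t [::].
  by rewrite word_bd_nil fglift0 oppr0 add0r big_ord1 /word_aug eqxx scale1r expr1
    scaleN1r.
rewrite /word_aug (negbTE t0) scale0r subr0 IH ?lt0n ?size_eq0 //.
rewrite linear_sum -sumrN; apply: eq_bigr => i _ /=.
rewrite fgliftZ fglift1 exprS mulN1r scaleNr; congr (- (_ *: << _ >>)).
case: i => -[|i] ilt //=; case: t t0 {IH} ilt => // z t _ ilt.
Qed.

Lemma word_face_cons i (w : word V) : (i <= size w.2)%N -> (0 < size w.2)%N ->
  (word_face i w).1 :: (word_face i w).2 = take i (w.1 :: w.2) ++ drop i.+1 (w.1 ::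
    w.2).
Proof. by case: w i => x [|y t] [|i]. Qed.

Lemma size_word_face i (w : word V) : (i <= size w.2)%N -> (0 < size w.2)%N ->
  size (word_face i w).2 = (size w.2).-1.
Proof.
move=> iw w0; have := congr1 size (word_face_cons iw w0).
by rewrite size_cat size_take size_drop /= ltnS iw; lia.
Qed.

End ExplicitFaces.

Lemma word_vertex_face_std n i j : (i <= n.+1)%N -> (j <= n)%N ->
  word_vertex (word_face i (std_word n.+1)) j = bump i j.
Proof.
move=> iN jn; rewrite /word_vertex word_face_cons ?size_iota // -[_ :: _]/(iota 0 n.+2).
rewrite nth_cat size_take size_iota ltnS iN /bump.
have [ij|ij] := leqP i j; last by rewrite nth_take // nth_iota //; lia.
by rewrite nth_drop nth_iota; lia.
Qed.

Lemma singset_ind (R : realType) (X : topologicalType) (P : singset R X -> Prop) :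
  (forall n (s : sing R X n), P (Tagged (fun n => sing R X n) s)) -> forall u, P u.
Proof. by move=> h [n s]; exact: h. Qed.

Section TotalComplex.
Variables (R : realType) (X : topologicalType).

Notation S := (singset R X).
Notation d := (fglift (@simplex_bd S)).

Definition total_of n : chain R X n -> {freeg S / rat} :=
  fglift (fun s => << (Tagged (fun n => sing R X n) s : S) >>).
HB.instance Definition _ n := GRing.Linear.on (@total_of n).

Lemma face_vertex_map n (i : 'I_n.+2) t : vertex_map n.+1 (bump i) t = @face R n i t.
Proof.
have fE k : set_val (@face R n i t) k = face_fun i t k by rewrite [in LHS]set_valE.
apply: std_simplex_eq => k; rewrite set_val_vertex_map fE /face_fun.
case: unliftP => [j ->|->].
  rewrite (bigD1 j) /=; last by apply/eqP/val_inj; rewrite /= inordK //;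
    exact: ltn_ord (fintype.lift i j).
  rewrite big1 ?addr0 // => l /andP[/eqP il lj].
  case/negP: lj; apply/eqP/(@lift_inj _ i); rewrite -il; apply/val_inj.
  by rewrite /= inordK //; exact: ltn_ord (fintype.lift i l).
rewrite big1 // => l /eqP il.
have : fintype.lift i l = i.
  by rewrite -[RHS]il; apply/val_inj; rewrite /= inordK //;
    exact: ltn_ord (fintype.lift i l).
by move/eqP; rewrite eq_sym (negbTE (neq_lift _ _)).
Qed.

Lemma word_act_face n (s : sing R X n.+1) (i : 'I_n.+2) :
  @word_act S (Tagged (fun n => sing R X n) s) (word_face i (std_word n.+1)) =
  Tagged (fun n => sing R X n) (sing_face s i).
Proof.
have iN : (i <= n.+1)%N by rewrite -ltnS.
rewrite /word_act size_word_face ?size_iota //.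
rewrite (@sact_ext S _ _ _ (bump i)); last first.
  by move=> j jn; rewrite word_vertex_face_std.
congr Tagged; apply/continuousEP => t /=.
by rewrite face_vertex_map.
Qed.

Lemma simplex_bd_sing0 (s : sing R X 0) : @simplex_bd S (Tagged (fun n => sing R X n)
  s) = 0.
Proof. by rewrite /simplex_bd /= fglift0. Qed.

Lemma simplex_bd_singS n (s : sing R X n.+1) :
  @simplex_bd S (Tagged (fun n => sing R X n) s) = total_of (boundary << s >>).
Proof.
rewrite /= fglift1 linear_sum /= /simplex_bd word_bd_faces ?size_iota //= linear_sum.
apply: eq_bigr => i _ /=; rewrite fgliftZ fglift1 linearZ /= /total_of fglift1.
congr (_ *: << _ >>); exact: word_act_face.
Qed.

Lemma total_of_boundary n (c : chain R X n.+1) : d (total_of c) = total_of (boundary c).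
Proof.
rewrite /total_of fglift_comp; elim/freeg_ind: c => [|s|a u v Fu Fv].
- by rewrite fglift0 linear0 fglift0.
- by rewrite fglift1 fglift1 simplex_bd_singS.
- by rewrite fgliftD Fu Fv linearP fgliftD.
Qed.

Lemma d_total_of0 (c : chain R X 0) : d (total_of c) = 0.
Proof.
rewrite /total_of fglift_comp -[RHS](fglift_0f _ c); apply: eq_fglift => s.
by rewrite fglift1 simplex_bd_sing0.
Qed.

Definition component_simplex n (u : S) : chain R X n :=
  if tag u =P n is ReflectT e then << ecast k (sing R X k) e (tagged u) >> else 0.

Definition component n : {freeg S / rat} -> chain R X n := fglift (component_simplex n).
HB.instance Definition _ n := GRing.Linear.on (@component n).

Lemma componentD n a u v : component n (a *: u + v) = a *: component n u + component
  n v.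
Proof. exact: fgliftD. Qed.

Lemma total_ofD n a u v : total_of (a *: u + v : chain R X n) = a *: total_of u +
  total_of v.
Proof. exact: fgliftD. Qed.

Lemma component_add n u v : component n (u + v) = component n u + component n v.
Proof. exact: fglift_add. Qed.

Lemma componentZ n a u : component n (a *: u) = a *: component n u.
Proof. exact: fgliftZ. Qed.

Lemma component_sum n (I : Type) (r : seq I) (P : pred I) g :
  component n (\sum_(i <- r | P i) g i) = \sum_(i <- r | P i) component n (g i).
Proof. exact: linear_sum. Qed.

Lemma total_of_add n (u v : chain R X n) : total_of (u + v) = total_of u + total_of v.
Proof. exact: fglift_add. Qed.

Lemma total_ofZ n a (u : chain R X n) : total_of (a *: u) = a *: total_of u.
Proof. exact: fgliftZ. Qed.

Lemma total_of_sum n (I : Type) (r : seq I) (P : pred I) (g : I -> chain R X n) :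
  total_of (\sum_(i <- r | P i) g i) = \sum_(i <- r | P i) total_of (g i).
Proof. exact: linear_sum. Qed.

Lemma component_simplex_eq n (s : sing R X n) : component_simplex n (Tagged (fun n =>
  sing R X n) s) = << s >>.
Proof. by rewrite /component_simplex; case: eqP => //= e; rewrite eq_axiomK. Qed.

Lemma component_simplex_neq n (u : S) : tag u != n -> component_simplex n u = 0.
Proof. by rewrite /component_simplex; case: eqP => // ->; rewrite eqxx. Qed.

Lemma component_total_of n (c : chain R X n) : component n (total_of c) = c.
Proof.
rewrite /component /total_of fglift_comp -[RHS]fglift_id; apply: eq_fglift => s.
by rewrite fglift1 component_simplex_eq.
Qed.

Lemma component_total_of_neq m n (c : chain R X m) : m != n -> component n (total_of
  c) = 0.
Proof.
move=> mn; rewrite /component /total_of fglift_comp -[RHS](fglift_0f _ c).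
by apply: eq_fglift => s; rewrite fglift1 component_simplex_neq.
Qed.

Lemma component_d n c : component n (d c) = boundary (component n.+1 c).
Proof.
elim/freeg_ind: c => [|u|a u v Fu Fv].
- by rewrite fglift0 !linear0.
- rewrite fglift1 [X in boundary X]fglift1; elim/singset_ind: u => -[|m] s.
    by rewrite simplex_bd_sing0 component_simplex_neq // !linear0.
  rewrite simplex_bd_singS.
  have [mn|mn] := eqVneq m n;
    last by rewrite component_simplex_neq // component_total_of_neq // linear0.
  by case: n / mn; rewrite component_simplex_eq component_total_of.
- by rewrite fgliftD !componentD Fu Fv [RHS]linearP.
Qed.

Lemma component_supported P n c : supported P c -> (forall s, P s -> tag s != n) ->
  component n c = 0.
Proof.
move=> Pc Pn; rewrite /component (eq_fglift_supported Pc (g := fun=> 0)) ?fglift_0f //.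
by move=> s /Pn; exact: component_simplex_neq.
Qed.

Lemma sum_total_of_component N c : supported (fun s : S => tag s < N)%N c ->
  c = \sum_(n < N) total_of (component n c).
Proof.
elim/freeg_supported_ind => [|u|a u v Fu Fv]; last first.
- rewrite {1}Fu {1}Fv scaler_sumr -big_split; apply: eq_bigr => n _ /=.
  by rewrite componentD total_ofD.
- elim/singset_ind: u => m s /= mN.
  rewrite (bigD1 (Ordinal mN)) //= big1 ?addr0.
    by rewrite {1}/component fglift1 component_simplex_eq /total_of fglift1.
  move=> n nm; rewrite {1}/component fglift1 component_simplex_neq ?linear0 //=.
  by rewrite eq_sym; apply: contraNneq nm => nm; apply/eqP/val_inj.
- by rewrite big1 // => n _; rewrite !linear0.
Qed.

End TotalComplex.

Section SingularMap.
Variables (R : realType) (X Y : topologicalType) (f : continuousType X Y).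

Definition singmap (s : singset R X) : singset R Y :=
  Tagged (fun n => sing R Y n) (f \o tagged s : sing R Y (tag s)).

Lemma singmap_symmap : symmap singmap.
Proof.
split=> // -[n s] m g; congr Tagged; exact/continuousEP.
Qed.

Lemma total_of_chain_map n (c : chain R X n) :
  total_of (chain_map f c) = freemap singmap (total_of c).
Proof.
by rewrite /total_of /chain_map !fglift_comp; apply: eq_fglift => s; rewrite !fglift1.
Qed.

Lemma component_chain_map n c :
  component n (freemap singmap c) = chain_map f (component n c).
Proof.
rewrite /chain_map /component !fglift_comp; apply: eq_fglift; elim/singset_ind => m s.
rewrite fglift1 /singmap /=.
have [mn|mn] := eqVneq m n; last by rewrite !component_simplex_neq // fglift0.
by case: n / mn; rewrite !component_simplex_eq fglift1.
Qed.

End SingularMap.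

Local Open Scope quotient_scope.

Section HomologyClass.
Variables (R : realType) (X : topologicalType) (n : nat).
Notation Hn := (homology R X n).

Definition hclass (z : Defs.cycle R X n) : Hn := \pi_(lquot (@Defs.is_boundary R X
  n)) z.

Lemma hclass_linear : linear hclass.
Proof. by move=> a u v; rewrite /hclass pi_lquotD pi_lquotZ. Qed.

HB.instance Definition _ := GRing.isLinear.Build rat (Defs.cycle R X n) Hn _ hclass
  hclass_linear.

Lemma hclass_eq0 z : hclass z = 0 <-> exists c : chain R X n.+1, boundary c = val z.
Proof.
rewrite -[0](linear0 hclass) /hclass; split => [/eqP|zB].
  by rewrite eq_lquot subr0 inE.
by apply/eqP; rewrite eq_lquot subr0 inE.
Qed.

Definition rep (h : Hn) : Defs.cycle R X n := repr h.

Lemma hclass_rep h : hclass (rep h) = h.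
Proof. exact: reprK. Qed.

Lemma rep_cycle h : boundary (val (rep h)) = 0.
Proof. by have := valP (rep h); rewrite inE => /eqP. Qed.

(** Relations between homology classes are boundaries of the corresponding
combinations of representatives. *)
Lemma sum_rep_eq0 (I : finType) (a : I -> rat) (h : I -> Hn) :
  \sum_i a i *: h i = 0 <->
  exists c : chain R X n.+1, boundary c = \sum_i a i *: val (rep (h i)).
Proof.
have -> : \sum_i a i *: h i = hclass (\sum_i a i *: rep (h i)).
  by rewrite linear_sum; apply: eq_bigr => i _; rewrite linearZ /= hclass_rep.
rewrite hclass_eq0.
have -> // : val (\sum_i a i *: rep (h i)) = \sum_i a i *: val (rep (h i)).
by rewrite linear_sum; apply: eq_bigr => i _; rewrite linearZ.
Qed.

Lemma rep_sum (I : finType) (a : I -> rat) (h : I -> Hn) (g : Hn) :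
  g = \sum_i a i *: h i ->
  exists c : chain R X n.+1, val (rep g) = \sum_i a i *: val (rep (h i)) + boundary c.
Proof.
move=> gE; have : hclass (rep g - \sum_i a i *: rep (h i)) = 0.
  rewrite linearB /= hclass_rep {1}gE linear_sum /= -sumrB big1 // => i _.
  have -> : hclass (a i *: rep (h i)) = a i *: h i by rewrite linearZ /= hclass_rep.
  exact: subrr.
move=> /hclass_eq0[c cE]; exists c; rewrite cE linearB linear_sum /= addrC.
rewrite [X in _ - X + _](_ : _ = \sum_i a i *: val (rep (h i))) ?subrK //.
Qed.

Lemma cycle_class (c : chain R X n) : boundary c = 0 ->
  exists h : Hn, exists e : chain R X n.+1, val (rep h) = c + boundary e.
Proof.
move=> c0; have cc : c \in @Defs.is_cycle R X n by rewrite inE c0.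
pose z : Defs.cycle R X n := exist _ c cc.
exists (hclass z).
have : hclass (rep (hclass z) - z) = 0 by rewrite linearB /= hclass_rep subrr.
by move=> /hclass_eq0[e eE]; exists e; rewrite eE linearB /= addrC subrK.
Qed.

End HomologyClass.

Lemma homology_kerP (R : realType) (X Y : topologicalType) (f : continuousType X Y) n
    (h : homology R X n) : homology_map R f n h = 0 <->
  exists c : chain R Y n.+1, boundary c = chain_map f (val (rep h)).
Proof.
have -> : homology_map R f n h = hclass (Defs.cycle_map f (rep h)) by [].
exact: hclass_eq0.
Qed.

(** * Graded dimensions and total homology *)
Lemma big_sig (V : lmodType rat) (I : finType) (J : I -> finType)
    (f : {i : I & J i} -> V) : \sum_p f p = \sum_i \sum_(j : J i) f (Tagged J j).
Proof.
rewrite (sig_big_dep (fun=> true) (fun _ _ => true) (fun i j => f (Tagged J j))) /=.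
by apply: eq_bigr => -[].
Qed.

Lemma finite_nat_bound (A : set nat) : finite_set A ->
  exists N, forall i, A i -> (i < N)%N.
Proof.
move=> /finite_seqP[s ->]; exists (\max_(i <- s) i).+1 => i /= si.
by rewrite ltnS; exact: (@leq_bigmax_seq _ s xpredT id).
Qed.

Section SpaceBasis.
Variables (R : realType) (X : topologicalType).

Notation S := (singset R X).
Notation d := (fglift (@simplex_bd S)).
Notation D n := (Defs.dim [set: homology R X n]).

Lemma d_total_of_rep n (h : homology R X n) : d (total_of (val (rep h))) = 0.
Proof.
case: n h => [|n] h; first exact: d_total_of0.
by rewrite total_of_boundary rep_cycle /total_of fglift0.
Qed.

(** Bases in the finitely many nonzero degrees combine into a basis of the
total homology. *)
Lemma space_basis : finite_homology_rank R X ->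
  exists N, exists y : {i : 'I_N & 'I_(D i)} -> {freeg S / rat},
    hbasis y /\ forall i, (N <= i)%N -> D i = 0%N.
Proof.
move=> [fin_i /finite_nat_bound[N hN]].
have N0 i : (N <= i)%N -> D i = 0%N.
  by move=> Ni; apply/eqP/negPn/negP => /hN; rewrite ltnNge Ni.
pose b i := projT1 (cid (fin_dimP (fin_i i))).
have bP i : is_basis [set: homology R X i] (b i) by exact: projT2.
pose r i l := val (rep (b i l)).
pose y (p : {i : 'I_N & 'I_(D i)}) : {freeg S / rat} := total_of (r _ (tagged p)).
exists N, y; split => //; split.
- by move=> p; exact: d_total_of_rep.
- move=> c v E [i l]; have [bi _] := bP i.
  apply: (bi (fun l => c (Tagged _ l))); apply/sum_rep_eq0; exists (component i.+1 v).
  rewrite -component_d -E big_sig component_sum (bigD1 i) //= component_sum [X in _ +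
    X]big1 ?addr0.
    by apply: eq_bigr => k _; rewrite componentZ component_total_of.
  move=> j ji; rewrite component_sum big1 // => k _.
  by rewrite componentZ component_total_of_neq ?scaler0 // val_eqE.
- move=> z zc.
  have H n : exists ce : ('I_(D n) -> rat) * chain R X n.+1,
      component n z = \sum_l ce.1 l *: r n l + boundary ce.2.
    have pc : boundary (component n z) = 0.
      by case: n => [|n] //; rewrite -component_d zc linear0.
    have [h [e hE]] := cycle_class pc.
    have [c /rep_sum[e' E]] := is_basis_span (bP n) (I : [set: homology R X n] h).
    exists (c, e' - e); rewrite [boundary _](linearB (@boundary R X n.+1)) /= addrA
      -E hE.
    by rewrite addrK.
  pose ce n := projT1 (cid (H n)).
  have ceP n : component n z = \sum_l (ce n).1 l *: r n l + boundary (ce n).2.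
    exact: (projT2 (cid (H n))).
  have [p zp] := supported_bound (fun s : S => tag s) z.
  (* The degrees N, ..., N + p - 1 contribute boundaries only. *)
  exists (fun q : {i : 'I_N & 'I_(D i)} => (ce (tag q)).1 (tagged q)).
  exists (\sum_(n < N + p) total_of (ce n).2).
  rewrite {1}(sum_total_of_component (N := N + p) (c := z)); last first.
    by apply: sub_supported zp => s /= sp; apply: ltn_addl.
  rewrite [in X in _ + X]linear_sum /=.
  transitivity (\sum_(n < N + p) (\sum_l (ce n).1 l *: total_of (r n l) + d (total_of
    (ce n).2))).
    apply: eq_bigr => n _; rewrite total_of_boundary [in LHS]ceP total_of_add.
    by rewrite total_of_sum; congr (_ + _); apply: eq_bigr => l _; rewrite total_ofZ.
  rewrite big_split; congr (_ + _).
  rewrite big_split_ord /= [X in _ + X]big1 ?addr0; first by rewrite big_sig.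
  move=> i _; rewrite big1 // => -[l lt]; exfalso.
  by move: lt; rewrite N0 //= leq_addr.
Qed.

End SpaceBasis.

Lemma poincare_at1 (D : nat -> nat) N : (forall i, (N <= i)%N -> D i = 0%N) ->
  (\sum_(i \in [set i | (2 <= i)%N]) ('X^i : {poly int}) *+ D i).[1] =
  (\sum_(i < N) (if (2 <= i)%N then D i else 0%N))%N%:Z.
Proof.
move=> DN; rewrite (@fsbigE _ _ _ _ _ [seq i <- iota 0 N | (2 <= i)%N]); first last.
- move=> i /= i2; rewrite mem_filter i2 mem_iota /= add0n -leqNgt => /DN ->.
  by rewrite mulr0n.
- by move=> i /=; rewrite mem_filter => /andP[].
- by rewrite filter_uniq // iota_uniq.
rewrite big_filter_cond -[N in iota 0 N]subn0 -/(index_iota 0 N) big_mkord horner_sum.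
rewrite (big_morph Posz PoszD (erefl _)) big_mkcond /=; apply: eq_bigr => i _.
have -> : (i : nat) \in [set i0 | (2 <= i0)%N] = (2 <= i)%N.
  by apply/idP/idP; rewrite inE.
rewrite andbb; case: ifP => // _.
by rewrite hornerMn hornerXn expr1n natz.
Qed.

Section KernelDimension.
Variables (R : realType) (X Y : topologicalType) (f : continuousType X Y).
Notation S := (singset R X).
Notation d := (fglift (@simplex_bd S)).
Notation K n := (Defs.ker (homology_map R f n)).

Lemma ker_submod n : K n 0 /\ forall a u v, K n u -> K n v -> K n (a *: u + v).
Proof.
split => [|a u v]; rewrite /Defs.ker /= ?linear0 // => ku kv.
by rewrite linearP /= ku kv scaler0 addr0.
Qed.

(** If the total homology has a finite spanning family x, then each degree n
has dimension at most the size of x, and dimension 0 as soon as n exceeds the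
degrees of the chains of x. *)
Lemma hspan_indep_bound (I : finType) (x : I -> {freeg S / rat}) n k
    (h : 'I_k -> homology R X n) : hspan x -> lin_indep h ->
  (k <= #|I|)%N /\ (forall N, (forall i, supported (fun s : S => tag s < N)%N (x i)) ->
     (N <= n)%N -> k = 0%N).
Proof.
move=> xs hi.
have /choice[ce ceP] : forall l, exists ce : (I -> rat) * {freeg S / rat},
    total_of (val (rep (h l))) = \sum_i ce.1 i *: x i + d ce.2.
  by move=> l; have [c [e E]] := xs _ (d_total_of_rep (h l)); exists (c, e).
have key c : \sum_l c l *: val (rep (h l)) =
    \sum_i (\sum_l c l * (ce l).1 i) *: component n (x i) +
    boundary (component n.+1 (\sum_l c l *: (ce l).2)).
  transitivity (component n (\sum_l c l *: total_of (val (rep (h l))))).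
    by rewrite component_sum; apply: eq_bigr => l _;
      rewrite componentZ component_total_of.
  rewrite -component_d fglift_sum.
  transitivity (component n (\sum_i (\sum_l c l * (ce l).1 i) *: x i
      + \sum_l c l *: d (ce l).2)); last first.
    rewrite component_add component_sum; congr (_ + component n _).
      by apply: eq_bigr => i _; rewrite componentZ.
    by apply: eq_bigr => i _; rewrite fgliftZ.
  congr component; under eq_bigr => l _ do rewrite ceP scalerDr.
  rewrite big_split; congr (_ + _).
  under eq_bigr => l _ do rewrite scaler_sumr.
  rewrite exchange_big; apply: eq_bigr => i _ /=.
  by rewrite scaler_suml; apply: eq_bigr => l _; rewrite scalerA.
split=> [|N xN Nn].
  rewrite leqNgt; apply/negP; rewrite -[k in (_ < k)%N]card_ord => /linear_relation.
  move=> /(_ (fun l i => (ce l).1 i))[c [[l cl] cE]].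
  case/eqP: cl; apply: (hi c); apply/sum_rep_eq0.
  exists (component n.+1 (\sum_j c j *: (ce j).2)).
  by rewrite key [X in _ = X + _]big1 ?add0r // => i _; rewrite cE scale0r.
case: k h hi ce ceP key => [//|k] h hi ce ceP key; exfalso.
have : (1 : rat) = 0.
  pose c (i : 'I_k.+1) : rat := (i == ord0)%:R.
  apply: (hi c _ ord0); apply/sum_rep_eq0.
  exists (component n.+1 (\sum_j c j *: (ce j).2)).
  rewrite key [X in _ = X + _]big1 ?add0r // => i _.
  rewrite (component_supported (xN i)) ?scaler0 // => s sN.
  by apply/eqP => sn; move: sN; rewrite sn; lia.
by move/eqP; rewrite oner_eq0.
Qed.

Lemma fin_total_ker (I : finType) (x : I -> {freeg S / rat}) : hspan x ->
  fin_total_dim (fun n => K n).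
Proof.
move=> xs.
have bd n : fin_dim (K n) /\ (Defs.dim (K n) <= #|I|)%N.
  apply: fin_dim_bound; [exact: (ker_submod n).1|exact: (ker_submod n).2|].
  by move=> k b bi _; case: (hspan_indep_bound xs bi).
split=> [i|]; first by case: (bd i).
have [N xN] := supported_bound_family (fun s : S => tag s) x.
apply: (sub_finite_set _ (finite_II N)) => n /= nK; rewrite ltnNge; apply/negP => Nn.
have [b [bi _]] := fin_dimP (bd n).1.
by move: nK; rewrite ((hspan_indep_bound xs bi).2 N).
Qed.

(** Independent classes of the total kernel, in degrees at least 2, are at most
as many as the sum of the dimensions of the kernels in these degrees: the
coordinates of their components in bases of the kernels cannot satisfy a common
linear relation. *)
Lemma homological_poly_ge (I : finType) (k : I -> {freeg S / rat}) :
  fin_total_dim (fun n => K n) ->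
  (forall i, d (k i) = 0) -> hindep k ->
  (forall i, supported (fun s : S => 2 <= tag s)%N (k i)) ->
  (forall i, exists b, freemap (singmap f) (k i) = fglift (@simplex_bd (singset R Y))
    b) ->
  #|I|%:Z < (homological_poly R f).[1].
Proof.
move=> [finK /finite_nat_bound[N0 hN0]] kc ki k2 kb.
have [p kp] := supported_bound_family (fun s : S => tag s) k.
pose N := maxn N0 p.
have N0N : (N0 <= N)%N by exact: leq_maxl.
have kN i : supported (fun s : S => tag s < N)%N (k i).
  by apply: sub_supported (kp i) => s sp; apply: leq_trans sp (leq_maxr _ _).
rewrite /homological_poly hornerD hornerC (poincare_at1 (N := N)); last first.
  move=> i Ni; apply/eqP/negPn/negP => /hN0; rewrite ltnNge => /negP; apply.
  exact: leq_trans Ni.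
rewrite ltz1D lez_nat.
pose D n := if (2 <= n)%N then Defs.dim (K n) else 0%N.
pose J : finType := {n : 'I_N & 'I_(D n)}.
have -> : (\sum_(i < N) (if (2 <= i)%N then Defs.dim (K i) else 0))%N = #|J|.
  rewrite card_tagged sumnE big_map big_enum /=; apply: eq_bigr => n _.
  by rewrite card_ord.
rewrite leqNgt; apply/negP => /linear_relation rel.
(* The components of the cycles in degree n, expressed in the basis r of the
   kernel. In degrees 0 and 1 both the components and the basis are trivial. *)
have H n : exists r : 'I_(D n) -> chain R X n, forall i,
    exists ae : ('I_(D n) -> rat) * chain R X n.+1,
    component n (k i) = \sum_l ae.1 l *: r l + boundary ae.2.
  rewrite /D; case: ifPn => n2; last first.
    exists (fun=> 0) => i; exists (fun=> 0, 0).
    rewrite (component_supported (k2 i)) ?big_ord0 ?linear0 ?addr0 // => s s2.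
    by apply: contraNneq n2 => <-.
  have [b bb] := fin_dimP (finK n).
  exists (fun l => val (rep (b l))) => i.
  have pc : boundary (component n (k i)) = 0.
    by case: n {n2 b bb} => [|n] //; rewrite -component_d kc linear0.
  have [h [e hE]] := cycle_class pc.
  have Kh : K n h.
    apply/homology_kerP; have [v vE] := kb i.
    exists (component n.+1 v + chain_map f e).
    transitivity (boundary (component n.+1 v) + boundary (chain_map f e)).
      exact: linearD.
    rewrite -component_d -vE component_chain_map boundary_chain_map hE.
    by rewrite (linearD (@chain_map R X Y f n)).
  have [c /rep_sum[e' E]] := is_basis_span bb Kh.
  exists (c, e' - e); rewrite [boundary _](linearB (@boundary R X n.+1)) /= addrA -E hE.
  by rewrite addrK.
pose r n := projT1 (cid (H n)).
have rP n i := projT2 (cid (H n)) i.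
pose ae n i := projT1 (cid (rP n i)).
have aeP n i : component n (k i) = \sum_l (ae n i).1 l *: r n l + boundary (ae n i).2.
  exact: (projT2 (cid (rP n i))).
have [c [[i ci] cE]] := rel (fun i p => (ae (tag p) i).1 (tagged p)).
case/eqP: ci; apply: (ki c (\sum_(n < N) total_of (\sum_j c j *: (ae n j).2))).
rewrite (sum_total_of_component (N := N) (c := \sum_j c j *: k j)); last first.
  by apply: supported_sum => j _; exact: supportedZ.
rewrite fglift_sum; apply: eq_bigr => n _ /=; rewrite total_of_boundary; congr total_of.
rewrite component_sum linear_sum /=.
transitivity (\sum_j (\sum_l (c j * (ae n j).1 l) *: r n l + c j *: boundary (ae n
  j).2)).
  apply: eq_bigr => j _; rewrite componentZ aeP scalerDr scaler_sumr; congr (_ + _).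
  by apply: eq_bigr => l _; rewrite scalerA.
rewrite big_split exchange_big /= big1 ?add0r => [|l _].
  by apply: eq_bigr => j _; rewrite [RHS](linearZ_LR (@boundary R X n.+1)).
by rewrite -scaler_suml (cE (Tagged (fun n : 'I_N => 'I_(D n)) l)) scale0r.
Qed.

End KernelDimension.

(** * Powers of a space *)
Section Power.
Variables (R : realType) (X : topologicalType).

Notation pow n := {ptws 'I_n -> X}.

Definition pow_tail n (x : pow n.+1) : pow n := fun i => x (fintype.lift ord0 i).
Definition pow_head n (x : pow n.+1) : X := x ord0.
Definition pow_cons n (x : pow n) (a : X) : pow n.+1 :=
  fun i => if unlift ord0 i is Some j then x j else a.

Lemma pow_tail_continuous n : continuous (@pow_tail n).
Proof. by apply: continuous_ptws => i; exact: continuous_coord. Qed.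

Lemma pow_head_continuous n : continuous (@pow_head n).
Proof. exact: continuous_coord. Qed.

HB.instance Definition _ n :=
  isContinuous.Build _ _ (@pow_tail n) (@pow_tail_continuous n).
HB.instance Definition _ n :=
  isContinuous.Build _ _ (@pow_head n) (@pow_head_continuous n).

Lemma pow_cons_continuous (T : topologicalType) n (a : T -> pow n) (b : T -> X) :
  continuous a -> continuous b -> continuous (fun t => pow_cons (a t) (b t)).
Proof.
move=> ac bc; apply: continuous_ptws => i; rewrite /pow_cons.
case: (unlift ord0 i) => [j|//].
exact: (continuous_compT ac (@continuous_coord _ X j)).
Qed.

Lemma pow_consK n (x : pow n.+1) : pow_cons (pow_tail x) (pow_head x) = x.
Proof.
apply/funext => i; rewrite /pow_cons.
by case: (unliftP ord0 i) => [j ->|->].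
Qed.

Lemma pow_tail_cons n (x : pow n) a : pow_tail (pow_cons x a) = x.
Proof. by apply/funext => i; rewrite /pow_tail /pow_cons liftK. Qed.

Lemma pow_head_cons n (x : pow n) a : pow_head (pow_cons x a) = a.
Proof. by rewrite /pow_head /pow_cons unlift_none. Qed.

Notation S := (singset R X).
Notation P n := (singset R (pow n)).

(** Pulling b back along the identity of the vertices of a makes the degrees
agree definitionally, and changes nothing when they are equal. *)
Definition pow_pair n (a : P n) (b : S) : P n.+1 :=
  Tagged (fun m => sing R (pow n.+1) m)
    (mkcts (pow_cons_continuous (@cts_fun _ _ (tagged a))
      (@cts_fun _ _ (tagged (sact b (tag a) id)))) : sing R (pow n.+1) (tag a)).

Lemma pow_fst_pair n (a : P n) (b : S) : sdeg a = sdeg b ->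
  singmap (@pow_tail n) (pow_pair a b) = a.
Proof.
move=> _; elim/singset_ind: a => m a; congr Tagged; apply/continuousEP => t.
exact: pow_tail_cons.
Qed.

Lemma pow_snd_pair n (a : P n) (b : S) : sdeg a = sdeg b ->
  singmap (@pow_head n) (pow_pair a b) = b.
Proof.
move=> ab; rewrite -[RHS]sact_id -ab; congr Tagged; apply/continuousEP => t.
exact: pow_head_cons.
Qed.

Lemma pow_pair_eta n (s : P n.+1) :
  pow_pair (singmap (@pow_tail n) s) (singmap (@pow_head n) s) = s.
Proof.
elim/singset_ind: s => m s; congr Tagged; apply/continuousEP => t.
rewrite -[RHS]pow_consK /pow_pair.
by congr pow_cons; rewrite /= vertex_map_id.
Qed.

Definition pow_prod n : symprod (P n) S := @SymProd _ _ (P n.+1)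
  (singmap (@pow_tail n)) (singmap (@pow_head n)) (@pow_pair n)
  (proj1 (@singmap_symmap R _ _ (@pow_tail n))) (proj1 (@singmap_symmap R _ _
    (@pow_head n)))
  (proj2 (@singmap_symmap R _ _ (@pow_tail n))) (proj2 (@singmap_symmap R _ _
    (@pow_head n)))
  (@pow_fst_pair n) (@pow_snd_pair n) (@pow_pair_eta n).

End Power.

Lemma freemap_simplex_bd (K K' : symset) (g : K -> K') c : symmap g ->
  fglift (@simplex_bd K') (freemap g c) = freemap g (fglift (@simplex_bd K) c).
Proof.
move=> gs; rewrite !fglift_comp; apply: eq_fglift => s.
by rewrite fglift1 simplex_bd_map.
Qed.

Lemma freemap_cross (K K' L L' : symset) (M : symprod K L) (M' : symprod K' L')
    (g : K -> K') (k : L -> L') (m : M -> M') u v :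
  symmap g -> symmap k -> (forall s, pfst (m s) = g (pfst s)) ->
  (forall s, psnd (m s) = k (psnd s)) ->
  freemap m (cross M u v) = cross M' (freemap g u) (freemap k v).
Proof.
move=> gs ks m1 m2; rewrite /cross /tens !fglift_comp; apply: eq_fglift => a.
rewrite fglift1 !fglift_comp; apply: eq_fglift => b.
by rewrite !fglift1 -(eilenberg_zilber_map (a, b) gs ks m1 m2).
Qed.

Lemma hbasis_iso (K K' : symset) (g : K -> K') (g' : K' -> K) (J : finType)
    (y : J -> {freeg K / rat}) : symmap g -> symmap g' -> cancel g g' -> cancel g' g ->
  hbasis y -> hbasis (fun j => freemap g (y j)).
Proof.
move=> gs gs' gK gK' [yc yi ys].
have cK (A B : choiceType) (p : A -> B) (q : B -> A) (c : {freeg A / rat}) : cancel p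
  q ->
    freemap q (freemap p c) = c :> {freeg A / rat}.
  move=> pK; rewrite fglift_comp -[RHS]fglift_id; apply: eq_fglift => s.
  by rewrite fglift1 pK.
split=> [j|c v E|z zc].
- by rewrite freemap_simplex_bd // yc fglift0.
- apply: (yi c (freemap g' v)); rewrite freemap_simplex_bd // -E fglift_sum.
  by apply: eq_bigr => j _; rewrite fgliftZ cK.
- have /ys[c [v E]] : fglift (@simplex_bd K) (freemap g' z) = 0.
    by rewrite freemap_simplex_bd // zc fglift0.
  exists c, (freemap g v); rewrite -[LHS](cK _ _ _ _ z gK') E fglift_add fglift_sum.
  rewrite freemap_simplex_bd //; congr (_ + _).
  by apply: eq_bigr => j _; rewrite fgliftZ.
Qed.

Section PowerBasis.
Variables (R : realType) (X : topologicalType).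
Notation pow n := {ptws 'I_n -> X}.

Lemma pow_basis (J : finType) (y : J -> {freeg (singset R X) / rat}) : hbasis y ->
  forall n, exists (I : finType) (x : I -> {freeg (singset R (pow n.+1)) / rat}),
    hbasis x /\ #|I| = (#|J| ^ n.+1)%N.
Proof.
move=> yb; elim=> [|n [I [x [xb xI]]]]; last first.
  have xyb := kunneth (pow_prod R X n.+1) yb xb.
  by exists (I * J)%type, (fun ij => cross (pow_prod R X n.+1) (x ij.1) (y ij.2));
    split => //; rewrite card_prod xI -expnSr.
have cc : continuous ((fun (x : X) (i : 'I_1) => x) : X -> pow 1).
  by apply: continuous_ptws => i x.
pose h : continuousType X (pow 1) := mkcts cc.
pose h' : continuousType (pow 1) X := mkcts (@continuous_coord _ X (ord0 : 'I_1)).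
exists J, (fun j => freemap (singmap h) (y j)); rewrite expn1; split=> //.
apply: (hbasis_iso (g' := singmap h')) => //; try exact: singmap_symmap.
- by elim/singset_ind => m s; congr Tagged; exact/continuousEP.
- elim/singset_ind => m s; congr Tagged; apply/continuousEP => t.
  by apply/funext => i; rewrite [i in RHS]ord1.
Qed.

Lemma dim_neq0 (V : lmodType rat) (A : set V) v : fin_dim A -> A v -> v <> 0 ->
  Defs.dim A <> 0%N.
Proof.
move=> /fin_dimP[b /is_basis_span bA] /bA[c ->] + d0; apply.
by rewrite big1 // => -[i ilt]; exfalso; move: ilt; rewrite d0.
Qed.

Definition chain_aug : chain R X 0 -> rat^o := fglift (fun=> 1).

Lemma chain_aug_boundary (c : chain R X 1) : chain_aug (boundary c) = 0.
Proof.
rewrite /chain_aug /= fglift_comp -[RHS](fglift_0f _ c); apply: eq_fglift => s.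
rewrite !big_ord_recl big_ord0 !freeg_linE fglift0.
by rewrite addr0 expr0 expr1 scale1r scaleN1r subrr.
Qed.

(** The class of a point is detected by the augmentation. *)
Lemma homology0_neq0 (x0 : X) : exists h : homology R X 0, h <> 0.
Proof.
pose s : sing R X 0 := mkcts (@cst_continuous _ _ x0).
have [h [e hE]] := @cycle_class R X 0 << s >> erefl.
exists h => h0; have : \sum_(i < 1) (1 : rat) *: h = 0.
  by rewrite big_ord1 h0 scaler0.
move/sum_rep_eq0 => [c]; rewrite big_ord1 scale1r hE => /(congr1 chain_aug).
rewrite chain_aug_boundary [RHS](fglift_add _ << s >> (boundary e)).
by rewrite [X in _ = _ + X]chain_aug_boundary addr0 [RHS]fglift1 => /esym/eqP;
  rewrite oner_eq0.
Qed.

End PowerBasis.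

Section Growth.
Variables (R : realType) (X Y : topologicalType) (f : continuousType X Y).
Notation d := (fglift (@simplex_bd (singset R _))).

Lemma kernel_cycle : fin_total_dim (fun i => Defs.ker (homology_map R f i)) ->
  1 < (homological_poly R f).[1] ->
  exists i (h : homology R X i), [/\ (2 <= i)%N, h <> 0 & homology_map R f i h = 0].
Proof.
move=> [finK /finite_nat_bound[N hN]].
rewrite /homological_poly hornerD hornerC (poincare_at1 (N := N)); last first.
  by move=> i Ni; apply/eqP/negPn/negP => /hN; rewrite ltnNge Ni.
rewrite ltrDl => sum_gt0.
have [i [i2 Ki]] : exists i, (2 <= i)%N /\ Defs.dim (Defs.ker (homology_map R f i))
  <> 0%N.
  apply: contrapT => /forallNP nK; move: sum_gt0; rewrite big1 // => i _.
  by case: ifP => // i2; apply: contrapT => Ki; exact: (nK i).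
have [b bb] := fin_dimP (finK i).
case: (Defs.dim _) Ki b bb => [//|k] _ b bb; exists i, (b ord0); split=> //.
  move=> b0; have [bi _] := bb.
  have E : \sum_j (j == ord0)%:R *: b j = 0.
    by rewrite big_ord_recl b0 scaler0 add0r big1 // => j _; rewrite scale0r.
  by have /eqP := bi _ E ord0; rewrite oner_eq0.
exact: (is_basis_mem bb ord0).
Qed.

(** The cross products of a basis of the homology of X^(n+1) with a class alpha
in the kernel of H(f) lie in the kernel of H(f^(n+2)). *)
Lemma power_growth (x0 : X) n : finite_homology_rank R X ->
  fin_total_dim (fun i => Defs.ker (homology_map R f i)) ->
  1 < (homological_poly R f).[1] ->
  let fn : continuousType {ptws 'I_n.+2 -> X} {ptws 'I_n.+2 -> Y} := power_map f
    (n:=n.+2) in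
  fin_total_dim (fun i => Defs.ker (homology_map R fn i)) /\
  (2 ^ n.+1)%N%:Z < (homological_poly R fn).[1].
Proof.
move=> rk kf f_ninj fn.
have [N [y [yb yN]]] := space_basis rk.
have [i [h [i2 h0 hf]]] := kernel_cycle kf f_ninj.
have [h' h'0] := homology0_neq0 R x0.
(* The homology of X has classes in degree 0 and in the degree i of alpha. *)
have J2 : (2 <= #|{: {i : 'I_N & 'I_(Defs.dim [set: homology R X i])}}|)%N.
  have D0 j (g : homology R X j) : g <> 0 -> exists p : {i : 'I_N & 'I_(Defs.dim
    [set: homology R X i])}, tag p = j :> nat.
    move=> g0; have Dj := dim_neq0 (rk.1 j) (I : [set: homology R X j] g) g0.
    have jN : (j < N)%N by rewrite ltnNge; apply/negP => /yN.
    have l0 : (0 < Defs.dim [set: homology R X j])%N by rewrite lt0n; apply/eqP.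
    by exists (Tagged (fun i : 'I_N => 'I_(Defs.dim [set: homology R X i]))
      (Ordinal l0 : 'I_(Defs.dim [set: homology R X (Ordinal jN)]))).
  have [p pi] := D0 _ _ h0; have [q q0] := D0 _ _ h'0.
  apply/card_gt1P; exists p, q; split=> //; apply/eqP => pq.
  by move: i2; rewrite -pi pq q0.
have [I [x [xb xI]]] := pow_basis yb n.
have [_ _ xyspan] := kunneth (pow_prod R X n.+1) yb xb.
have kfn := @fin_total_ker R _ _ fn _ _ xyspan.
split=> //.
pose alpha := total_of (val (rep h)) : {freeg (singset R X) / rat}.
have alpha_nb v : alpha <> d v.
  move=> E; apply: h0; have : \sum_(j < 1) (1 : rat) *: h = 0; last first.
    by rewrite big_ord1 scale1r.
  apply/sum_rep_eq0; exists (component i.+1 v); rewrite big_ord1 scale1r.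
  by rewrite -component_d -E component_total_of.
have alpha_c : d alpha = 0 := d_total_of_rep h.
have := @homological_poly_ge R _ _ fn I (fun j => cross (pow_prod R X n.+1) (x j)
  alpha) kfn.
rewrite xI => low; apply: le_lt_trans (low _ _ _ _).
- by rewrite lez_nat leq_exp2r.
- have [xc _ _] := xb.
  by move=> j; rewrite (bd_cross (pow_prod R X n.+1)) // xc /cross tens0l fglift0.
- exact: (cross_indep (M := pow_prod R X n.+1) yb xb alpha_c alpha_nb).
- move=> j; apply: (supported_fglift (P := fun s => sdeg s.2 == i)).
    apply: (supported_fglift (P := predT)) => // a _.
    apply: (supported_fglift (P := fun s : singset R X => tag s == i)).
      by apply: (supported_fglift (P := predT)) => // s _; exact: supported1.
    by move=> s /= si; apply: supported1.
  move=> s /eqP si; apply: sub_supported (@eilenberg_zilber_deg _ _ (pow_prod R X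
    n.+1) s) => t.
  by rewrite si => /eqP ts; rewrite -[tag t]/(sdeg t) ts; apply: leq_trans i2 _;
    exact: leq_addl.
- move=> j; have /homology_kerP[c cE] := hf.
  have [xc _ _] := xb.
  pose fK := power_map f (n := n.+1) : continuousType _ _.
  have fx0 : d (freemap (singmap fK) (x j)) = 0.
    by rewrite freemap_simplex_bd ?xc ?fglift0 //; exact: singmap_symmap.
  have [b bE] := cross_bdr (pow_prod R Y n.+1) (total_of c) fx0.
  exists b; rewrite -bE total_of_boundary cE total_of_chain_map.
  apply: (freemap_cross (M := pow_prod R X n.+1) (M' := pow_prod R Y n.+1)).
  + exact: singmap_symmap.
  + exact: singmap_symmap.
  + by elim/singset_ind => m s; congr Tagged; exact/continuousEP.
  + by elim/singset_ind => m s; congr Tagged; exact/continuousEP.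
Qed.

End Growth.

(** * Unit laws for the concatenation of spheroids *)
Section UnitLaws.
Variable R : realType.
Notation I := (unit_itv R).

(** Reparametrizations of the unit interval that deform [itv_lo] and [itv_hi],
at t = 0, to the identity, at t = 1, and preserve the two ends. *)
Fact slide_lo_ge0 (s t : I) : 0 <= Num.min 1 ((2 - set_val t) * set_val s).
Proof.
rewrite le_min ler01 mulr_ge0 ?unit_itv_ge0 // subr_ge0.
by rewrite (le_trans (unit_itv_le1 t)) // ler1n.
Qed.
Fact slide_lo_le1 (s t : I) : Num.min 1 ((2 - set_val t) * set_val s) <= 1.
Proof. by rewrite ge_min lexx. Qed.
Fact slide_hi_ge0 (s t : I) : 0 <= Num.max 0 ((2 - set_val t) * set_val s - (1 -
  set_val t)).
Proof. by rewrite le_max lexx. Qed.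
Fact slide_hi_le1 (s t : I) : Num.max 0 ((2 - set_val t) * set_val s - (1 - set_val
  t)) <= 1.
Proof.
rewrite ge_max ler01 /=; have := unit_itv_le1 s; have := unit_itv_le1 t.
by move: (set_val t) (set_val s) => u v u1 v1; nra.
Qed.

Definition slide_lo (s t : I) : I := mk_itv (slide_lo_ge0 s t) (slide_lo_le1 s t).
Definition slide_hi (s t : I) : I := mk_itv (slide_hi_ge0 s t) (slide_hi_le1 s t).

Lemma val_slide_lo s t : set_val (slide_lo s t) = Num.min 1 ((2 - set_val t) *
  set_val s).
Proof. by rewrite [in LHS]set_valE. Qed.
Lemma val_slide_hi s t :
  set_val (slide_hi s t) = Num.max 0 ((2 - set_val t) * set_val s - (1 - set_val t)).
Proof. by rewrite [in LHS]set_valE. Qed.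

Lemma continuous_slide (T : topologicalType) (a b : T -> I) :
  continuous a -> continuous b ->
  continuous (fun x => (2 - set_val (b x)) * set_val (a x) : R).
Proof.
move=> ac bc x; apply: (@cvgM _ _ (nbhs x) _ (fun x => 2 - set_val (b x)) (fun x =>
  set_val (a x))).
  apply: (@cvgB _ R^o _ (nbhs x) _ (cst 2) (fun x => set_val (b x))).
    exact: cst_continuous.
  exact: (continuous_compT bc (@itv_val_continuous R)).
exact: (continuous_compT ac (@itv_val_continuous R)).
Qed.

Lemma slide_lo_continuous (T : topologicalType) (a b : T -> I) :
  continuous a -> continuous b -> continuous (fun x => slide_lo (a x) (b x)).
Proof.
move=> ac bc; apply: continuous_set_type.
rewrite (_ : _ \o _ = cst 1 \min (fun x => (2 - set_val (b x)) * set_val (a x))).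
  move=> t; apply: continuous_min; first exact: cst_continuous.
  exact: continuous_slide.
by apply/funext => t; exact: val_slide_lo.
Qed.

Lemma slide_hi_continuous (T : topologicalType) (a b : T -> I) :
  continuous a -> continuous b -> continuous (fun x => slide_hi (a x) (b x)).
Proof.
move=> ac bc; apply: continuous_set_type.
rewrite (_ : _ \o _ = cst 0 \max (fun x => (2 - set_val (b x)) * set_val (a x) - (1 -
  set_val (b x)))).
  move=> t; apply: continuous_max; first exact: cst_continuous.
  apply: (@cvgB _ R^o _ (nbhs t) _ (fun x => (2 - set_val (b x)) * set_val (a x))
    (fun x => 1 - set_val (b x))).
    exact: continuous_slide.
  apply: (@cvgB _ R^o _ (nbhs t) _ (cst 1) (fun x => set_val (b x))).
    exact: cst_continuous.
  exact: (continuous_compT bc (@itv_val_continuous R)).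
by apply/funext => t; exact: val_slide_hi.
Qed.

Lemma val_itv0 : set_val (itv0 R) = 0. Proof. by rewrite set_valE. Qed.
Lemma val_itv1 : set_val (itv1 R) = 1. Proof. by rewrite set_valE. Qed.

Lemma slide_lo0 s : slide_lo s (itv0 R) = itv_lo s.
Proof. by apply: itv_eq; rewrite val_slide_lo val_itv0 subr0 [in RHS]set_valE. Qed.
Lemma slide_lo1 s : slide_lo s (itv1 R) = s.
Proof.
apply: itv_eq; rewrite val_slide_lo val_itv1.
rewrite (_ : (2 - 1 : R) = 1) ?mul1r; last by lra.
by rewrite min_r // unit_itv_le1.
Qed.
Lemma slide_hi0 s : slide_hi s (itv0 R) = itv_hi s.
Proof. by apply: itv_eq; rewrite val_slide_hi val_itv0 !subr0 [in RHS]set_valE. Qed.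
Lemma slide_hi1 s : slide_hi s (itv1 R) = s.
Proof.
apply: itv_eq; rewrite val_slide_hi val_itv1.
rewrite (_ : (2 - 1 : R) = 1) ?mul1r ?subrr ?subr0; last by lra.
by rewrite max_r // unit_itv_ge0.
Qed.

Lemma slide_lo_end s t : set_val s = 0 \/ set_val s = 1 ->
  set_val (slide_lo s t) = 0 \/ set_val (slide_lo s t) = 1.
Proof.
have := unit_itv_le1 t; rewrite val_slide_lo => t1 [->|->]; [left|right].
  by rewrite mulr0 min_r.
by rewrite mulr1 min_l //; lra.
Qed.
Lemma slide_hi_end s t : set_val s = 0 \/ set_val s = 1 ->
  set_val (slide_hi s t) = 0 \/ set_val (slide_hi s t) = 1.
Proof.
have := unit_itv_le1 t; rewrite val_slide_hi => t1 [->|->]; [left|right].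
  by rewrite mulr0 max_l //; lra.
by rewrite mulr1 (_ : _ - _ - _ = 1); [rewrite max_r|lra].
Qed.

Variables (X : topologicalType) (x : X) (n : nat).
Notation sph := (spheroid R x n.+1).

Definition slide (u : I -> I -> I) (st : cube R n.+1 * I) : cube R n.+1 :=
  fun j => if j == ord0 then u (st.1 j) st.2 else st.1 j.

Lemma slide_continuous u :
  (forall (T : topologicalType) (a b : T -> I),
    continuous a -> continuous b -> continuous (fun x => u (a x) (b x))) ->
  continuous (slide u).
Proof.
move=> uc; apply: continuous_ptws => j; rewrite /slide.
have c1 : continuous (fun st : cube R n.+1 * I => st.1 j).
  exact: (continuous_compT (@continuous_fst _ _) (@cube_coord_continuous R n.+1 j)).
case: eqP => _ //; apply: uc => //; exact: continuous_snd.
Qed.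

(** Precomposing a spheroid with such a deformation of the first coordinate is a
homotopy relative to the boundary of the cube. *)
Lemma slide_homotopic u (a b : sph) :
  (forall (T : topologicalType) (a b : T -> I),
    continuous a -> continuous b -> continuous (fun x => u (a x) (b x))) ->
  (forall s, u s (itv1 R) = s) ->
  (forall s t, set_val s = 0 \/ set_val s = 1 ->
    set_val (u s t) = 0 \/ set_val (u s t) = 1) ->
  (forall s, val b s = val a (slide u (s, itv0 R))) -> homotopic b a.
Proof.
move=> uc u1 ub bE; apply/asboolP.
have Hc := continuous_compT (slide_continuous uc) (@cts_fun _ _ (val a)).
exists (mkcts Hc); split => /= [s|s|s t [j sj]]; first by rewrite bE.
- congr (val a _); apply/funext => j; rewrite /slide /=.
  by case: ifP.
- apply: spheroidP; exists j; rewrite /slide /=.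
  by case: ifP => // _; exact: ub.
Qed.

Fact cst_spheroid : is_spheroid x (mkcts (@cst_continuous (cube R n.+1) X x)).
Proof. exact/asboolP. Qed.
Definition cst_sphere : sph :=
  exist _ (mkcts (@cst_continuous (cube R n.+1) X x) : continuousType _ _) cst_spheroid.

Lemma concat_cst_spherer (a : sph) : homotopic (concat a cst_sphere) a.
Proof.
apply: (slide_homotopic slide_lo_continuous slide_lo1 slide_lo_end) => s.
rewrite -[LHS]/(concat_fun a cst_sphere s) /concat_fun.
have -> : slide slide_lo (s, itv0 R) = cube_lo s.
  by apply/funext => j; rewrite /slide /cube_lo /= slide_lo0.
case: ifPn => // s0; rewrite [LHS]/= spheroidP //; exists ord0; right.
rewrite /cube_lo eqxx [in LHS]set_valE /= min_l //.
by move: s0; rewrite -ltNge; lra.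
Qed.

Lemma concat_cst_spherel (a : sph) : homotopic (concat cst_sphere a) a.
Proof.
apply: (slide_homotopic slide_hi_continuous slide_hi1 slide_hi_end) => s.
rewrite -[LHS]/(concat_fun cst_sphere a s) /concat_fun.
have -> : slide slide_hi (s, itv0 R) = cube_hi s.
  by apply/funext => j; rewrite /slide /cube_hi /= slide_hi0.
case: ifPn => // s0; rewrite [LHS]/= spheroidP //; exists ord0; left.
rewrite /cube_hi eqxx [in LHS]set_valE /= max_l //.
by move: s0; lra.
Qed.

End UnitLaws.

(** * Rational homotopy groups of powers *)
Section TensorGenerators.
Variables (G : choiceType) (mul : G -> G -> G).

Definition tclass (g : G) : rat_tensor mul :=
  \pi_(lquot (in_span (tensor_relators mul))) << g >>.

Lemma tclassM g h : tclass (mul g h) = tclass g + tclass h.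
Proof.
rewrite /tclass -pi_lquotD; apply/eqP; rewrite eq_lquot opprD addrA inE.
exists 1%N, (fun=> 1), (fun=> << mul g h >> - << g >> - << h >>); split.
  by move=> _; exists (g, h).
by rewrite big_ord1 scale1r.
Qed.

Lemma rat_tensor_ind (P : rat_tensor mul -> Prop) : P 0 -> (forall g, P (tclass g)) ->
  (forall a u v, P u -> P v -> P (a *: u + v)) -> forall v, P v.
Proof.
move=> P0 P1 PD; elim/(@quotW _ (lquot (in_span (tensor_relators mul)))).
elim/freeg_ind => [|g|a u v Pu Pv]; last 2 first.
- exact: P1.
- by rewrite pi_lquotD pi_lquotZ; exact: PD.
suff -> : \pi_(lquot (in_span (tensor_relators mul))) 0 = 0 :> rat_tensor mul by [].
rewrite -[X in \pi_(lquot _) X](scale0r 0) pi_lquotZ.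
exact: (scale0r (\pi_(lquot (in_span (tensor_relators mul))) 0 : rat_tensor mul)).
Qed.

End TensorGenerators.

Lemma rat_tensor_map_class (G G' : choiceType) (mul : G -> G -> G)
    (mul' : G' -> G' -> G') (phi : G -> G')
    (phiM : forall g h, phi (mul g h) = mul' (phi g) (phi h)) g :
  rat_tensor_map phiM (tclass mul g) = tclass mul' (phi g).
Proof.
rewrite /tclass /rat_tensor_map [LHS]lquot_mapE.
by rewrite /= /freeg_map fglift1.
Qed.

Section PowerHomotopy.
Variables (R : realType) (X : topologicalType) (x0 : X) (n : nat).
Notation Xn := {ptws 'I_n -> X}.
Notation xn := ((fun=> x0) : Xn).

Definition coordinate (j : 'I_n) (x : Xn) : X := x j.
HB.instance Definition _ j := isContinuous.Build Xn X (coordinate j)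
  (@continuous_coord _ X j).

Section Tuples.
Variable k : nat.
Implicit Types a b : 'I_n -> spheroid R x0 k.

Lemma tuple_sphere_continuous a : continuous ((fun s i => val (a i) s) : cube R k ->
  Xn).
Proof. by apply: continuous_ptws => i; exact: cts_fun. Qed.

Fact tuple_sphere_spheroid a : is_spheroid xn (mkcts (@tuple_sphere_continuous a)).
Proof. by apply/asboolP => s bs; apply/funext => i; exact: spheroidP. Qed.

Definition tuple_sphere a : spheroid R xn k :=
  exist _ (mkcts (@tuple_sphere_continuous a) : continuousType _ _)
    (tuple_sphere_spheroid a).

Lemma tuple_sphere_homotopic a b : (forall i, homotopic (a i) (b i)) -> homotopic
  (tuple_sphere a) (tuple_sphere b).
Proof.
move=> ab; have /choice[H HP] : forall i, exists H : continuousType (cube R k *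
  unit_itv R)%type X,
      [/\ forall s, H (s, itv0 R) = val (a i) s,
          forall s, H (s, itv1 R) = val (b i) s &
          forall s t, cube_boundary s -> H (s, t) = x0].
  by move=> i; have /asboolP := ab i.
have Hc : continuous ((fun st i => H i st) : cube R k * unit_itv R -> Xn).
  by apply: continuous_ptws => i; exact: cts_fun.
apply/asboolP; exists (mkcts Hc); split=> [s|s|s t bs]; apply/funext => i /=.
- by have [h _ _] := HP i; exact: h.
- by have [_ h _] := HP i; exact: h.
- by have [_ _ h] := HP i; exact: h.
Qed.

Lemma tuple_sphere_coordinate (u : spheroid R xn k) :
  tuple_sphere (fun i => spheroid_map (coordinate i) u : spheroid R x0 k) = u.
Proof. by apply: val_inj; apply/continuousEP => s; apply/funext. Qed.

End Tuples.

Lemma tuple_sphere_concat k (a b : 'I_n -> spheroid R x0 k.+1) :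
  tuple_sphere (fun i => concat (a i) (b i)) = concat (tuple_sphere a) (tuple_sphere b).
Proof.
apply: val_inj; apply/continuousEP => s; apply/funext => i.
rewrite -[LHS]/(concat_fun (a i) (b i) s) -[RHS]/(concat_fun (tuple_sphere a)
  (tuple_sphere b) s i).
by rewrite /concat_fun; case: ifP.
Qed.

Variable k : nat.
Notation pi1 x := (homotopy_group R x k.+1).
Notation c := (cst_sphere R x0 k).

Definition axis_sphere (j : 'I_n) (a : spheroid R x0 k.+1) : spheroid R xn k.+1 :=
  tuple_sphere (fun i => if i == j then a else c).

(** The map induced by the inclusion of the j-th axis. It is defined on
spheroids and not through a map of spaces, because the inclusion sends the base
point to the base point only up to extensional equality, and the homotopy
groups depend on the base point as a term. *)
Definition pi_axis (j : 'I_n) (u : pi1 x0) : pi1 xn :=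
  \pi_(homotopy_group R xn k.+1) (axis_sphere j (repr u)).

Lemma pi_axisE j a : pi_axis j (\pi_(homotopy_group R x0 k.+1) a) =
  \pi_(homotopy_group R xn k.+1) (axis_sphere j a).
Proof.
apply/eqmodP; apply: tuple_sphere_homotopic => i; case: eqP => _;
  last exact: homotopic_refl.
by apply/eqmodP; rewrite reprK.
Qed.

Lemma pi_axisM j u v : pi_axis j (Defs.pi_mul u v) = Defs.pi_mul (pi_axis j u)
  (pi_axis j v).
Proof.
elim/(@quotW _ (homotopy_group R x0 k.+1)): u => a.
elim/(@quotW _ (homotopy_group R x0 k.+1)): v => b.
rewrite Defs.pi_mulE !pi_axisE Defs.pi_mulE -tuple_sphere_concat; apply/eqmodP.
apply: tuple_sphere_homotopic => i; case: eqP => _; first exact: homotopic_refl.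
by rewrite homotopic_sym; exact: concat_cst_spherer.
Qed.

Notation class := (tclass (@Defs.pi_mul R _ xn k)).
Notation sphere_class u := (class (\pi_(homotopy_group R xn k.+1) u)).

Lemma sphere_class_homotopic a b : homotopic a b -> sphere_class a = sphere_class b.
Proof. by move=> ab; congr tclass; apply/eqmodP. Qed.

Lemma sphere_class_concat a b : sphere_class (concat a b) = sphere_class a +
  sphere_class b.
Proof. by rewrite -Defs.pi_mulE tclassM. Qed.

(** Turn the coordinates on one at a time: the concatenation of the tuple with
m coordinates and of the m-th axis is, in each coordinate, a concatenation with
a constant spheroid. *)
Lemma sphere_class_tuple (a : 'I_n -> spheroid R x0 k.+1) : sphere_class
  (tuple_sphere a) = \sum_j sphere_class (axis_sphere j (a j)).
Proof.
pose t m := tuple_sphere (fun i : 'I_n => if (i < m)%N then a i else c).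
have tS (m : 'I_n) : sphere_class (t m.+1) = sphere_class (t m) + sphere_class
  (axis_sphere m (a m)).
  rewrite -sphere_class_concat -tuple_sphere_concat;
    apply/sphere_class_homotopic/tuple_sphere_homotopic => i.
  rewrite homotopic_sym ltnS [(i <= m)%N]leq_eqVlt.
  have -> : (i == m) = (i == m :> nat) by rewrite val_eqE.
  case: (ltngtP i m) => [im|im|/val_inj ->] /=;
    [exact: concat_cst_spherer| |exact: concat_cst_spherel].
  exact: concat_cst_spherer.
have t0 : sphere_class (t 0%N) = 0.
  apply: (@addrI _ (sphere_class (t 0%N)));
    rewrite addr0 -sphere_class_concat -tuple_sphere_concat.
  by apply/sphere_class_homotopic/tuple_sphere_homotopic => i;
    exact: concat_cst_spherer.
have tm m : (m <= n)%N -> sphere_class (t m) = \sum_(j < n | (j < m)%N) sphere_class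
  (axis_sphere j (a j)).
  elim: m => [_|m IH mn]; first by rewrite t0 big_pred0.
  rewrite (tS (Ordinal mn)) IH ?(ltnW mn) //.
  rewrite [RHS](bigD1 (Ordinal mn)) //= addrC; congr (_ + _); apply: eq_bigl => j.
  by rewrite ltnS ltn_neqAle andbC.
have -> : tuple_sphere a = t n.
  by congr tuple_sphere; apply/funext => i; rewrite ltn_ord.
by rewrite tm //; apply: eq_bigl => j; rewrite ltn_ord.
Qed.

Definition pi_rat_axis j : {linear pi_rat R x0 k -> pi_rat R xn k} :=
  rat_tensor_map (pi_axisM j).

Definition pi_rat_coordinate j : {linear pi_rat R xn k -> pi_rat R x0 k} :=
  pi_rat_map R (coordinate j) xn k.

Lemma pi_rat_decomp v : v = \sum_j pi_rat_axis j (pi_rat_coordinate j v).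
Proof.
elim/rat_tensor_ind: v => [|g|a u v Fu Fv].
- by rewrite big1 // => j _; rewrite !linear0.
- elim/(@quotW _ (homotopy_group R xn k.+1)): g => u.
  rewrite -{1}(tuple_sphere_coordinate u) sphere_class_tuple; apply: eq_bigr => j _.
  by rewrite [pi_rat_coordinate _ _]rat_tensor_map_class pi_mapE
    [RHS]rat_tensor_map_class pi_axisE.
- rewrite {1}Fu {1}Fv scaler_sumr -big_split; apply: eq_bigr => j _ /=.
  by rewrite !linearP.
Qed.

End PowerHomotopy.

Lemma pi_rat_coordinate_natural (R : realType) (X Y : topologicalType)
    (f : continuousType X Y) (x0 : X) n k (j : 'I_n) v :
  pi_rat_map R f x0 k (pi_rat_coordinate R x0 k j v) =
  pi_rat_coordinate R (f x0) k j
    (pi_rat_map R (power_map f (n:=n) : continuousType _ _) (fun=> x0) k v).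
Proof.
elim/rat_tensor_ind: v => [|g|a u v Fu Fv].
- by rewrite !linear0.
- elim/(@quotW _ (homotopy_group R ((fun=> x0) : {ptws 'I_n -> X}) k.+1)): g => u.
  rewrite [pi_rat_coordinate _ _ _ _ _]rat_tensor_map_class pi_mapE.
  rewrite [LHS]rat_tensor_map_class pi_mapE.
  rewrite [pi_rat_map _ _ _ _ _]rat_tensor_map_class pi_mapE.
  rewrite [RHS]rat_tensor_map_class pi_mapE.
  by congr tclass; congr (\pi_ _ _); apply: val_inj; exact/continuousEP.
- rewrite (linearP (pi_rat_coordinate R x0 k j)) (linearP (pi_rat_map R f x0 k)) Fu Fv.
  rewrite (linearP (pi_rat_map R (power_map f (n:=n) : continuousType _ _) (fun=> x0)
    k)).
  by rewrite (linearP (pi_rat_coordinate R (f x0) k j)).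
Qed.

(** A subspace that maps into B under each of finitely many maps, jointly
injective, has dimension at most that of the corresponding power of B. *)
Lemma fin_dim_jointly_injective (V W : lmodType rat) (J : finType)
    (p : J -> {linear V -> W}) (A : set V) (B : set W) :
  A 0 -> (forall a u v, A u -> A v -> A (a *: u + v)) ->
  (forall v, (forall j, p j v = 0) -> v = 0) ->
  (forall j v, A v -> B (p j v)) -> fin_dim B ->
  fin_dim A /\ (Defs.dim A <= #|J| * Defs.dim B)%N.
Proof.
move=> A0 AD pinj pAB /fin_dimP[b bb]; apply: fin_dim_bound => // m v vi vA.
have /choice[a aE] : forall ij : 'I_m * J, exists a : 'I_(Defs.dim B) -> rat,
    p ij.2 (v ij.1) = \sum_l a l *: b l.
  by move=> ij; apply: is_basis_span bb _; exact: pAB.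
rewrite leqNgt; apply/negP => mJ.
have := @linear_relation 'I_m (J * 'I_(Defs.dim B))%type (fun i jl => a (i, jl.1) jl.2).
rewrite card_prod !card_ord => /(_ mJ)[c [[i ci] cE]].
case/eqP: ci; apply: (vi c); apply: pinj => j.
rewrite linear_sum /=.
transitivity (\sum_i0 \sum_l (c i0 * a (i0, j) l) *: b l).
  apply: eq_bigr => i0 _; rewrite linearZ /= (aE (i0, j)) scaler_sumr.
  by apply: eq_bigr => l _; rewrite scalerA.
rewrite exchange_big big1 // => l _.
by rewrite -scaler_suml (cE (j, l)) scale0r.
Qed.

Lemma pi_rat_power_ker (R : realType) (X Y : topologicalType)
    (f : continuousType X Y) (x0 : X) n k :
  let fn : continuousType {ptws 'I_n -> X} {ptws 'I_n -> Y} := power_map f (n:=n) in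
  fin_dim (Defs.ker (pi_rat_map R f x0 k)) ->
  fin_dim (Defs.ker (pi_rat_map R fn (fun=> x0) k)) /\
  (Defs.dim (Defs.ker (pi_rat_map R fn (fun=> x0) k)) <=
    n * Defs.dim (Defs.ker (pi_rat_map R f x0 k)))%N.
Proof.
move=> fn finK; rewrite -[n in (_ <= n * _)%N]card_ord.
apply: (fin_dim_jointly_injective (p := pi_rat_coordinate R x0 k)) finK.
- by rewrite /Defs.ker /= linear0.
- move=> a u v; rewrite /Defs.ker /= => ku kv.
  by rewrite linearP /= ku kv scaler0 addr0.
- move=> v v0; rewrite (pi_rat_decomp v) big1 // => j _.
  by rewrite v0 linear0.
- move=> j v kv; rewrite /Defs.ker /mkset pi_rat_coordinate_natural.
  by rewrite (kv : pi_rat_map R fn (fun=> x0) k v = 0) linear0.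
Qed.

(** * Linear against exponential growth *)
(** With m = n - 1 one has n * C <= m * m <= 2 ^ m, as soon as m is at least 4
and at least 2 * C. *)
Lemma leq_mul_exp2 C n : (C.*2 + 5 <= n)%N -> (n * C <= 2 ^ n.-1)%N.
Proof.
have sq m : (4 <= m)%N -> (m * m <= 2 ^ m)%N.
  elim: m => // m IH; rewrite leq_eqVlt => /predU1P[<-//|m4].
  by have := IH m4; rewrite expnS; nia.
case: n => [|n] nC; first by rewrite mul0n.
by apply: leq_trans (sq n _); [nia|lia].
Qed.

Local Close Scope quotient_scope.
Local Close Scope classical_set_scope.
Unset Implicit Arguments.

Theorem theorem3p8 (R : realType) (X Y : topologicalType)
    (f : continuousType X Y) (x0 : X)
    (X_sc : simply_connected R X) (Y_sc : simply_connected R Y)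
    (X_ft : rational_finite_type R X) (Y_ft : rational_finite_type R Y)
    (f_ell : rationally_elliptic_ker R f x0)
    (X_rank : finite_homology_rank R X)
    (f_ninj : 1 < (homological_poly R f).[1]) :
  exists n0 : nat, (0 < n0)%N /\
    forall n : nat, (n0 <= n)%N ->
      let fn : continuousType {ptws 'I_n -> X} {ptws 'I_n -> Y} :=
        power_map f (n:=n) in
      let xn : {ptws 'I_n -> X} := fun=> x0 in
      rationally_elliptic_ker R fn xn /\
      (homotopical_poly R fn xn).[1] < (homological_poly R fn).[1].
Proof.
have [kerH [kerpi /finite_nat_bound[N piN]]] := f_ell.
pose D k := Defs.dim (Defs.ker (pi_rat_map R f x0 k)).
have DN k : (N <= k)%N -> D k = 0%N.
  by move=> Nk; apply/eqP/negPn/negP => /piN; rewrite ltnNge Nk.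
pose C := (\sum_(i < N.+1) (if (2 <= i)%N then D i.-1 else 0))%N.
exists (C.*2 + 5)%N; split=> [|n nC fn xn]; first by rewrite addnS.
have [finH growth] : fin_total_dim (fun i => Defs.ker (homology_map R fn i)) /\
    (2 ^ n.-1)%N%:Z < (homological_poly R fn).[1].
  case: n nC @fn @xn => [|[|n]] nC; [lia|lia|].
  exact: power_growth.
have pi_n k := @pi_rat_power_ker R X Y f x0 n k (kerpi k).
have DnN k : (N <= k)%N -> Defs.dim (Defs.ker (pi_rat_map R fn xn k)) = 0%N.
  by move=> Nk; apply/eqP; rewrite -leqn0 (leq_trans (pi_n k).2) // -/(D k) DN // muln0.
split.
  split=> //; split=> [k|]; first by case: (pi_n k).
  apply: (sub_finite_set _ (finite_II N)) => k /= Dk; rewrite ltnNge; apply/negP => Nk.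
  by move: Dk; rewrite DnN.
apply: le_lt_trans growth; rewrite /homotopical_poly.
rewrite (@poincare_at1 (fun i => Defs.dim (Defs.ker (pi_rat_map R fn xn i.-1)))
  N.+1); last first.
  by move=> i Ni; apply: DnN; lia.
rewrite lez_nat; apply: leq_trans (leq_mul_exp2 nC); rewrite /C big_distrr /=.
apply: leq_sum => i _; case: ifP => // _.
by case: (pi_n i.-1).
Qed.
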